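(* Let $H_1$ denote the hypergeometric equation $E(k+\frac12,\ell+\frac12,\frac nm)$, where $k,\ell,m,n$ are positive integers, $m>1$ and $\gcd(n,m)=1$. Then: (1) The monodromy group of $H_1$ is the finite dihedral group with $2m$ elements. (2) The expression $$G(\sqrt x)=x^{k/2}\,F_3\!\left(\left.{k+1,\ell+1;-k,-\ell\atop 1+\frac nm}\right|\frac{\sqrt x+1}{2\sqrt x},\frac{1+\sqrt x}{2}\right)$$ is a polynomial in $\sqrt x$, and one can write $$(1+\sqrt x)^n\,G(\sqrt x)^m=\Theta_1(x)+x^{k+\frac12}\,\Theta_2(x),$$ so that $\Theta_1(x)$ and $\Theta_2(x)$ are polynomials in $x$. (3) Klein's pull-back covering for $H_1$ is given by the rational function $$\Phi(x)=\frac{x^{2k+1}\,\Theta_2(x)^2}{\Theta_1(x)^2}.$$ (4) The covering is unique up to Möbius transformations, and its degree is equal to $(k+\ell)m+n$.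
   Context: The hypergeometric equation $z(1-z)y''+(C-(A+B+1)z)y'-AB\,y=0$ has local exponent differences (up to sign) $1-C$ at $z=0$, $C-A-B$ at $z=1$, $A-B$ at $z=\infty$. $E(d_1,d_2,d_3)$ denotes a hypergeometric equation with local exponent differences $d_1,d_2,d_3$ (up to sign, in unimportant order) at its three singular points. A pull-back transformation from an equation in $z$ to an equation in $x$ is a substitution $z\mapsto\varphi(x)$, $y(z)\mapsto Y(x)=\theta(x)\,y(\varphi(x))$, with $\varphi$ a rational function (the pull-back covering $\mathbb{P}^1_x\to\mathbb{P}^1_z$) and $\theta$ a product of powers of rational functions. Klein's pull-back covering for $H_1$ is the covering $\varphi$ of a pull-back transformation to $H_1$ from the standard hypergeometric equation $H_0=E(\frac12,\frac12,\frac1m)$ with the same dihedral monodromy group. The explicit formula for $\Phi$ uses this normalization: the local exponent differences $k+\frac12$, $\ell+\frac12$, $\frac nm$ of $H_1$ are assigned to $x=0$, $x=\infty$, $x=1$ respectively, the differences $\frac12,\frac12,\frac1m$ of $H_0$ are assigned to $z=0$, $z=\infty$, $z=1$ respectively, and the point $x=0$ lies above $z=0$. Appell's function is $$F_3\!\left(\left.{u_1,u_2;v_1,v_2\atop b}\right|x,y\right)=\sum_{p\ge0}\sum_{q\ge0}\frac{(u_1)_p(u_2)_q(v_1)_p(v_2)_q}{(b)_{p+q}\,p!\,q!}x^py^q,$$ with $(a)_j=a(a+1)\cdots(a+j-1)$; here the sum is finite because $v_1=-k$, $v_2=-\ell$. *)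

(* Defs.v *)
From HB Require Import structures.
From mathcomp Require Import all_boot all_order all_algebra all_fingroup.
From mathcomp Require Import all_solvable.
From mathcomp Require Import complex.
From mathcomp Require Import all_classical all_reals all_analysis.

Set Implicit Arguments.
Unset Strict Implicit.
Unset Printing Implicit Defensive.

Import Order.TTheory GRing.Theory Num.Theory.
Import numFieldNormedType.Exports.

Local Open Scope classical_set_scope.
Local Open Scope ring_scope.
Local Open Scope complex_scope.

(* [\n_] and [\d_] of a representative need not be coprime, so the common
   factor is divided out: evaluation and degree refer to lowest terms. *)
Section RationalFunctions.
Variable F : fieldType.
Implicit Type f : {fraction {poly F}}.

Definition ratfun_num f : {poly F} :=
  let r := frac (generic_quotient.repr f) in r.1 %/ gcdp r.1 r.2.

Definition ratfun_den f : {poly F} :=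
  let r := frac (generic_quotient.repr f) in r.2 %/ gcdp r.1 r.2.

(* Meaningful where the reduced denominator does not vanish; the value is 0
   at a pole. *)
Definition ratfun_eval f (x : F) : F := (ratfun_num f).[x] / (ratfun_den f).[x].

(* The degree of [f] as a covering of the projective line by itself; it is 0
   exactly for constant functions. *)
Definition ratfun_degree f : nat :=
  maxn (size (ratfun_num f)).-1 (size (ratfun_den f)).-1.

Definition ratfun_const (c : F) : {fraction {poly F}} := tofrac c%:P.

(* [g] is the composition of [f] with a Moebius transformation acting on the
   values of [f]. *)
Definition moebius_equivalent f (g : {fraction {poly F}}) : Prop :=
  exists a b c d : F, a * d - b * c != 0 /\
    g = (ratfun_const a * f + ratfun_const b) /
        (ratfun_const c * f + ratfun_const d).

End RationalFunctions.

(* Convergence, germs and holomorphy on the complex plane R[i] refer to R[i]^o,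
   which carries the topology given by the modulus; [derivable] is then complex
   differentiability. *)

(* Holds the parameters of z(1-z) y'' + (C - (A+B+1) z) y' - A B y = 0. *)
Record hypergeometric_eq (R : realType) := HypergeometricEq {
  paramA : R[i]; paramB : R[i]; paramC : R[i] }.

Section Hypergeometric.
Variable R : realType.
Local Notation C := R[i].
Implicit Types (H : hypergeometric_eq R) (y F : C^o -> C^o).

(* In the order z = 0, z = 1, z = oo. *)
Definition exponent_differences H : seq C :=
  [:: 1 - paramC H; paramC H - paramA H - paramB H; paramA H - paramB H].

Definition eq_up_to_sign (a b : C) : bool := (a == b) || (a == - b).

Definition has_exponent_differences H (d0 d1 doo : C) : Prop :=
  all2 eq_up_to_sign (exponent_differences H) [:: d0; d1; doo].

(* H is an equation E(d1, d2, d3): the differences are matched up to sign and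
   in any order. *)
Definition is_E (d1 d2 d3 : C) H : Prop :=
  exists2 s : seq C, perm_eq s [:: d1; d2; d3] &
    all2 eq_up_to_sign (exponent_differences H) s.

(* [y] represents a germ at [z0] of a holomorphic solution of H. *)
Definition solves_near H (z0 : C^o) y : Prop :=
  \forall z \near z0,
    [/\ derivable y z 1, derivable (derive1 y) z 1 &
        z * (1 - z) * derive1 (derive1 y) z
        + (paramC H - (paramA H + paramB H + 1) * z) * derive1 y z
        - paramA H * paramB H * y z = 0].

(* Two independent germs at a regular point, hence a basis of the
   two-dimensional local solution space. *)
Definition solution_basis H (z0 : C^o) (y : 'I_2 -> C^o -> C^o) : Prop :=
  (forall i, solves_near H z0 (y i)) /\
  forall c : 'I_2 -> C,
    (\forall z \near z0, \sum_i c i * y i z = 0) -> forall i, c i = 0.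

Definition regular_loop (z0 : C^o) (gamma : R -> C^o) : Prop :=
  [/\ {within `[0, 1], continuous gamma},
      forall t, t \in `[0, 1] -> gamma t != 0 /\ gamma t != 1,
      gamma 0 = z0 & gamma 1 = z0].

(* Analytic continuation of solutions along [gamma]: [F t] represents the
   germ at [gamma t]. *)
Definition continuation_along H (gamma : R -> C^o)
    (F : R -> C^o -> C^o) : Prop :=
  forall t : R, t \in `[0, 1] ->
    solves_near H (gamma t) (F t) /\
    \forall s \near t, s \in `[0, 1] ->
      \forall z \near gamma s, F s z = F t z.

Definition monodromy_matrix H (z0 : C^o) (y : 'I_2 -> C^o -> C^o) (M : 'M[C]_2) :
    Prop :=
  exists (gamma : R -> C^o) (F : 'I_2 -> R -> C^o -> C^o),
    regular_loop z0 gamma /\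
    forall i, [/\ continuation_along H gamma (F i),
      \forall z \near z0, F i 0 z = y i z &
      \forall z \near z0, F i 1 z = \sum_j M i j * y j z].

(* The monodromy matrices modulo scalars, i.e. the image of the monodromy
   group in PGL_2, form a group isomorphic to gT. Exponent differences
   determine an equation only up to y |-> theta y, which changes monodromy
   matrices by scalar factors: "the monodromy group of E(d1, d2, d3)" is this
   projective group. *)
Definition monodromy_group_isog H (gT : finGroupType) : Prop :=
  forall (z0 : C^o) (y : 'I_2 -> C^o -> C^o),
    z0 != 0 -> z0 != 1 -> solution_basis H z0 y ->
    exists rho : 'M[C]_2 -> gT,
      [/\ forall g, exists2 M, monodromy_matrix H z0 y M & rho M = g,
          forall M N, monodromy_matrix H z0 y M -> monodromy_matrix H z0 y N ->
            rho (M *m N) = (rho M * rho N)%g &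
          forall M N, monodromy_matrix H z0 y M -> monodromy_matrix H z0 y N ->
            rho M = rho N <-> exists2 c : C, c != 0 & N = c *: M].

Definition cexp (z : C) : C :=
  (expR (complex.Re z))%:C * (cos (complex.Im z) +i* sin (complex.Im z)).

(* [theta] is, near [x0], a branch of the product of the powers
   [r i ^ a i]; [L i] is a branch of log (r i). *)
Definition power_product_branch (N : nat)
    (r : 'I_N -> {fraction {poly C}}) (a : 'I_N -> C) (x0 : C^o)
    (theta : C^o -> C^o) : Prop :=
  exists L : 'I_N -> C^o -> C^o,
    (forall i, \forall x \near x0,
       derivable (L i) x 1 /\ cexp (L i x) = ratfun_eval (r i) x) /\
    \forall x \near x0, theta x = \prod_i cexp (a i * L i x).

(* The substitution y(z) |-> theta(x) y(phi(x)) turns solutions of H0 into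
   solutions of H. As both are linear equations of order two, this may be
   tested at the points which are regular for H and do not lie above a
   singularity of H0; where some [r i] has a zero or a pole there is no branch
   [theta]. *)
Definition pullback_transformation (H0 H : hypergeometric_eq R)
    (phi : {fraction {poly C}}) : Prop :=
  (0 < ratfun_degree phi)%N /\
  exists (N : nat) (r : 'I_N -> {fraction {poly C}}) (a : 'I_N -> C),
    (forall i, r i != 0) /\
    forall x0 : C^o,
      x0 != 0 -> x0 != 1 -> (ratfun_den phi).[x0] != 0 ->
      ratfun_eval phi x0 != 0 -> ratfun_eval phi x0 != 1 ->
      forall y theta : C^o -> C^o,
        solves_near H0 (ratfun_eval phi x0) y ->
        power_product_branch r a x0 theta ->
        solves_near H x0 (fun x => theta x * y (ratfun_eval phi x)).

(* H0 = E(1/2, 1/2, 1/m) has the same dihedral monodromy group as H1, and phi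
   is the covering of a pull-back transformation from H0 to H1. *)
Definition klein_pullback (m : nat) (H0 H1 : hypergeometric_eq R)
    (phi : {fraction {poly C}}) : Prop :=
  [/\ is_E (1 / 2) (1 / 2) (1 / m%:R) H0,
      monodromy_group_isog H0 'D_(m.*2),
      monodromy_group_isog H1 'D_(m.*2) &
      pullback_transformation H0 H1 phi].

Definition klein_covering (m : nat) (H1 : hypergeometric_eq R)
    (phi : {fraction {poly C}}) : Prop :=
  exists H0, klein_pullback m H0 H1 phi.

Definition pochhammer (a : C) (j : nat) : C := \prod_(i < j) (a + i%:R).

(* The double series is summed over q first. *)
Definition appellF3 (u1 u2 v1 v2 b x y : C) : C^o :=
  let term p q : C^o :=
    pochhammer u1 p * pochhammer u2 q * pochhammer v1 p * pochhammer v2 q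
    / (pochhammer b (p + q) * p`!%:R * q`!%:R) * x ^+ p * y ^+ q in
  limn (series (fun p => limn (series (term p)))).

End Hypergeometric.

(* Main.v *)
Require Import Defs.
From HB Require Import structures.
From mathcomp Require Import all_boot all_order all_algebra all_fingroup.
From mathcomp Require Import all_solvable.
From mathcomp Require Import complex.
From mathcomp Require Import all_classical all_reals all_analysis.
From mathcomp Require Import ring lra zify.

Set Implicit Arguments.
Unset Strict Implicit.
Unset Printing Implicit Defensive.

Import Order.TTheory GRing.Theory Num.Theory.
Import numFieldNormedType.Exports.

Local Open Scope ring_scope.
Local Open Scope complex_scope.

(** Let [a = n / m]. A Moebius involution [w] of the [x]-line puts the exponent
    difference [n / m] at [w = 1] and the other two at 0 and infinity. With
    [s ^ 2 = w] and [U = log ((1 + s) / (1 - s))] the equation has the two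
    solutions [x^al (1 - x)^be exp (a U / 2) G(s)] and
    [x^al (1 - x)^be exp (- a U / 2) G(- s)] ([ode_identity], [sol_fundamental]),
    where [G] is the polynomial given by Appell's sum: the sum telescopes when
    the differential operator is applied to its terms ([klein_op_double_sum]).
    The Wronskian of the two solutions is a multiple of [s^(2 k)]
    ([klein_wronskianE]); this and the equation for [G] give the degree of [G],
    [G(0) <> 0], [G(1) <> 0] and the absence of common roots of [G(s)] and
    [G(- s)].

    Monodromy. Continuation replaces [s] by [+- s] and [U] by [+- U + 2 pi i j],
    so that up to scalars the solutions undergo a dihedral transformation
    ([monodromy_dihedral], by real induction along the path). In the coordinate
    [U] the singular points are the multiples of [pi i], and paths from [U] to
    [+- U + 2 pi i j] realize all these transformations ([realize_loop]).
    Together this gives [dihedral_monodromy], which applies also to the standard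
    equation, the case [k = l = 0], [n = 1], [G = 1].

    The covering. Put [P(s) = (1 + s)^n G(s)^m]. The Wronskian of [P(s)] and
    [P(- s)] vanishes to order [2 k] at 0, so that the odd part of [P] is
    divisible by [s^(2 k + 1)] ([theta_split]). For
    [s0 = s^(2 k + 1) Theta2 / Theta1] the quotient [(1 + s0) / (1 - s0)] equals
    [P(s) / P(- s)], the [m]-th power of the quotient of the two solutions of
    [H1]; the [m]-th root of the left-hand side is the quotient of the two
    solutions of the standard equation at [s0 ^ 2 = Phi(x)]. Hence [Phi] is the
    covering of a pull-back transformation ([Phi_pullback]).

    Uniqueness and degree. In the coordinate [t = exp (U / m)] the point [x] is a
    rational function of degree [2 m], and the quotient of the solutions of [H1]
    is a rational function [f] of degree [n + m (k + l)]. If [phi] is the covering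
    of any pull-back transformation from a standard equation, the quotient of the
    solutions of the latter is a Moebius function [g] of [f], and [phi(x)] is a
    Moebius function of [g^m + g^(- m)] ([pullback_relation]). Comparison of the
    degrees in [t] gives [deg phi = n + m (k + l)]. As [x] is invariant under
    [t |-> zeta t], for [zeta ^ m = 1], and under [t |-> 1 / t], while these act
    on [f] by [zeta^n f] and [1 / f], the numerator and the denominator of [phi]
    are combinations of the invariant forms of degree [2 m] in [f]
    ([klein_form]). There are only two of these, so that any two such coverings
    differ by a Moebius transformation. *)

(** * Complex derivatives *)

Section DerivativeOverField.
Local Open Scope classical_set_scope.
Local Open Scope ring_scope.

Lemma is_derive1_comp_num (K : numFieldType) (f g : K^o -> K^o) (x a b : K^o) :
  is_derive x 1 f a -> is_derive (f x) 1 g b ->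
  is_derive x 1 (fun z => g (f z)) (a * b).
Proof.
move=> [df <-] [dg <-].
have d1 := (derivable1_diffP f x).1 df.
have d2 := (derivable1_diffP g (f x)).1 dg.
have d3 := differentiable_comp d1 d2.
split; first exact/derivable1_diffP.
rewrite -!derive1E [LHS](derive1E' d3) (diff_comp d1 d2) /=.
have e1 : 'd f x 1 = f^`()%classic x by rewrite (derive1E' d1).
have e2 := congr1 (fun h : K^o -> K^o => h ('d f x 1)) (deriv1E dg).
by rewrite -e1; exact: e2.
Qed.

(** The quotient of differences is replaced by a bound without division, from
    which derivatives can be transferred between the real and the complex
    field. *)
Lemma is_derive1_epsP (K : numFieldType) (f : K^o -> K^o) (x d : K^o) :
  is_derive x 1 f d <->
  forall e : K, 0 < e ->
    \forall h \near (0 : K^o), `|f (x + h) - f x - d * h| <= e * `|h|.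
Proof.
have quotE h : h != 0 ->
    `|d - h^-1 * (f (h * 1 + x) - f x)| = `|f (x + h) - f x - d * h| / `|h|.
  move=> h0; rewrite -normfV -normrM distrC mulr1 [h + x]addrC; congr `|_|.
  by field.
split=> [[df dE] e e0|fP].
  have /cvgrPdist_le /(_ e e0) : (fun h : K^o => h^-1 *: ((f \o shift x) (h *: (1 : K^o)) - f x))
      @ 0^'%classic --> d by rewrite -dE; exact: df.
  rewrite !near_withinE; apply: filterS => h hP.
  have [->|h0] := eqVneq h 0; first by rewrite addr0 subrr mulr0 subrr !normr0 mulr0.
  by move: (hP h0); rewrite /= /GRing.scale /= quotE // ler_pdivrMr // normr_gt0.
have cv : (fun h : K^o => h^-1 *: ((f \o shift x) (h *: (1 : K^o)) - f x))
      @ 0^'%classic --> d.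
  apply/cvgrPdist_le => e e0; rewrite !near_withinE; move: (fP e e0).
  apply: filterS => h hP h0.
  by rewrite /= /GRing.scale /= quotE // ler_pdivrMr // normr_gt0.
split; first by apply/cvg_ex; exists d.
exact/cvg_lim.
Qed.

End DerivativeOverField.

Section ComplexAnalysis.
Local Open Scope classical_set_scope.
Local Open Scope ring_scope.
Local Open Scope complex_scope.
Variable R : realType.
Local Notation C := R[i].
Implicit Types f g : C -> C.

(** The norm of [R[i]] takes its values in [R[i]]; estimates are made in [R],
    with this function. *)
Definition modulus (z : C) : R := Normc.normc z.

Lemma normE (z : C) : `|z| = (modulus z)%:C.
Proof. by []. Qed.

Lemma modulus_ge0 z : 0 <= modulus z.
Proof. by rewrite -ler0c -normE. Qed.
Lemma modulus0 : modulus 0 = 0. Proof. exact: Normc.normc0. Qed.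
Lemma modulusM x y : modulus (x * y) = modulus x * modulus y.
Proof. exact: Normc.normcM. Qed.
Lemma modulusV x : modulus x^-1 = (modulus x)^-1.
Proof. exact: Normc.normcV. Qed.
Lemma modulusN x : modulus (- x) = modulus x.
Proof. exact: normcN. Qed.
Lemma modulusD x y : modulus (x + y) <= modulus x + modulus y.
Proof. exact: le_normcD. Qed.
Lemma modulusB x y : modulus (x - y) = modulus (y - x).
Proof. by rewrite -modulusN opprB. Qed.
Lemma modulus_eq0 x : (modulus x == 0) = (x == 0).
Proof. by apply/eqP/eqP => [/Normc.eq0_normc //|->]; rewrite modulus0. Qed.
Lemma modulus_gt0 x : (0 < modulus x) = (x != 0).
Proof. by rewrite lt_def modulus_ge0 andbT modulus_eq0. Qed.
Lemma modulusR (x : R) : modulus x%:C = `|x|.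
Proof. by rewrite /modulus /= expr0n /= addr0 sqrtr_sqr. Qed.
Lemma modulus_sqr (z : C) : modulus z ^+ 2 = complex.Re z ^+ 2 + complex.Im z ^+ 2.
Proof. by case: z => a b; rewrite /modulus sqr_sqrtr // addr_ge0 ?sqr_ge0. Qed.
Lemma modulus_geRe (z : C) : `|complex.Re z| <= modulus z.
Proof.
rewrite -(@ler_pXn2r _ 2) ?nnegrE ?modulus_ge0 //.
by rewrite modulus_sqr real_normK ?num_real // lerDl sqr_ge0.
Qed.
Lemma modulus_geIm (z : C) : `|complex.Im z| <= modulus z.
Proof.
rewrite -(@ler_pXn2r _ 2) ?nnegrE ?modulus_ge0 //.
by rewrite modulus_sqr real_normK ?num_real // lerDr sqr_ge0.
Qed.
Lemma modulus_leReIm (z : C) : modulus z <= `|complex.Re z| + `|complex.Im z|.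
Proof.
rewrite -(@ler_pXn2r _ 2) ?nnegrE ?modulus_ge0 ?addr_ge0 // modulus_sqr sqrrD !real_normK ?num_real //.
by rewrite -addrA lerD2l lerDr mulrn_wge0 // mulr_ge0.
Qed.

Lemma gt0_complexP (e : C) : 0 < e -> exists2 r : R, 0 < r & e = r%:C.
Proof. by case: e => a b; rewrite ltcE /= => /andP[/eqP -> a0]; exists a. Qed.

Lemma near_modulusP (x : C) (P : C -> Prop) :
  (\forall z \near (x : C^o), P z) <->
  exists2 e : R, 0 < e & forall z, modulus (z - x) < e -> P z.
Proof.
split.
  move=> /nbhs_ballP[e /= /gt0_complexP[r r0 ->]] h.
  exists r => // z zx; apply: h => /=.
  by rewrite /ball /= normE ltcR modulusB.
move=> [e e0 h]; apply/nbhs_ballP; exists e%:C => /=; first by rewrite ltcR.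
by move=> z; rewrite /ball /= normE ltcR modulusB => /h.
Qed.

Lemma near_radius (x : C) (e : R) : 0 < e -> \forall z \near (x : C^o), modulus (z - x) < e.
Proof. by move=> e0; apply/near_modulusP; exists e. Qed.

Definition cder f (x d : C) : Prop := is_derive (x : C^o) (1 : C^o) (f : C^o -> C^o) (d : C^o).

Lemma cder_epsP f (x d : C) : cder f x d <->
  forall e : R, 0 < e -> exists2 r : R, 0 < r &
    forall z, modulus (z - x) < r ->
      modulus (f z - f x - d * (z - x)) <= e * modulus (z - x).
Proof.
split=> [/is_derive1_epsP h e e0|h].
  have /near_modulusP[r r0 hr] : \forall h \near (0 : C^o), `|f (x + h) - f x - d * h| <= e%:C * `|h|.
    by apply: h; rewrite ltcR.
  exists r => // z zx; have := hr (z - x); rewrite subr0 => /(_ zx).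
  by rewrite [x + _]addrC subrK !normE -rmorphM lecR.
apply/is_derive1_epsP => e /gt0_complexP[r r0 ->].
have [q q0 hq] := h r r0.
apply/near_modulusP; exists q => // z; rewrite subr0 => zq.
have := hq (x + z); rewrite [x + z]addrC addrK => /(_ zq).
by rewrite !normE -rmorphM lecR.
Qed.

Lemma cder_cst (c x : C) : cder (fun=> c) x 0.
Proof. exact: is_derive_cst. Qed.
Lemma cder_id (x : C) : cder id x 1.
Proof. exact: is_derive_id. Qed.
Lemma cderD f g (x a b : C) :
  cder f x a -> cder g x b -> cder (fun z => f z + g z) x (a + b).
Proof. by move=> h1 h2; have h := @is_deriveD C C^o C^o f g _ _ _ _ h1 h2; exact h. Qed.
Lemma cderM f g (x a b : C) : cder f x a -> cder g x b ->
  cder (fun z => f z * g z) x (a * g x + f x * b).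
Proof.
move=> h1 h2; have h := @is_deriveM C C^o f g _ _ _ _ h1 h2.
by apply: (is_derive_eq h); rewrite /GRing.scale /= addrC [g x * a]mulrC.
Qed.
Lemma cderV f (x a : C) : f x != 0 -> cder f x a ->
  cder (fun z => (f z)^-1) x (- a / f x ^+ 2).
Proof.
move=> fx [df <-]; split.
  exact: (@derivableV _ _ (f : C^o -> C)).
rewrite (@deriveV _ _ (f : C^o -> C)) //.
by rewrite /GRing.scale /= mulrC mulrN mulNr.
Qed.
Lemma cder_comp f g (x a b : C) : cder f x a -> cder g (f x) b ->
  cder (fun z => g (f z)) x (a * b).
Proof. exact: is_derive1_comp_num. Qed.
Lemma cder_near f g (x a : C) :
  (\forall z \near (x : C^o), f z = g z) -> cder f x a -> cder g x a.
Proof. by move=> h; apply: near_eq_is_derive. Qed.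
Lemma cder_continuous f (x a : C) : cder f x a -> {for (x : C^o), continuous (f : C^o -> C^o)}.
Proof.
by move=> [df _]; apply: differentiable_continuous; apply/derivable1_diffP.
Qed.
Lemma cder_eq f (x a b : C) : cder f x a -> a = b -> cder f x b.
Proof. by move=> h <-. Qed.
Lemma cder_unique f (x a b : C) : cder f x a -> cder f x b -> a = b.
Proof. by move=> [_ <-] [_ <-]. Qed.
Lemma cderZ f (c x a : C) : cder f x a -> cder (fun z => c * f z) x (c * a).
Proof.
by move=> h; apply: cder_eq (cderM (cder_cst c x) h) _; rewrite mul0r add0r.
Qed.
Lemma cderN f (x a : C) : cder f x a -> cder (fun z => - f z) x (- a).
Proof. by move=> h; have k := @is_deriveN C C^o C^o f _ _ _ h; exact k. Qed.
Lemma cderB f g (x a b : C) :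
  cder f x a -> cder g x b -> cder (fun z => f z - g z) x (a - b).
Proof. by move=> h1 h2; apply: cderD => //; apply: cderN. Qed.
Lemma cderX f n (x a : C) : cder f x a ->
  cder (fun z => f z ^+ n) x (n%:R * a * f x ^+ n.-1).
Proof.
move=> h; elim: n => [|n IH].
  by rewrite !mul0r; apply: cder_near (cder_cst 1 x); near=> z; rewrite expr0.
apply: (@cder_near (fun z => f z * f z ^+ n)).
  by near=> z; rewrite exprS.
apply: cder_eq (cderM h IH) _; case: n {IH} => [|n] /=; first by ring.
by rewrite !exprS; ring.
Unshelve. all: by end_near. Qed.

Lemma cder_poly (p : {poly C}) (x : C) : cder (fun z => p.[z]) x (p^`()).[x].
Proof.
elim/poly_ind: p => [|p c IH].
  by rewrite deriv0 horner0; apply: cder_near (cder_cst 0 x); near=> z; rewrite horner0.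
apply: (@cder_near (fun z => p.[z] * z + c)).
  by near=> z; rewrite !hornerE.
apply: cder_eq (cderD (cderM IH (cder_id x)) (cder_cst c x)) _.
by rewrite derivD derivC addr0 derivM derivX !hornerE.
Unshelve. all: by end_near. Qed.

(** The real mean value theorem applies to the real and imaginary parts along
    the segment from the centre. *)
Lemma cder0_const f (x : C) (r : R) : 0 < r ->
  (forall z, modulus (z - x) < r -> cder f z 0) ->
  forall z, modulus (z - x) < r -> f z = f x.
Proof.
move=> r0 df z zr.
have key (phi : C -> R) : (forall u v, phi (u - v) = phi u - phi v) ->
    (forall u, `|phi u| <= modulus u) -> phi (f z) = phi (f x).
  move=> phiB phi_le.
  pose g (t : R) : R := phi (f (x + t%:C * (z - x))).
  have dg (t : R) : t \in `[0, 1] -> is_derive (t : R^o) (1 : R^o) (g : R^o -> R^o) 0.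
    move=> t01; apply/is_derive1_epsP => e e0.
    have tr : modulus (x + t%:C * (z - x) - x) < r.
      rewrite addrAC subrr add0r modulusM modulusR.
      apply: le_lt_trans zr; rewrite ler_piMl ?modulus_ge0 // ler_norml.
      by move: t01; rewrite in_itv /= => /andP[??]; lra.
    have m0 : 0 < modulus (z - x) + 1 by rewrite ltr_wpDl ?modulus_ge0.
    have [q q0 hq] := (cder_epsP f _ 0).1 (df _ tr) (e / (modulus (z - x) + 1)) (divr_gt0 e0 m0).
    apply/nbhs_ballP; exists (q / (modulus (z - x) + 1)) => /=; first exact: divr_gt0.
    move=> h; rewrite /ball /= sub0r normrN => hh.
    have hE : x + (t + h)%:C * (z - x) - (x + t%:C * (z - x)) = h%:C * (z - x).
      by rewrite rmorphD /=; ring.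
    have hb : `|h| * modulus (z - x) <= `|h| * (modulus (z - x) + 1).
      by rewrite ler_wpM2l // lerDl.
    have := hq (x + (t + h)%:C * (z - x)); rewrite hE modulusM modulusR => /(_ _)/wrap[].
      apply: le_lt_trans hb _; by rewrite -ltr_pdivlMr.
    rewrite mul0r !subr0 => hf; rewrite mul0r subr0 /g -phiB.
    apply: le_trans (phi_le _) _; apply: le_trans hf _.
    rewrite -mulrA ler_wpM2l ?(ltW e0) // mulrC ler_pdivrMr //.
  have gc : {within `[0, 1], continuous g}%classic.
    by apply: (@derivable_within_continuous R R^o) => u u01; have [] := dg u u01.
  have dg0 (t : R) : t \in `]0, 1[ -> is_derive t 1 g 0.
    by move=> t01; apply: dg; move: t01; rewrite !in_itv /= => /andP[? ?]; rewrite !ltW.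
  have g01 : g 1 - g 0 = 0.
    have [c cin] := MVT_segment (df := fun=> 0) (ler01 : (0 : R) <= 1) dg0 gc.
    by rewrite mul0r.
  move: g01; rewrite /g rmorph1 rmorph0 mul1r mul0r addr0 [x + _]addrC subrK => /eqP.
  by rewrite subr_eq0 => /eqP.
have e1 := key _ (raddfB (@complex.Re R : {additive Rcomplex R -> R})) modulus_geRe.
have e2 := key _ (raddfB (@complex.Im R : {additive Rcomplex R -> R})) modulus_geIm.
by apply/eqP; rewrite eq_complex e1 e2 !eqxx.
Qed.

Lemma near_cder0_const f (x : C) : (\forall z \near (x : C^o), cder f z 0) ->
  \forall z \near (x : C^o), f z = f x.
Proof.
move=> /near_modulusP[r r0 h]; apply/near_modulusP; exists r => //.
exact: cder0_const h.
Qed.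

End ComplexAnalysis.

(** * The complex exponential *)

Section ComplexExponential.
Variable R : realType.
Local Notation C := R[i].
Local Open Scope classical_set_scope.
Local Open Scope ring_scope.
Local Open Scope complex_scope.
Implicit Types f g : C -> C.

Lemma cexpE (a b : R) : cexp (a +i* b) = (expR a * cos b) +i* (expR a * sin b).
Proof. by rewrite /cexp /=; simpc; rewrite ?mul0r ?subr0 ?addr0. Qed.

Lemma cexp0 : cexp 0 = 1 :> C.
Proof. by rewrite cexpE expR0 cos0 sin0 mulr1 mulr0. Qed.

Lemma cexpD (x y : C) : cexp (x + y) = cexp x * cexp y.
Proof.
case: x y => [a b] [c d]; simpc; rewrite !cexpE expRD cosD sinD.
by simpc; congr (_ +i* _); ring.
Qed.

Lemma cexpN (x : C) : cexp (- x) = (cexp x)^-1.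
Proof.
have h : cexp x * cexp (- x) = 1 by rewrite -cexpD subrr cexp0.
have x0 : cexp x != 0.
  by apply/eqP => e; move: h; rewrite e mul0r => /eqP; rewrite eq_sym oner_eq0.
by apply: (mulfI x0); rewrite h divff.
Qed.

Lemma cexp_neq0 (x : C) : cexp x != 0.
Proof.
apply/eqP => e; have : cexp x * cexp (- x) = 1 by rewrite -cexpD subrr cexp0.
by rewrite e mul0r => /eqP; rewrite eq_sym oner_eq0.
Qed.

Lemma cexpB (x y : C) : cexp (x - y) = cexp x / cexp y.
Proof. by rewrite cexpD cexpN. Qed.

Lemma cexpMn n (x : C) : cexp (n%:R * x) = cexp x ^+ n.
Proof.
elim: n => [|n IH]; first by rewrite mul0r cexp0.
by rewrite -natr1 mulrDl mul1r cexpD IH exprSr.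
Qed.

Lemma modulus_cexp (z : C) : modulus (cexp z) = expR (complex.Re z).
Proof.
case: z => a b; rewrite cexpE /modulus /=.
rewrite !exprMn -mulrDr cos2Dsin2 mulr1 sqrtr_sqr ger0_norm ?expR_ge0 //.
Qed.

Lemma real_der0 (f : R -> R) (d : R) : is_derive (0 : R) (1 : R) f d ->
  forall e : R, 0 < e -> exists2 r : R, 0 < r &
    forall h, `|h| < r -> `|f h - f 0 - d * h| <= e * `|h|.
Proof.
move=> /is_derive1_epsP h e /h /nbhs_ballP[r r0 hr].
exists r => // x xr; have := hr x; rewrite /ball /= sub0r normrN add0r; exact.
Qed.

(** The addition theorem reduces the statement to [z = 0], where it follows
    from the real derivatives of [expR], [cos] and [sin]. *)
Lemma cder_cexp (z : C) : cder (@cexp R) z (cexp z).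
Proof.
have cder0 : cder (@cexp R) 0 1.
  apply/cder_epsP => e e0.
  (* The four error terms below add up to at most [8 k] times the modulus. *)
  pose k := Num.min (e / 8) 1.
  have k0 : 0 < k by rewrite lt_min ltr01 andbT divr_gt0.
  have k1 : k <= 1 by rewrite ge_min lexx orbT.
  have k8 : 8 * k <= e by rewrite mulrC -ler_pdivlMr // ge_min lexx.
  clearbody k.
  have [r1 r10 H1] := real_der0 (is_derive_expR 0) k0.
  have [r2 r20 H2] := real_der0 (is_derive_cos 0) k0.
  have [r3 r30 H3] := real_der0 (is_derive_sin 0) k0.
  exists (Num.min (Num.min r1 r2) (Num.min r3 k)).
    by rewrite !lt_min r10 r20 r30 k0.
  move=> [a b]; rewrite subr0 !lt_min => /andP[/andP[h1 h2] /andP[h3 hk]].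
  have ha := le_lt_trans (modulus_geRe (a +i* b)); have hb := le_lt_trans (modulus_geIm (a +i* b)).
  move: (H1 a (ha _ h1)) (H2 b (hb _ h2)) (H3 b (hb _ h3)).
  have {ha}hak := ha _ hk; have {hb}hbk := hb _ hk; rewrite /= in hak hbk.
  rewrite expR0 cos0 sin0 ?oppr0 ?mul0r ?subr0 ?addr0 !mul1r => E1 E2 E3.
  rewrite cexp0 cexpE.
  have -> : (expR a * cos b +i* (expR a * sin b)) - 1 - (a +i* b) =
     ((expR a - 1 - a) * cos b + (1 + a) * (cos b - 1)) +i*
     ((expR a - 1) * sin b + (sin b - b)).
    by rewrite -[1]/(1 +i* 0); simpc; congr (_ +i* _); ring.
  apply: le_trans (modulus_leReIm _) _ => /=.
  have M0 := modulus_ge0 (a +i* b).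
  have Ma : `|a| <= modulus (a +i* b) := modulus_geRe (a +i* b).
  have Mb : `|b| <= modulus (a +i* b) := modulus_geIm (a +i* b).
  set M := modulus _ in M0 Ma Mb hk *.
  have T1 : `|(expR a - 1 - a) * cos b| <= k * M.
    rewrite normrM; apply: le_trans (_ : `|expR a - 1 - a| * 1 <= _).
      by rewrite ler_wpM2l // cos_max.
    by rewrite mulr1; apply: le_trans E1 _; rewrite ler_wpM2l // ltW.
  have T2 : `|(1 + a) * (cos b - 1)| <= 2 * k * M.
    rewrite normrM -mulrA; apply: ler_pM => //.
      by apply: le_trans (ler_normD _ _) _; rewrite normr1; lra.
    by apply: le_trans E2 _; rewrite ler_wpM2l // ltW.
  have T3 : `|sin b - b| <= k * M.
    by apply: le_trans E3 _; rewrite ler_wpM2l // ltW.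
  have T4 : `|(expR a - 1) * sin b| <= 2 * k * (2 * M).
    rewrite normrM; apply: ler_pM => //.
      have -> : expR a - 1 = (expR a - 1 - a) + a by ring.
      apply: le_trans (ler_normD _ _) _.
      have : k * `|a| <= 1 * `|a| by rewrite ler_wpM2r.
      rewrite mul1r; lra.
    have -> : sin b = (sin b - b) + b by ring.
    apply: le_trans (ler_normD _ _) _.
    have : k * `|b| <= 1 * `|b| by rewrite ler_wpM2r.
    rewrite mul1r; lra.
  apply: le_trans (_ : 8 * k * M <= _); last by rewrite ler_wpM2r.
  have := ler_normD ((expR a - 1 - a) * cos b) ((1 + a) * (cos b - 1)).
  have := ler_normD ((expR a - 1) * sin b) (sin b - b).
  lra.
have h : cder (fun w => cexp z * cexp (w - z)) z (cexp z * (1 * 1)).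
  apply: cderZ; apply: (@cder_comp R (fun w => w - z) (@cexp R) z).
    by apply: cder_eq (cderB (cder_id z) (cder_cst z z)) _; rewrite subr0.
  by rewrite subrr.
apply: cder_eq (cder_near _ h) _; last by rewrite !mulr1.
by near=> w; rewrite -cexpD addrC subrK.
Unshelve. all: by end_near. Qed.

Lemma cder_cexp_comp f (x a : C) : cder f x a -> cder (fun z => cexp (f z)) x (a * cexp (f x)).
Proof. by move=> h; apply: cder_comp h (cder_cexp _). Qed.

Lemma cexp_eq1 (z : C) : cexp z = 1 -> exists j : int, z = (pi *+ 2 *~ j)%:C * 'i.
Proof.
case: z => a b h.
have a0 : a = 0.
  by move/(congr1 (@modulus R)): h; rewrite modulus_cexp modulusR normr1 -expR0 => /expR_inj.
move: h; rewrite a0 cexpE expR0 !mul1r => -[cb sb].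
pose T : R := pi *+ 2.
have T0 : 0 < T by rewrite /T mulrn_wgt0 // pi_gt0.
pose j := Num.floor (b / T).
pose c := b - T * j%:~R.
have /andP[j1 j2] := real_floor_itv (num_real (b / T)).
have c0 : 0 <= c by rewrite subr_ge0 mulrC -ler_pdivlMr.
have cT : c < T.
  rewrite ltrBlDl -[X in _ < _ + X]mulr1 -mulrDr mulrC -ltr_pdivrMr //.
  by move: j2; rewrite intrD.
have cosp (x : R) (i : int) : cos (x + T * i%:~R) = cos x.
  have cosn n : forall y, cos (y + T * n%:R) = cos y.
    by move=> y; rewrite mulr_natr /T; exact: (periodicn (@cosD2pi R)).
  case: i => n; first exact: cosn.
  by rewrite NegzE rmorphN /= mulrN -(cosn n.+1 (x - _)) subrK.
have cc : cos c = 1 by rewrite -cb -(cosp c j) /c subrK.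
suff c_eq0 : c = 0.
  exists j; move/eqP: c_eq0; rewrite subr_eq0 mulrzr => /eqP ->.
  by apply/eqP; rewrite eq_complex /= !(mul0r, mulr0, mulr1, addr0, subr0) !eqxx.
have [cpi|picl] := leP c pi.
  by apply: (@cos_inj R); rewrite ?in_itv /= ?c0 ?cpi ?lexx ?pi_ge0 // cos0.
have dT : T - c = 0.
  apply: (@cos_inj R); rewrite ?in_itv /= ?lexx ?pi_ge0 //.
    by move: cT picl; rewrite /T mulr2n; lra.
  rewrite cos0 -cc -cosN opprB -[RHS](cosp c (-1)).
  by congr cos; rewrite mulrN1.
by move: cT; rewrite -subr_gt0 dT ltxx.
Qed.

Lemma cexp_onto (w : C) : w != 0 -> exists z, cexp z = w.
Proof.
move=> w0; have m0 : 0 < modulus w by rewrite modulus_gt0.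
pose c := complex.Re w / modulus w.
have c1 : -1 <= c <= 1.
  by rewrite -ler_norml normrM normfV (gtr0_norm m0) ler_pdivrMr // mul1r modulus_geRe.
have sE : Num.sqrt (1 - c ^+ 2) = `|complex.Im w| / modulus w.
  have -> : 1 - c ^+ 2 = (complex.Im w / modulus w) ^+ 2.
    rewrite /c !exprMn !exprVn -[1](@divff _ (modulus w ^+ 2)) ?expf_neq0 ?gt_eqF //.
    by rewrite -mulrBl modulus_sqr; congr (_ / _); ring.
  by rewrite sqrtr_sqr normrM normfV (gtr0_norm m0).
have e1 : modulus w * cos (acos c) = complex.Re w.
  by rewrite acosK ?in_itv // mulrC divfK ?gt_eqF.
have e2 : modulus w * sin (acos c) = `|complex.Im w|.
  by rewrite sin_acos // sE mulrC divfK ?gt_eqF.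
have [i0|i0] := leP 0 (complex.Im w).
  exists (ln (modulus w) +i* acos c).
  by rewrite cexpE lnK ?posrE // e1 e2 ger0_norm //; case: (w).
exists (ln (modulus w) +i* - acos c).
by rewrite cexpE lnK ?posrE // cosN sinN mulrN e1 e2 ltr0_norm // opprK; case: (w).
Qed.

(** [asin] is the argument of [z] only in the right half-plane, where this is
    the principal logarithm. *)
Definition Log (z : C) : C := ln (modulus z) +i* asin (complex.Im z / modulus z).

Lemma Log1 : Log 1 = 0.
Proof.
rewrite /Log modulusR normr1 ln1 /= mul0r -[in asin 0](@sin0 R) sinK //.
by rewrite in_itv /= oppr_le0 divr_ge0 ?pi_ge0. Qed.

Lemma Re_gt0_slope (z : C) : 0 < complex.Re z -> 0 < modulus z /\ -1 < complex.Im z / modulus z < 1.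
Proof.
move=> z0; have m0 : 0 < modulus z.
  by apply: lt_le_trans z0 _; apply: le_trans (ler_norm _) (modulus_geRe z).
split => //; rewrite -ltr_norml normrM normfV (gtr0_norm m0) ltr_pdivrMr // mul1r.
rewrite -(@ltr_pXn2r _ 2) ?nnegrE ?modulus_ge0 //.
by rewrite modulus_sqr real_normK ?num_real // ltrDr exprn_gt0.
Qed.

Lemma cexp_Log (z : C) : 0 < complex.Re z -> cexp (Log z) = z.
Proof.
move=> z0; have [m0 /andP[s1 s2]] := Re_gt0_slope z0.
rewrite cexpE lnK ?posrE // asinK ?in_itv /= ?ltW // cos_asin ?ltW //.
have -> : 1 - (complex.Im z / modulus z) ^+ 2 = (complex.Re z / modulus z) ^+ 2.
  rewrite !exprMn !exprVn -[1](@divff _ (modulus z ^+ 2)) ?expf_neq0 ?gt_eqF //.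
  by rewrite -mulrBl modulus_sqr; congr (_ / _); ring.
rewrite sqrtr_sqr normrM normfV (gtr0_norm m0) (gtr0_norm z0).
by rewrite !(mulrC (modulus z)) !divfK ?gt_eqF //; case: (z).
Qed.

Lemma lipschitz_continuous (phi : C -> R) : (forall u v, `|phi u - phi v| <= modulus (u - v)) ->
  forall z : C^o, {for z, continuous (phi : C^o -> R^o)}.
Proof.
move=> h z; apply/(@cvgrPdist_lt R R^o C^o (nbhs z) _) => e e0; apply/near_modulusP; exists e => // w wz.
by apply: le_lt_trans (h _ _) _; rewrite modulusB.
Qed.

Lemma continuous_modulus (z : C^o) : {for z, continuous (@modulus R : C^o -> R^o)}.
Proof.
apply: lipschitz_continuous => u v; rewrite ler_norml; apply/andP; split.
  by rewrite lerNl opprB lerBlDr modulusB; apply: le_trans (modulusD _ _); rewrite subrK.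
by rewrite lerBlDr; apply: le_trans (modulusD _ _); rewrite subrK.
Qed.

Lemma continuous_Im (z : C^o) : {for z, continuous (@complex.Im R : C^o -> R^o)}.
Proof. by apply: lipschitz_continuous => u v; rewrite -(raddfB (@complex.Im R : {additive Rcomplex R -> R})) modulus_geIm. Qed.

Lemma cvg_complex (T : Type) (F : set_system T) (FF : Filter F) (a b : T -> R^o) (x y : R^o) :
  a @ F --> x -> b @ F --> y -> (fun t => (a t +i* b t) : C^o) @ F --> ((x +i* y) : C^o).
Proof.
move=> /cvgrPdist_lt ha /cvgrPdist_lt hb; apply/cvgrPdist_lt => e /gt0_complexP[r r0 ->].
have r2 : 0 < r / 2 by rewrite divr_gt0.
move: (ha _ r2) (hb _ r2); apply: filterS2 => t h1 h2.
rewrite normE ltcR; apply: le_lt_trans (modulus_leReIm _) _ => /=.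
by rewrite [r]splitr ltrD.
Qed.

Lemma continuous_Log (z : C^o) : 0 < complex.Re z -> {for z, continuous (Log : C^o -> C^o)}.
Proof.
move=> z0; have [m0 s1] := Re_gt0_slope z0.
have h1 : (fun w : C^o => ln (modulus w) : R^o) @ z --> (ln (modulus z) : R^o).
  by apply: (cvg_comp (@modulus R : C^o -> R^o) _ (@continuous_modulus z)); exact: continuous_ln.
have h2 : (fun w : C^o => asin (complex.Im w / modulus w) : R^o) @ z --> (asin (complex.Im z / modulus z) : R^o).
  apply: (cvg_comp (fun w : C^o => complex.Im w / modulus w : R^o) (@asin R : R^o -> R^o) _ (continuous_asin s1)).
  have h3 : (fun w : C^o => (modulus w)^-1 : R^o) @ z --> ((modulus z)^-1 : R^o).
    exact: (@cvgV R C^o (nbhs z) _ (@modulus R) _ (lt0r_neq0 m0) (@continuous_modulus z)).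
  have h4 : (fun w : C^o => complex.Im w : R^o) @ z --> (complex.Im z : R^o) by exact: continuous_Im.
  exact: (@cvgM R C^o (nbhs z) _ _ _ _ _ h4 h3).
exact: cvg_complex h1 h2.
Qed.
End ComplexExponential.

(** * Holomorphic germs and logarithms *)

Section LocalLogarithms.
Variable R : realType.
Local Notation C := R[i].
Local Open Scope classical_set_scope.
Local Open Scope ring_scope.
Local Open Scope complex_scope.
Implicit Types f g L : C -> C.

Lemma germ_near (x : C^o) (P : C^o -> Prop) :
  (\forall z \near x, P z) -> \forall z \near x, \forall w \near z, P w.
Proof.
move=> /near_modulusP[r r0 hr]; apply/near_modulusP; exists (r / 2); first by rewrite divr_gt0.
move=> z zx; apply/near_modulusP; exists (r / 2); first by rewrite divr_gt0.
move=> w wz; apply: hr; rewrite -(subrK z w) -addrA.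
by apply: le_lt_trans (modulusD _ _) _; rewrite [r]splitr ltrD.
Qed.

(** The derivative of a continuous local inverse of [cexp] is the inverse of
    the derivative: differentiability of [cexp] at [L x] bounds [L z - L x] by
    a multiple of [z - x]. *)
Lemma cder_log_inverse L (x : C) : {for (x : C^o), continuous (L : C^o -> C^o)} ->
  (\forall z \near (x : C^o), cexp (L z) = z) -> cder L x x^-1.
Proof.
move=> cL eL; have xE : cexp (L x) = x by exact: (nbhs_singleton eL).
have x0 : x != 0 by rewrite -xE cexp_neq0.
have m0 : 0 < modulus x by rewrite modulus_gt0.
apply/cder_epsP => e e0.
(* The first bound makes [u] at most twice [d / x]; the second then absorbs the
   remaining factors of the error. *)
pose k := Num.min (modulus x / 2) (e * modulus x ^+ 2 / 2).
have k0 : 0 < k by rewrite lt_min !divr_gt0 // mulr_gt0 // exprn_gt0.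
have [k1 k2] : k <= modulus x / 2 /\ k <= e * modulus x ^+ 2 / 2.
  by split; rewrite ge_min lexx ?orbT.
clearbody k.
have [r r0 hr] := (cder_epsP _ _ _).1 (cder_cexp (L x)) k k0.
have : \forall z \near (x : C^o), modulus (L z - L x) < r.
  exact: (cL _ (near_radius (L x) r0)).
move=> /(filterI eL) /near_modulusP[q q0 hq].
exists q => // z /hq[zE /hr]; rewrite zE xE => h.
set u := L z - L x in h *; set d := z - x in h *.
have h1 : modulus (u - x^-1 * d) <= k * modulus u / modulus x.
  have -> : u - x^-1 * d = - (d - x * u) / x by field.
  by rewrite modulusM modulusN modulusV ler_wpM2r // invr_ge0 ltW.
have h2 : modulus u <= 2 * (modulus d / modulus x).
  have : modulus u <= modulus (u - x^-1 * d) + modulus (x^-1 * d).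
    by apply: le_trans (modulusD _ _); rewrite subrK.
  rewrite [modulus (x^-1 * d)]modulusM modulusV [(modulus x)^-1 * _]mulrC.
  have : k * modulus u / modulus x <= modulus u / 2.
    rewrite ler_pdivrMr //.
    have : k * modulus u <= modulus x / 2 * modulus u by rewrite ler_wpM2r ?modulus_ge0.
    lra.
  lra.
apply: le_trans h1 _; rewrite ler_pdivrMr //.
have h3 : k * modulus u <= k * (2 * (modulus d / modulus x)) by rewrite ler_pM2l.
apply: le_trans h3 _.
have h4 : k * (2 * (modulus d / modulus x)) <= e * modulus x ^+ 2 / 2 * (2 * (modulus d / modulus x)).
  by rewrite ler_wpM2r // mulr_ge0 // divr_ge0 ?modulus_ge0.
apply: le_trans h4 _; rewrite le_eqVlt; apply/orP; left; apply/eqP; field.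
exact: lt0r_neq0.
Qed.

Lemma near_Re_gt0 (z : C) : 0 < complex.Re z -> \forall w \near (z : C^o), 0 < complex.Re w.
Proof.
move=> z0; apply/near_modulusP; exists (complex.Re z) => // w.
move=> /(le_lt_trans (modulus_geRe _)).
rewrite (raddfB (@complex.Re R : {additive Rcomplex R -> R})) ltr_norml => /andP[h _].
by move: h; rewrite /=; lra.
Qed.

Lemma cder_Log (z : C) : 0 < complex.Re z -> cder (@Log R) z z^-1.
Proof.
move=> z0; apply: cder_log_inverse; first exact: continuous_Log.
by apply: filterS (near_Re_gt0 z0) => w; exact: cexp_Log.
Qed.

Definition hol f (x : C) := \forall z \near (x : C^o), exists d, cder f z d.

Lemma hol_cder f (x : C) : hol f x -> exists d, cder f x d.
Proof. exact: nbhs_singleton. Qed.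

Lemma hol_continuous f (x : C) : hol f x -> {for (x : C^o), continuous (f : C^o -> C^o)}.
Proof. by move=> /hol_cder[d]; exact: cder_continuous. Qed.

Lemma hol_near f (x : C) : hol f x -> \forall z \near (x : C^o), hol f z.
Proof. exact: germ_near. Qed.

Lemma hol_comp f g (x : C) : hol f x -> hol g (f x) -> hol (fun z => g (f z)) x.
Proof.
move=> hf hg; have := hol_continuous hf hg.
by apply: filterS2 hf => z [d hd] [e he]; exists (d * e); exact: cder_comp.
Qed.

(** The quotient [f z / f x] stays near 1, within the domain of [Log]. *)
Definition loclog f (l x : C) (z : C) : C := l + Log (f z / f x).

Lemma loclog_base f (l x : C) : f x != 0 -> loclog f l x x = l.
Proof. by move=> fx; rewrite /loclog divff // Log1 addr0. Qed.

Lemma near_div_Re_gt0 f (x : C) : {for (x : C^o), continuous (f : C^o -> C^o)} -> f x != 0 ->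
  \forall z \near (x : C^o), 0 < complex.Re (f z / f x).
Proof.
move=> cf fx.
have c1 : {for (x : C^o), continuous (fun z : C^o => f z / f x : C^o)}.
  exact: (@cvgM C C^o (nbhs (x : C^o)) _ _ _ _ _ cf (cvg_cst _)).
by apply: (c1 (fun w => 0 < complex.Re w)); apply: near_Re_gt0; rewrite divff //= ltr01.
Qed.

Lemma cexp_loclog f (l x : C) : hol f x -> f x != 0 -> cexp l = f x ->
  \forall z \near (x : C^o), cexp (loclog f l x z) = f z.
Proof.
move=> hf fx lx; apply: filterS (near_div_Re_gt0 (hol_continuous hf) fx) => z z0.
by rewrite /loclog cexpD lx cexp_Log // mulrC divfK.
Qed.

Lemma hol_loclog f (l x : C) : hol f x -> f x != 0 -> hol (loclog f l x) x.
Proof.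
move=> hf fx; have := near_div_Re_gt0 (hol_continuous hf) fx.
apply: filterS2 hf => z [d hd] z0.
have h1 : cder (fun w => f w / f x) z (d / f x).
  by apply: cder_eq (cderM hd (cder_cst _ _)) _; rewrite mulr0 addr0.
have h2 := cder_comp h1 (cder_Log z0).
by eexists; exact: cderD (cder_cst l z) h2.
Qed.

Lemma cder_of_cexp f L (x a d : C) : (\forall z \near (x : C^o), cexp (L z) = f z) ->
  cder L x a -> cder f x d -> a = d / f x.
Proof.
move=> e hL hf; have h1 := cder_near e (cder_cexp_comp hL).
have := cder_unique h1 hf; rewrite (nbhs_singleton e) => <-.
by rewrite mulfK // -(nbhs_singleton e) cexp_neq0.
Qed.

Lemma cder_log f L (x d : C) : (\forall z \near (x : C^o), cexp (L z) = f z) ->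
  hol L x -> cder f x d -> cder L x (d / f x).
Proof. by move=> e /hol_cder[a ha] hf; rewrite -(cder_of_cexp e ha hf). Qed.

(** The difference of the two branches has derivative zero. *)
Lemma log_unique L1 L2 (x : C) : hol L1 x -> hol L2 x ->
  (\forall z \near (x : C^o), cexp (L1 z) = cexp (L2 z)) ->
  \forall z \near (x : C^o), L1 z = L2 z + (L1 x - L2 x).
Proof.
move=> h1 h2 e.
have /near_cder0_const : \forall z \near (x : C^o), cder (fun z => L1 z - L2 z) z 0.
  move: (germ_near e); apply: filterS3 h1 h2 => z [a ha] [b hb] ez.
  apply: cder_eq (cderB ha hb) _.
  rewrite (cder_of_cexp ez ha (cder_cexp_comp hb)) mulfK ?cexp_neq0 // subrr //.
by apply: filterS => z <-; rewrite addrC subrK.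
Qed.

(** Distinct periods of [cexp] are at least [2 * pi] apart. *)
Lemma cexp_inj_small (a b : C) : cexp a = cexp b -> modulus (a - b) < 1 -> a = b.
Proof.
move=> e h; have /cexp_eq1[j jE] : cexp (a - b) = 1 by rewrite cexpB e divff ?cexp_neq0.
suff j0 : j = 0 by apply/eqP; rewrite -subr_eq0 jE j0 mulr0z mul0r.
apply/eqP/negPn/negP => j0; move: h; rewrite jE modulusM modulusR -mulrzr normrM.
have -> : modulus 'i = 1 :> R by rewrite /modulus /= expr0n expr1n add0r sqrtr1.
rewrite mulr1 ltNge => /negP; apply.
have h1 : 1 <= `|j%:~R : R|.
  by rewrite -intr_norm ler1z -gtz0_ge1 normr_gt0.
have h2 : 1 <= `|pi *+ 2 : R|.
  move: (@pi_ge2 R); move: (@pi R) => p p2.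
    by rewrite ger0_norm ?mulrn_wge0 ?mulr2n //; lra.
by apply: (le_trans h2); rewrite ler_peMr.
Qed.

End LocalLogarithms.

(** * Paths *)

Section Paths.
Variable R : realType.
Local Notation C := R[i].
Local Open Scope classical_set_scope.
Local Open Scope ring_scope.
Local Open Scope complex_scope.

(** Real induction: the supremum of the points up to which [P] holds is 1. *)
Lemma unit_interval_induction (P : R -> Prop) : P 0 ->
  (forall t, t \in `[0, 1] -> exists2 r, 0 < r &
     forall s u, s \in `[0, 1] -> u \in `[0, 1] -> s <= u ->
       `|s - t| < r -> `|u - t| < r -> P s -> P u) ->
  forall t, t \in `[0, 1] -> P t.
Proof.
move=> P0 step.
pose A : set R := [set t | t \in `[0, 1] /\ forall s, 0 <= s <= t -> P s].
have A0 : A 0.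
  split; first by rewrite in_itv /= lexx ler01.
  by move=> s /andP[s0 s1]; have -> : s = 0 by apply/eqP; rewrite eq_le s0 s1.
have ubA : has_ubound A by exists 1 => t [] ; rewrite in_itv /= => /andP[].
have supA : has_sup A by split => //; exists 0.
set c := sup A.
have c0 : 0 <= c by exact: ub_le_sup.
have c1 : c <= 1.
  by apply: ge_sup => [|t []]; [exists 0|rewrite in_itv /= => /andP[]].
have cin : c \in `[0, 1] by rewrite in_itv /= c0.
have [r r0 hr] := step c cin.
have [s0 [s0in hs0] s0c] : exists2 s, A s & c - r < s by exact: sup_adherent.
have s0le : s0 <= c by exact: ub_le_sup.
have key u : u \in `[0, 1] -> u < c + r -> P u.
  move=> uin ur; have [us|su] := leP u s0.
    by apply: hs0; move: uin; rewrite in_itv /= us => /andP[->].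
  apply: (hr s0 u) => //; first exact: ltW.
  - by rewrite ltr_norml; apply/andP; split; lra.
  - by rewrite ltr_norml; apply/andP; split; lra.
  - by apply: hs0; move: s0in; rewrite in_itv /= lexx => /andP[->].
have cE : c = 1.
  apply/eqP; rewrite eq_le c1 /= leNgt; apply/negP => clt.
  pose v := Num.min 1 (c + r / 2).
  have [v1 v2] : v <= 1 /\ v <= c + r / 2 by split; rewrite ge_min lexx ?orbT.
  have cv : c < v by rewrite lt_min clt /=; lra.
  have : A v.
    split; first by rewrite in_itv /=; apply/andP; split; lra.
    by move=> s /andP[? ?]; apply: key; [rewrite in_itv /=; apply/andP; split|]; lra.
  by move=> /(ub_le_sup ubA); rewrite -/c; lra.
by move=> t tin; apply: key => //; move: tin; rewrite in_itv /= cE => /andP[_]; lra.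
Qed.

Lemma near_pathP (gamma : R -> C^o) (t : R) : {for t, continuous gamma} ->
  forall e : R, 0 < e -> exists2 r, 0 < r &
    forall s, `|s - t| < r -> modulus (gamma s - gamma t) < e.
Proof.
move=> ct e e0; have /nbhs_ballP[r /= r0 hr] := ct _ (near_radius (gamma t) e0).
by exists r => // s st; apply: (hr s); rewrite /ball /= distrC.
Qed.

Definition clamp (t : R) : R := Num.max 0 (Num.min 1 t).

Lemma clamp_in t : clamp t \in `[0, 1].
Proof. by rewrite in_itv /= /clamp le_max lexx /= ge_max ler01 ge_min lexx. Qed.
Lemma clamp_id t : t \in `[0, 1] -> clamp t = t.
Proof. by rewrite in_itv /= /clamp => /andP[t0 t1]; rewrite (min_idPr t1) (max_idPr t0). Qed.
Lemma lipschitz_continuousR (f : R -> R) : (forall x y, `|f x - f y| <= `|x - y|) -> continuous f.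
Proof.
move=> h t; apply/(@cvgrPdist_lt R R^o R (nbhs t) _) => e e0.
apply/nbhs_ballP; exists e => // s; rewrite /ball /=.
exact: le_lt_trans (h _ _).
Qed.
Lemma dist_max (a x y : R) : `|Num.max a x - Num.max a y| <= `|x - y|.
Proof. by rewrite /Num.max; do 2 case: ifP => ?; rewrite ler_norml; have := ler_norm (x - y); have := lerNnormlW (lexx `|x - y|); lra. Qed.
Lemma dist_min (a x y : R) : `|Num.min a x - Num.min a y| <= `|x - y|.
Proof. by rewrite /Num.min; do 2 case: ifP => ?; rewrite ler_norml; have := ler_norm (x - y); have := lerNnormlW (lexx `|x - y|); lra. Qed.
Lemma continuous_clamp : continuous clamp.
Proof.
apply: lipschitz_continuousR => x y.
exact: le_trans (dist_max _ _ _) (dist_min _ _ _).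
Qed.

(** A lift over [[0, s]] is prolonged to [[0, u]] by adding the principal
    logarithm of the quotient [gamma v / gamma s], which stays close to 1. *)
Lemma path_lift (gamma : R -> C^o) (l0 : C) : continuous gamma ->
  (forall t, gamma t != 0) -> cexp l0 = gamma 0 ->
  exists2 l : R -> C^o, continuous l & l 0 = l0 /\ forall t, t \in `[0, 1] -> cexp (l t) = gamma t.
Proof.
move=> cg g0 l0E.
pose P (t : R) := exists2 l : R -> C^o, continuous l &
  l 0 = l0 /\ forall s, 0 <= s <= t -> cexp (l s) = gamma s.
suff /(_ 1) : forall t, t \in `[0, 1] -> P t.
  rewrite in_itv /= ler01 lexx => /(_ isT)[l cl [lE h]].
  by exists l => //; split => // t; rewrite in_itv; exact: h.
apply: unit_interval_induction.
  exists (fun=> l0); first by move=> t; exact: cvg_cst.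
  split => // s /andP[s0 s1]; have -> : s = 0 by apply/eqP; rewrite eq_le s0 s1.
  by [].
move=> t tin.
have m0 : 0 < modulus (gamma t) / 4 by rewrite divr_gt0 // modulus_gt0.
have [r r0 hr] := near_pathP (cg t) m0.
exists r => // s u sin uin su st ut [l cl [lE h]].
have s0 : 0 <= s by move: sin; rewrite in_itv => /andP[].
pose cl2 v := Num.max s (Num.min u v).
have ccl2 : continuous cl2.
  apply: lipschitz_continuousR => x y.
  exact: le_trans (dist_max _ _ _) (dist_min _ _ _).
have near2 v : 0 < complex.Re (gamma (cl2 v) / gamma s).
  have vt : `|cl2 v - t| < r.
    have h1 : s <= cl2 v by rewrite le_max lexx.
    have h2 : cl2 v <= u by rewrite ge_max su ge_min lexx.
    by move: st ut; rewrite !ltr_norml => /andP[? ?] /andP[? ?]; apply/andP; split; lra.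
  have d1 := hr _ vt; have d2 := hr _ st.
  have d3 : modulus (gamma t) <= modulus (gamma s) + modulus (gamma s - gamma t).
    by rewrite (modulusB (gamma s)); apply: le_trans (modulusD _ _); rewrite addrC subrK.
  have d4 : modulus (gamma (cl2 v) - gamma s) <= modulus (gamma (cl2 v) - gamma t) + modulus (gamma s - gamma t).
    by rewrite (modulusB (gamma s)); apply: le_trans (modulusD _ _); rewrite addrA subrK.
  have d5 : modulus (gamma (cl2 v) / gamma s - 1) < 1.
    rewrite -[1](@divff _ (gamma s)) // -mulrBl modulusM modulusV ltr_pdivrMr ?modulus_gt0 //.
    lra.
  have := le_lt_trans (modulus_geRe _) d5.
  rewrite (raddfB (@complex.Re R : {additive Rcomplex R -> R})) ltr_norml => /andP[h1 _].
  have : - 1 < complex.Re (gamma (cl2 v) / gamma s) - 1 by exact: h1.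
  by rewrite ltrBrDr addNr.
exists (fun v => l (Num.min v s) + Log (gamma (cl2 v) / gamma s)).
  move=> v.
  have cmin : continuous (fun v => Num.min v s).
    by apply: lipschitz_continuousR => x y; rewrite !(minC _ s); exact: dist_min.
  have c1 : {for v, continuous (fun v => l (Num.min v s))}.
    exact: (@continuous_comp _ _ _ (fun v => Num.min v s) l v (cmin v) (cl _)).
  have c2 : {for v, continuous (fun v => gamma (cl2 v))}.
    exact: (@continuous_comp _ _ _ cl2 gamma v (ccl2 v) (cg _)).
  have c3 : {for v, continuous (fun v => gamma (cl2 v) / gamma s : C^o)}.
    exact: (@cvgM C R (nbhs v) _ _ _ _ _ c2 (cvg_cst _)).
  have c4 : {for v, continuous (fun v => Log (gamma (cl2 v) / gamma s) : C^o)}.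
    exact: (@continuous_comp _ _ _ (fun v => gamma (cl2 v) / gamma s : C^o) (@Log R : C^o -> C^o) v c3 (continuous_Log (near2 v))).
  exact: (@cvgD C C^o R (nbhs v) _ _ _ _ _ c1 c4).
have cl2s v : v <= s -> cl2 v = s.
  by move=> vs; rewrite /cl2 (min_idPr (le_trans vs su)) (max_idPl vs).
split; first by rewrite (min_idPl s0) cl2s // divff // Log1 addr0.
move=> v /andP[v0 vu]; rewrite /= cexpD cexp_Log ?near2 //.
have [vs|/ltW sv] := leP v s.
  by rewrite cl2s // divff // mulr1 h // v0 vs.
rewrite h ?s0 ?lexx // /cl2 (min_idPr vu) (max_idPr sv).
by rewrite mulrC divfK.
Qed.

End Paths.

(** * Local solutions of the hypergeometric equation *)

Section LinearODE.
Variable R : realType.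
Local Notation C := R[i].
Local Open Scope classical_set_scope.
Local Open Scope ring_scope.
Local Open Scope complex_scope.
Local Notation d1 f := (derive1 (f : C^o -> C^o)).
Local Notation derivableC f z := (derivable (f : C^o -> C^o) (z : C^o) 1).
Implicit Types (H : hypergeometric_eq R) (y f : C -> C).

Lemma cder_derive1 f (z d : C) : cder f z d -> d1 f z = d.
Proof. by move=> [_ <-]; rewrite derive1E. Qed.

Lemma derivable_cder f (z : C^o) : derivableC f z <-> cder f z (d1 f z).
Proof.
by split=> [h|[h _]]; [apply: DeriveDef; [exact: h|rewrite derive1E]|exact: h].
Qed.

Definition ode H (z y y1 y2 : C) : Prop :=
  z * (1 - z) * y2 + (paramC H - (paramA H + paramB H + 1) * z) * y1
    - paramA H * paramB H * y = 0.

Lemma solves_nearP H (z0 : C) y : solves_near H z0 y <->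
  exists y1 y2 : C -> C, \forall z \near (z0 : C^o),
    [/\ cder y z (y1 z), cder y1 z (y2 z) & ode H z (y z) (y1 z) (y2 z)].
Proof.
split=> [h|[y1 [y2 h]]].
  exists (d1 y), (d1 (d1 y)); apply: filterS h => z [h1 h2 e].
  by split; [exact: (derivable_cder _ _).1 h1|exact: (derivable_cder _ _).1 h2|exact: e].
rewrite /solves_near; apply: filterS2 h (germ_near h) => z [h1 h2 e] hz.
have e1 : \forall w \near (z : C^o), y1 w = d1 y w.
  by apply: filterS hz => w [hw _ _]; rewrite (cder_derive1 hw).
have h3 := cder_near e1 h2.
split; [by case: h1|by case: h3|].
by rewrite (cder_derive1 h3) (cder_derive1 h1).
Qed.

Lemma solves_near_near H (z0 : C) y : solves_near H z0 y ->
  \forall z \near (z0 : C^o), solves_near H z y.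
Proof. exact: germ_near. Qed.

Lemma solves_near_congr H (z0 : C) y f : (\forall z \near (z0 : C^o), y z = f z) ->
  solves_near H z0 y -> solves_near H z0 f.
Proof.
move=> e /solves_nearP[y1 [y2 h]]; apply/solves_nearP; exists y1, y2.
move: h e (germ_near e); apply: filterS3 => z [h1 h2 h3] ez e.
by split => //; [exact: cder_near e h1|rewrite -ez].
Qed.

Lemma solves_nearZ H (z0 c : C) y : solves_near H z0 y -> solves_near H z0 (fun z => c * y z).
Proof.
move=> /solves_nearP[y1 [y2 h]]; apply/solves_nearP.
exists (fun z => c * y1 z), (fun z => c * y2 z); apply: filterS h => z [h1 h2 e].
split; [exact: cderZ|exact: cderZ|].
move: e; rewrite /ode => e; rewrite -[RHS](mulr0 c) -e; ring.
Qed.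

Lemma solves_nearD H (z0 : C) y f : solves_near H z0 y -> solves_near H z0 f ->
  solves_near H z0 (fun z => y z + f z).
Proof.
move=> /solves_nearP[y1 [y2 h]] /solves_nearP[f1 [f2 h']]; apply/solves_nearP.
exists (fun z => y1 z + f1 z), (fun z => y2 z + f2 z); apply: filterS2 h h' => z [h1 h2 e] [k1 k2 e'].
split; [exact: cderD|exact: cderD|].
move: e e'; rewrite /ode => e e'; rewrite -[RHS](addr0 0) -{1}e -e'; ring.
Qed.

(** The derivative is sealed behind an opaque proof: unifying two unequal
    derivatives must not unfold the limits that define them. *)
Fact sealed_derivative : {D : (C -> C) -> C -> C | forall f, D f = d1 f}.
Proof. by exists (fun f => d1 f). Qed.

Definition der : (C -> C) -> C -> C := sval sealed_derivative.

Lemma derE f : der f = d1 f.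
Proof. exact: (svalP sealed_derivative). Qed.

Lemma derivable_der f (z : C^o) : derivableC f z -> cder f z (der f z).
Proof. by rewrite derE => h; exact: (derivable_cder f z).1. Qed.

Lemma cder_der f (z d : C) : cder f z d -> der f z = d.
Proof. by rewrite derE; exact: cder_derive1. Qed.

Lemma ord2 (i : 'I_2) : i = 0 \/ i = 1.
Proof. by case: i => [[|[|]]] // ?; [left|right]; exact/val_inj. Qed.

Lemma sum2 (F : 'I_2 -> C) : \sum_i F i = F 0 + F 1.
Proof. by rewrite !big_ord_recl big_ord0 addr0; congr (F _ + F _); exact/val_inj. Qed.

Lemma solves_near_sum H (z0 : C) (Y : 'I_2 -> C -> C) (c : 'I_2 -> C) :
  (forall i, solves_near H z0 (Y i)) -> solves_near H z0 (fun z => \sum_i c i * Y i z).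
Proof.
move=> h; apply: (@solves_near_congr _ _ (fun z => c 0 * Y 0 z + c 1 * Y 1 z)).
  by near=> z; rewrite sum2.
by apply: solves_nearD; exact: solves_nearZ.
Unshelve. all: by end_near. Qed.

Definition wronskian (Y : 'I_2 -> C -> C) (z : C) : C :=
  Y 0 z * der (Y 1) z - der (Y 0) z * Y 1 z.

Definition fundamental H (z0 : C) (Y : 'I_2 -> C -> C) : Prop :=
  (forall i, solves_near H z0 (Y i)) /\ wronskian Y z0 != 0.

Lemma near_regular (z0 : C) : z0 != 0 -> z0 != 1 ->
  \forall z \near (z0 : C^o), z != 0 /\ z != 1.
Proof.
move=> h0 h1.
have m0 : 0 < Num.min (modulus z0) (modulus (z0 - 1)).
  by rewrite lt_min !modulus_gt0 h0 subr_eq0.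
apply: filterS (near_radius z0 m0) => z; rewrite lt_min => /andP[a b]; split.
  by apply/eqP => e; move: a; rewrite e sub0r modulusN ltxx.
by apply/eqP => e; move: b; rewrite e modulusB ltxx.
Qed.

Lemma near_neq0 f (z0 : C) : {for (z0 : C^o), continuous (f : C^o -> C^o)} -> f z0 != 0 ->
  \forall z \near (z0 : C^o), f z != 0.
Proof.
move=> cf f0; have m0 : 0 < modulus (f z0) by rewrite modulus_gt0.
have h : \forall z \near (z0 : C^o), modulus (f z - f z0) < modulus (f z0).
  exact: (cf _ (near_radius (f z0) m0)).
apply: filterS h => z h; apply/eqP => e.
by move: h; rewrite e sub0r modulusN ltxx.
Qed.

Lemma solves_cder H (z0 : C) y : solves_near H z0 y -> cder y z0 (der y z0).
Proof. by move=> /nbhs_singleton[h _ _]; exact: derivable_der. Qed.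

Lemma solves_cder1 H (z0 : C) y : solves_near H z0 y -> cder (der y) z0 (der (der y) z0).
Proof. by rewrite (derE y) => /nbhs_singleton[_ h _]; exact: derivable_der. Qed.

Lemma solves_ode H (z0 : C) y : solves_near H z0 y -> ode H z0 (y z0) (der y z0) (der (der y) z0).
Proof. by rewrite (derE (der y)) (derE y) => /nbhs_singleton[_ _ h]. Qed.

Lemma cder_wronskian H (z0 : C) y f : solves_near H z0 y -> solves_near H z0 f ->
  cder (fun z => y z * der f z - der y z * f z) z0
    (y z0 * der (der f) z0 - der (der y) z0 * f z0).
Proof.
move=> h k; apply: cder_eq (cderB (cderM (solves_cder h) (solves_cder1 k))
  (cderM (solves_cder1 h) (solves_cder k))) _; ring.
Qed.

(** Solutions are differentiable, so that their Wronskian is continuous. *)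
Lemma fundamental_near H (z0 : C) Y : fundamental H z0 Y ->
  \forall z \near (z0 : C^o), fundamental H z Y.
Proof.
move=> [h w].
have h0 := solves_near_near (h 0); have h1 := solves_near_near (h 1).
have h2 := near_neq0 (cder_continuous (cder_wronskian (h 0) (h 1))) w.
move: h0 h1 h2; apply: filterS3 => z k0 k1 k2; split; last exact: k2.
move=> i; by have [->|->] := ord2 i.
Qed.

(** Cramer's rule: the coefficients of [y] on a basis are quotients of
    Wronskians, and all Wronskians satisfy the same first order equation. *)
Lemma fundamental_span H (z0 : C) Y y : z0 != 0 -> z0 != 1 -> fundamental H z0 Y ->
  solves_near H z0 y ->
  exists c : 'I_2 -> C, \forall z \near (z0 : C^o), y z = \sum_i c i * Y i z.
Proof.
move=> z00 z01 hY hy.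
pose N1 z := y z * der (Y 1) z - der y z * Y 1 z.
pose N2 z := Y 0 z * der y z - der (Y 0) z * y z.
have cst f g (N := fun z => f z * der g z - der f z * g z) :
    solves_near H z0 f -> solves_near H z0 g ->
    \forall z \near (z0 : C^o), N z / wronskian Y z = N z0 / wronskian Y z0.
  move=> hf hg; apply: (@near_cder0_const R (fun z => N z / wronskian Y z)).
  have n1 := near_regular z00 z01.
  have n2 : \forall z \near (z0 : C^o), solves_near H z f /\ solves_near H z g.
    exact: (filterI (solves_near_near hf) (solves_near_near hg)).
  have n3 := fundamental_near hY.
  move: n1 n2 n3; apply: filterS3 => z [z0n z1n] [kf kg] [kY w0].
  have dN := cder_wronskian kf kg; have dW := cder_wronskian (kY 0) (kY 1).
  apply: cder_eq (cderM dN (cderV w0 dW)) _.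
  have ef := solves_ode kf; have eg := solves_ode kg.
  have e0 := solves_ode (kY 0); have e1 := solves_ode (kY 1).
  have z1n' : 1 - z != 0 by rewrite subr_eq0 eq_sym.
  have solve (u2 u1 u P Q : C) : z * (1 - z) * u2 + P * u1 - Q * u = 0 ->
      u2 = (Q * u - P * u1) / (z * (1 - z)).
    have zz : z * (1 - z) != 0 by rewrite mulf_neq0.
    move=> e; apply: (mulIf zz); rewrite divfK //.
    by apply/eqP; rewrite -subr_eq0 -e; apply/eqP; ring.
  rewrite (solve _ _ _ _ _ ef) (solve _ _ _ _ _ eg) (solve _ _ _ _ _ e0) (solve _ _ _ _ _ e1).
  move: w0; rewrite /wronskian.
  move: (der (Y 0) z) (der (Y 1) z) (der f z) (der g z) (Y 0 z) (Y 1 z) (f z) (g z).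
  move: (paramC H - _) (paramA H * _) => P Q a1 a2 a3 a4 b1 b2 b3 b4 w0.
  by field; rewrite z1n' z0n w0.
have c1 := cst _ _ hy (hY.1 1); have c2 := cst _ _ (hY.1 0) hy.
exists (fun i => if i == 0 then N1 z0 / wronskian Y z0 else N2 z0 / wronskian Y z0).
have n3 := fundamental_near hY.
move: c1 c2 n3; apply: filterS3 => z e1 e2 [_ w0].
rewrite sum2 /= -e1 -e2; move: w0; rewrite /wronskian /N1 /N2.
move: (der (Y 0) z) (der (Y 1) z) (der y z) (Y 0 z) (Y 1 z) (y z) => a1 a2 a3 b1 b2 b3 w0.
by field.
Qed.

(** A relation between the solutions and its derivative form a linear system
    with the Wronskian as determinant. *)
Lemma fundamental_free H (z0 : C) Y (c : 'I_2 -> C) : fundamental H z0 Y ->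
  (\forall z \near (z0 : C^o), \sum_i c i * Y i z = 0) -> forall i, c i = 0.
Proof.
move=> [h w] e.
have e0 : c 0 * Y 0 z0 + c 1 * Y 1 z0 = 0 by rewrite -(sum2 (fun i => c i * Y i z0)); exact: (nbhs_singleton e).
have e1 : c 0 * der (Y 0) z0 + c 1 * der (Y 1) z0 = 0.
  apply: (@cder_unique R (fun z => c 0 * Y 0 z + c 1 * Y 1 z) z0).
    by apply: cderD; apply: cderZ; exact: solves_cder (h _).
  apply: cder_near (cder_cst 0 z0); apply: filterS e => z <-; by rewrite sum2.
have elim_c (a1 a2 b1 b2 c0 c1 : C) : c0 * b1 + c1 * b2 = 0 -> c0 * a1 + c1 * a2 = 0 ->
    c0 * (b1 * a2 - a1 * b2) = 0 /\ c1 * (b1 * a2 - a1 * b2) = 0.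
  move=> h0 h1; split.
    transitivity ((c0 * b1 + c1 * b2) * a2 - (c0 * a1 + c1 * a2) * b2); first by ring.
    by rewrite h0 h1 !mul0r subr0.
  transitivity ((c0 * a1 + c1 * a2) * b1 - (c0 * b1 + c1 * b2) * a1); first by ring.
  by rewrite h0 h1 !mul0r subr0.
have [k0 k1] := elim_c _ _ _ _ _ _ e0 e1; rewrite -/(wronskian Y z0) in k0 k1.
move: k0 k1 => /eqP; rewrite mulf_eq0 (negPf w) orbF => /eqP k0 /eqP.
rewrite mulf_eq0 (negPf w) orbF => /eqP k1 i.
by have [->|->] := ord2 i.
Qed.

End LinearODE.

(** * The polynomial G and its Wronskian *)

Section KleinPolynomial.
Variable F : numFieldType.
Implicit Types (p q G : {poly F}) (a s : F) (k l : nat).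

Lemma horner_eq0 p : (forall x, p.[x] = 0) -> p = 0.
Proof.
move=> h; apply/eqP/negPn/negP => p0.
have := @max_poly_roots _ p [seq i%:R | i <- iota 0 (size p)] p0.
rewrite size_map size_iota ltnn => H; apply: notF; apply: H.
  by apply/allP => x _; apply/rootP.
by rewrite map_inj_uniq ?iota_uniq // => i j /eqP; rewrite eqr_nat => /eqP.
Qed.

Lemma poly_nonroot p : p != 0 -> exists x, p.[x] != 0.
Proof.
move=> p0; apply: contrapT => h; move/eqP: p0; apply; apply: horner_eq0 => x.
by apply/eqP/negPn/negP => hx; apply: h; exists x.
Qed.

Lemma horner_eq0_generic p : (forall s, s != 0 -> s + 1 != 0 -> p.[s] = 0) -> p = 0.
Proof.
move=> E; have : p * ('X * ('X + 1)) = 0.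
  apply: horner_eq0 => s; rewrite !hornerM hornerX hornerD hornerX hornerC.
  have [->|s0] := eqVneq s 0; first by rewrite mul0r mulr0.
  have [->|s1] := eqVneq (s + 1) 0; first by rewrite !mulr0.
  by rewrite E // mul0r.
move/eqP; rewrite mulf_eq0 => /orP[/eqP //|].
by rewrite mulf_eq0 polyX_eq0 -[1]opprK -polyCN polyXsubC_eq0.
Qed.

(** The equation for [G] that results from writing a solution of the
    hypergeometric equation as [x^al (1 - x)^be ((1 + s) / (1 - s))^(a / 2)
    G(s)], where [s ^ 2] is a Moebius function of [x]. *)
Definition klein_op k l a G : {poly F} :=
  'X * (1 - 'X^2) * G^`()^`()
  + ((2 * a) *: 'X - 2 *: 'X^2 - (2 * k%:R) *: (1 - 'X^2)) * G^`()
  + ((l%:R * (l%:R + 1) - k%:R * (k%:R - 1)) *: 'X - (2 * k%:R * a)%:P) * G.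

Lemma klein_opD k l a p q : klein_op k l a (p + q) = klein_op k l a p + klein_op k l a q.
Proof. by rewrite /klein_op !derivD; ring. Qed.

Lemma klein_opZ k l a c p : klein_op k l a (c *: p) = c *: klein_op k l a p.
Proof. by rewrite /klein_op !derivZ -!mul_polyC; ring. Qed.

Lemma klein_op0 k l a : klein_op k l a 0 = 0.
Proof. by rewrite /klein_op !linear0 !mulr0 !addr0. Qed.

Lemma klein_op_sum k l a n (f : 'I_n -> {poly F}) :
  klein_op k l a (\sum_i f i) = \sum_i klein_op k l a (f i).
Proof.
by apply: (big_morph (klein_op k l a) (klein_opD k l a) (klein_op0 k l a)).
Qed.

(** The functions [s^k ((1 + s) / s)^p (1 + s)^q] of Appell's double sum are
    monomials in [1 + s] and [s]. *)
Definition monom i j : {poly F} := ('X + 1) ^+ i * 'X^j.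

Lemma monom_deriv i j : ('X + 1) * 'X * (monom i j)^`() =
  (i%:R *: 'X + j%:R *: ('X + 1)) * monom i j.
Proof.
rewrite /monom derivM derivXn deriv_exp derivD derivX derivC addr0 mul1r.
rewrite -[_ *+ i]mulr_natl -['X^_ *+ j]mulr_natl !scaler_nat.
rewrite -['X *+ i]mulr_natl -[('X + 1) *+ j]mulr_natl.
by case: i => [|i]; case: j => [|j] /=; rewrite ?exprS ?expr0; ring.
Qed.

(** Products of powers of [1 + s] and [s] have an explicit logarithmic
    derivative [u]; the operator becomes scalar on them. *)
Lemma log_derivative_horner p (x y s : F) : s != 0 -> s + 1 != 0 ->
  ('X + 1) * 'X * p^`() = (x *: 'X + y *: ('X + 1)) * p ->
  let u := x / (s + 1) + y / s in
  p^`().[s] = u * p.[s] /\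
  p^`()^`().[s] = (u ^+ 2 - x / (s + 1) ^+ 2 - y / s ^+ 2) * p.[s].
Proof.
move=> s0 s1 e u.
have e1 := congr1 (fun p => p.[s]) e; have e2 := congr1 (fun p => p^`().[s]) e.
move: e1 e2; rewrite /= !derivM !derivD !derivZ !derivD !derivX !derivC.
rewrite !(hornerD, hornerM, hornerZ, hornerX, hornerC).
move: p.[s] p^`().[s] p^`()^`().[s] => g g1 g2 e1 e2.
have ss : (s + 1) * s != 0 by rewrite mulf_neq0.
have E1 : g1 = u * g.
  by apply: (mulfI ss); rewrite e1 /u; field; rewrite s0 s1.
split=> //; apply: (mulfI ss).
have -> : (s + 1) * s * g2 = (x + y) * g + (x * s + y * (s + 1)) * (u * g) - (2 * s + 1) * (u * g).
  rewrite E1 in e2; apply/eqP; rewrite -subr_eq0; move/eqP: e2; rewrite -subr_eq0 => /eqP e2.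
  by rewrite -[X in _ == X]e2; apply/eqP; ring.
by rewrite /u; field; rewrite s0 s1.
Qed.

Lemma monom_horner i j s : s != 0 -> s + 1 != 0 ->
  let u := i%:R / (s + 1) + j%:R / s in
  (monom i j)^`().[s] = u * (monom i j).[s] /\
  (monom i j)^`()^`().[s] = (u ^+ 2 - i%:R / (s + 1) ^+ 2 - j%:R / s ^+ 2) * (monom i j).[s].
Proof. by move=> s0 s1; apply: log_derivative_horner => //; exact: monom_deriv. Qed.

Section Coefficients.
Variables (k l : nat) (a : F) (c : nat -> nat -> F).
Hypothesis c_stepl : forall p q : nat, (p%:R * (p%:R + 1) - k%:R * (k%:R + 1)) * c p q =
  2 * (a + p%:R + q%:R + 1) * (p%:R + 1) * c p.+1 q.
Hypothesis c_stepr : forall p q : nat, (q%:R * (q%:R + 1) - l%:R * (l%:R + 1)) * c p q =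
  2 * (a + p%:R + q%:R + 1) * (q%:R + 1) * c p q.+1.
Hypothesis c_endl : forall q : nat, c k.+1 q = 0.
Hypothesis c_endr : forall p : nat, c p l.+1 = 0.

Definition double_sum : {poly F} :=
  \sum_(p < k.+1) \sum_(q < l.+1) c p q *: monom (p + q) (k - p).

(** The operator applied to the term of index [(p, q)] is a difference
    [T (p+1) q - T p q - (S p (q+1) - S p q)], so that the double sum
    telescopes in both directions. *)
Lemma klein_op_double_sum : klein_op k l a double_sum = 0.
Proof.
suff: forall s, s != 0 -> s + 1 != 0 -> (klein_op k l a double_sum).[s] = 0.
  exact: horner_eq0_generic.
move=> s s0 s1.
pose T (p q : nat) := 2 * p%:R * (a + p%:R + q%:R) / (s + 1) / s * c p q * (s ^+ k * ((s + 1) / s) ^+ p * (s + 1) ^+ q).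
pose S (p q : nat) := 2 * q%:R * (a + p%:R + q%:R) / (s + 1) * c p q * (s ^+ k * ((s + 1) / s) ^+ p * (s + 1) ^+ q).
have term (p q : nat) : (p <= k)%N -> (klein_op k l a (c p q *: monom (p + q) (k - p))).[s] =
    s * ((T p.+1 q - T p q) - (S p q.+1 - S p q)).
  move=> pk; rewrite klein_opZ hornerZ /klein_op.
  have [m1 m2] := monom_horner (p + q) (k - p) s0 s1.
  have gE : (monom (p + q) (k - p)).[s] = s ^+ k * ((s + 1) / s) ^+ p * (s + 1) ^+ q.
    have -> : s ^+ k = s ^+ (k - p) * s ^+ p by rewrite -exprD subnK.
    rewrite /monom hornerM horner_exp hornerD hornerX hornerC hornerXn exprD expr_div_n.
    by field; rewrite expf_neq0.
  move: (monom _ _) m1 m2 gE => M m1 m2 gE.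
  rewrite !(hornerD, hornerN, hornerM, hornerZ, hornerX, hornerXn, hornerC) m1 m2 gE natrB // natrD.
  rewrite /T /S (exprS _ p) (exprS _ q).
  set g := s ^+ k; set r := ((s + 1) / s) ^+ p; set v := (s + 1) ^+ q.
  rewrite -[p.+1%:R]natr1 -[q.+1%:R]natr1.
  have e1 : 2 * (p%:R + 1) * (a + (p%:R + 1) + q%:R) / (s + 1) / s * c p.+1 q * (g * ((s + 1) / s * r) * v)
     = ((p%:R * (p%:R + 1) - k%:R * (k%:R + 1)) * c p q) / s ^+ 2 * (g * r * v).
    by rewrite c_stepl; field; rewrite s0 s1.
  have e2 : 2 * (q%:R + 1) * (a + p%:R + (q%:R + 1)) / (s + 1) * c p q.+1 * (g * r * ((s + 1) * v))
     = ((q%:R * (q%:R + 1) - l%:R * (l%:R + 1)) * c p q) * (g * r * v).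
    by rewrite c_stepr; field; rewrite s1.
  by rewrite e1 e2; field; rewrite s0 s1.
rewrite /double_sum klein_op_sum horner_sum.
under eq_bigr => p _ do rewrite klein_op_sum horner_sum.
under eq_bigr => p _.
  under eq_bigr => q _ do rewrite term -1?ltnS //.
  over.
have sumT (q : nat) : \sum_(p < k.+1) (T p.+1 q - T p q) = 0.
  rewrite -(big_mkord predT (fun p : nat => T p.+1 q - T p q)) telescope_sumr // /T c_endl.
  by rewrite !(mulr0, mul0r) subrr.
have sumS (p : nat) : \sum_(q < l.+1) (S p q.+1 - S p q) = 0.
  rewrite -(big_mkord predT (fun q : nat => S p q.+1 - S p q)) telescope_sumr // /S c_endr.
  by rewrite !(mulr0, mul0r) subrr.
under eq_bigr => p _ do rewrite -mulr_sumr sumrB sumS subr0.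
rewrite -mulr_sumr exchange_big /= big1 ?mulr0 // => q _; exact: sumT.
Qed.
End Coefficients.


Definition flip p : {poly F} := p \Po (- 'X).

Lemma flipD p q : flip (p + q) = flip p + flip q. Proof. exact: comp_polyD. Qed.
Lemma flipN p : flip (- p) = - flip p. Proof. by rewrite /flip linearN. Qed.
Lemma flipM p q : flip (p * q) = flip p * flip q. Proof. exact: comp_polyM. Qed.
Lemma flipC c : flip c%:P = c%:P. Proof. exact: comp_polyC. Qed.
Lemma flipZ c p : flip (c *: p) = c *: flip p. Proof. exact: comp_polyZ. Qed.
Lemma flip0 : flip 0 = 0. Proof. by rewrite /flip linear0. Qed.
Lemma flip1 : flip 1 = 1. Proof. by rewrite /flip rmorph1. Qed.
Lemma flipX : flip 'X = - 'X. Proof. exact: comp_polyX. Qed.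
Lemma flipX2 : flip 'X^2 = 'X^2. Proof. by rewrite /flip comp_Xn_poly sqrrN. Qed.
Lemma flip_exp p n : flip (p ^+ n) = flip p ^+ n. Proof. by rewrite /flip rmorphXn. Qed.
Lemma flipK p : flip (flip p) = p.
Proof. by rewrite /flip -comp_polyA raddfN /= comp_polyX opprK comp_polyXr. Qed.
Lemma flip_horner p s : (flip p).[s] = p.[- s].
Proof. by rewrite horner_comp hornerN hornerX. Qed.
Lemma deriv_flip p : (flip p)^`() = - flip p^`().
Proof. by rewrite deriv_comp derivN derivX mulrN1. Qed.
Lemma size_flip p : size (flip p) = size p.
Proof.
have h q : (size (flip q) <= size q)%N.
  have [->|q0] := eqVneq q 0; first by rewrite /flip comp_poly0.
  rewrite /flip (leq_trans (size_comp_poly_leq _ _)) // size_polyN size_polyX muln1.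
  by rewrite prednK // size_poly_gt0.
by apply/eqP; rewrite eqn_leq h -{1}(flipK p) h.
Qed.

Section KleinPolynomialTheory.
Variables (k l : nat) (a : F) (G : {poly F}).
Hypothesis G_ode : klein_op k l a G = 0.
Hypothesis G_N1 : G.[-1] != 0.
Hypothesis a_nonnat : forall j : nat, a != j%:R.

(** Up to an elementary factor, the Wronskian of the solutions [((1 + s) / (1
    - s))^(a / 2) G(s)] and [((1 + s) / (1 - s))^(- a / 2) G(- s)]. *)
Definition klein_wronskian : {poly F} :=
  (1 - 'X^2) * (G^`() * flip G + G * flip G^`()) + (2 * a) *: (G * flip G).
Local Notation W := klein_wronskian.

(** Abel's formula: the equations for [G(s)] and [G(- s)] eliminate the second
    derivatives. *)
Lemma klein_wronskian_ode : 'X * W^`() = (2 * k%:R) *: W.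
Proof.
have e2 := congr1 flip G_ode; move: e2; rewrite /klein_op.
rewrite !(flipD, flipN, flipM, flipZ, flipC, flipX, flipX2, flip1, flip0) => e2.
have e1 := G_ode; rewrite /klein_op in e1.
rewrite /klein_wronskian !(derivD, derivN, derivM, derivZ, derivC, deriv_flip, derivXn) /=.
have d1 : (1 : {poly F})^`() = 0 by rewrite -polyC1 derivC.
rewrite ?d1 ?expr1 ?derivE.
apply/eqP; rewrite -subr_eq0.
have E := congr2 (fun u v => flip G * u + G * v) e1 e2; rewrite /= !mulr0 addr0 in E.
apply/eqP; rewrite -[RHS]E -!mul_polyC !(polyCM, polyCD, polyCN, polyCB).
ring.
Qed.

Lemma klein_wronskian_monomial : exists c, W = c *: 'X^(2 * k).
Proof.
exists W`_(2 * k); apply/polyP => i; rewrite coefZ coefXn.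
have /(congr1 (fun p : {poly F} => p`_i)) := klein_wronskian_ode.
rewrite coefXM coefZ coef_deriv.
have [->|ik] := eqVneq i (2 * k)%N; first by rewrite mulr1.
rewrite mulr0; case: i ik => [|i] ik /=.
  move/eqP; rewrite eq_sym mulf_eq0 -natrM pnatr_eq0 => /orP[/eqP e|/eqP //].
  by rewrite e in ik.
rewrite -[_ *+ i.+1]mulr_natl -natrM => /eqP; rewrite -subr_eq0 -mulrBl mulf_eq0 subr_eq0 eqr_nat.
by rewrite (negPf ik) => /eqP.
Qed.

Lemma klein_poly_neq0 : G != 0.
Proof. by apply: contraNneq G_N1 => ->; rewrite horner0. Qed.

(** With [W = 0], comparison of the lowest terms at [s = 1] would make [a] the
    multiplicity of the root 1 of [G], a natural number. *)
Lemma klein_wronskian_neq0 : W != 0.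
Proof.
apply/eqP => W0.
have [j [q q1 Gq]] := multiplicity_XsubC G 1; rewrite klein_poly_neq0 /= in q1.
have m1 : (flip G).[1] != 0 by rewrite flip_horner.
have XC : ('X - 1%:P : {poly F}) != 0 by rewrite polyXsubC_eq0.
have key : ('X - 1%:P) ^+ j * ((- ('X + 1)) * ((j%:R *: q + ('X - 1%:P) * q^`()) * flip G +
     ('X - 1%:P) * q * flip G^`()) + (2 * a) *: (q * flip G)) = 0.
  have GE : ('X - 1%:P) * G^`() = ('X - 1%:P) ^+ j * (j%:R *: q + ('X - 1%:P) * q^`()).
    rewrite Gq derivM deriv_exp derivXsubC mul1r -[_ *+ j]mulr_natl -mul_polyC polyC_natr.
    by case: (j) => [|i] /=; rewrite ?exprS; ring.
  rewrite -[RHS]W0 /klein_wronskian -!mul_polyC.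
  transitivity (- ('X + 1) * ((('X - 1%:P) ^+ j * (j%:R *: q + ('X - 1%:P) * q^`())) * flip G + ('X - 1%:P) * (q * ('X - 1%:P) ^+ j) * flip G^`()) + (2 * a)%:P * ((q * ('X - 1%:P) ^+ j) * flip G)).
    by rewrite -!mul_polyC; ring.
  by rewrite -GE -Gq polyC1; ring.
move/eqP: key; rewrite mulf_eq0 expf_eq0 (negPf XC) andbF /= => /eqP.
move/(congr1 (fun p => p.[1])).
rewrite !(hornerD, hornerN, hornerM, hornerZ, hornerX, hornerC) subrr !mul0r !addr0 => e.
have : 2 * (a - j%:R) * (q.[1] * (flip G).[1]) = 0 by rewrite -e; ring.
move/eqP; rewrite !mulf_eq0 pnatr_eq0 /= subr_eq0 (negPf (a_nonnat j)) /= (negPf m1) orbF.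
by move: q1; rewrite /root => /negPf ->.
Qed.

Lemma klein_wronskianE : exists2 c, c != 0 & W = c *: 'X^(2 * k).
Proof.
have [c e] := klein_wronskian_monomial; exists c => //.
by apply: contraNneq klein_wronskian_neq0 => c0; rewrite e c0 scale0r.
Qed.

Lemma klein_poly_1 : G.[1] != 0.
Proof.
have [c c0 e] := klein_wronskianE; apply: contra_neq c0 => G1.
have := congr1 (fun p => p.[1]) e; rewrite /klein_wronskian.
rewrite !(hornerD, hornerN, hornerM, hornerZ, hornerX, hornerXn, hornerC) !expr1n G1.
by rewrite !mulr1 subrr !mul0r mulr0 addr0 => <-.
Qed.

(** The exponents of the equation at [s = 0] are [0] and [2 k + 1]; a root of
    order [2 k + 1] would give the Wronskian, a multiple of [s^(2 k)], a root
    of higher order. *)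
Lemma klein_poly_0 : G.[0] != 0.
Proof.
apply/negP => /eqP G0.
have [j [q q0 Gq]] := multiplicity_XsubC G 0; rewrite klein_poly_neq0 /= subr0 in q0 Gq.
have j0 : (0 < j)%N.
  by case: j Gq => // Gq; move: q0; rewrite /root -{1}[q]mulr1 -(expr0 'X) -Gq G0 eqxx.
have X0 : ('X : {poly F}) != 0 by rewrite polyX_eq0.
have D1 : 'X * G^`() = 'X^j * (j%:R *: q + 'X * q^`()).
  rewrite Gq derivM derivXn -[_ *+ j]mulr_natl -mul_polyC polyC_natr.
  by case: (j) => [|i] /=; rewrite ?exprS; ring.
have D2 : 'X * ('X * G^`()^`()) = 'X^j * ((j%:R * (j%:R - 1)) *: q + 'X * ((2 * j%:R) *: q^`() + 'X * q^`()^`())).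
  have := congr1 (@deriv F) D1; rewrite !derivM derivX mul1r => D2.
  have -> : 'X * ('X * G^`()^`()) = 'X * (G^`() + 'X * G^`()^`()) - 'X * G^`() by ring.
  rewrite D2 D1 derivXn -[_ *+ j]mulr_natl !(derivD, derivZ, derivM, derivX) -!mul_polyC.
  rewrite !(polyCM, polyCB, polyC_natr, polyC1).
  by case: (j) => [|i] /=; rewrite ?exprS; ring.
have key : 'X^j * ((1 - 'X^2) * ((j%:R * (j%:R - 1)) *: q + 'X * ((2 * j%:R) *: q^`() + 'X * q^`()^`()))
   + ((2 * a) *: 'X - 2 *: 'X^2 - (2 * k%:R) *: (1 - 'X^2)) * (j%:R *: q + 'X * q^`())
   + 'X * ((l%:R * (l%:R + 1) - k%:R * (k%:R - 1)) *: 'X - (2 * k%:R * a)%:P) * q) = 0.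
  have := congr1 (fun p => 'X * p) G_ode; rewrite mulr0 /klein_op => <-.
  rewrite mulrDr mulrDr.
  transitivity ((1 - 'X^2) * ('X * ('X * G^`()^`())) + ((2 * a) *: 'X - 2 *: 'X^2 - (2 * k%:R) *: (1 - 'X^2)) * ('X * G^`())
    + 'X * ((l%:R * (l%:R + 1) - k%:R * (k%:R - 1)) *: 'X - (2 * k%:R * a)%:P) * (q * 'X^j)).
    by rewrite D1 D2; ring.
  by rewrite -Gq; ring.
move/eqP: key; rewrite mulf_eq0 expf_eq0 (negPf X0) andbF /= => /eqP.
move/(congr1 (fun p => p.[0])).
rewrite !(hornerD, hornerN, hornerM, hornerZ, hornerX, hornerXn, hornerC) !(mul0r, mulr0, addr0, subr0, sub0r, add0r) => e.
have : j%:R * (j%:R - 1 - 2 * k%:R) * q.[0] = 0 by rewrite -[RHS]e; ring.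
move/eqP; rewrite !mulf_eq0 pnatr_eq0 -(prednK j0) /= (negPf (q0 : q.[0] != 0)) orbF -natr1 addrK -natrM subr_eq0 eqr_nat.
move=> /eqP jk.
have [c c0 e3] := klein_wronskianE.
have div : dvdp 'X^(2 * j) (c *: 'X^((2 * k).+1)).
  have -> : c *: 'X^((2 * k).+1) = 'X * W by rewrite e3 exprS scalerAr.
  have fl : flip G = 'X^j * ((-1) ^+ j *: flip q).
    by rewrite Gq flipM flip_exp flipX [(- 'X) ^+ j]exprNn -mul_polyC polyC_exp polyCN polyC1; ring.
  have fl' : 'X * flip G^`() = 'X^j * ((-1) ^+ j.+1 *: (flip (j%:R *: q + 'X * q^`()))).
    have := congr1 flip D1; rewrite !flipM flip_exp flipX => e4.
    have -> : 'X * flip G^`() = - ((- 'X) * flip G^`()) by ring.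
    rewrite e4 [(- 'X) ^+ j]exprNn -[(-1) ^+ j.+1 *: _]mul_polyC polyC_exp polyCN polyC1 exprS; ring.
  have -> : 'X * W = (1 - 'X^2) * (('X * G^`()) * flip G + G * ('X * flip G^`())) + (2 * a) *: ('X * G * flip G).
    by rewrite /klein_wronskian -!mul_polyC; ring.
  rewrite D1 fl fl' Gq mul2n -addnn exprD.
  set u := (j%:R *: q + 'X * q^`()); set v := flip u.
  have -> : (1 - 'X^2) * ('X^j * u * ('X^j * ((-1) ^+ j *: flip q)) + q * 'X^j * ('X^j * ((-1) ^+ j.+1 *: v))) + (2 * a) *: ('X * (q * 'X^j) * ('X^j * ((-1) ^+ j *: flip q)))
    = ((1 - 'X^2) * (u * ((-1) ^+ j *: flip q) + q * ((-1) ^+ j.+1 *: v)) + (2 * a) *: ('X * q * ((-1) ^+ j *: flip q))) * ('X^j * 'X^j).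
    by rewrite -!mul_polyC; ring.
  exact: dvdp_mull.
have := dvdp_leq _ div; rewrite scaler_eq0 (negPf c0) expf_eq0 (negPf X0) andbF /= => /(_ isT).
rewrite size_scale // !size_polyXn ltnS; move: jk; rewrite -(prednK j0); lia.
Qed.

(** The exponents at infinity allow the degrees [k + l] and [k - l - 1]; the
    second is too small for the Wronskian to have degree [2 k]. *)
Lemma klein_poly_size : size G = (k + l).+1.
Proof.
have Gn0 := klein_poly_neq0; have sG : (0 < size G)%N by rewrite size_poly_gt0.
pose d := (size G).-1; have dE : size G = d.+1 by rewrite /d prednK.
have lead : G`_d != 0 by rewrite -lead_coefE lead_coef_eq0.
have big i : (d < i)%N -> G`_i = 0 by move=> di; rewrite nth_default // dE.
have := congr1 (fun p : {poly F} => p`_d.+1) G_ode.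
have -> : klein_op k l a G = 'X * G^`()^`() - 'X^3 * G^`()^`() + (2 * a) *: ('X * G^`())
  + (2 * k%:R - 2) *: ('X^2 * G^`()) - (2 * k%:R) *: G^`()
  + (l%:R * (l%:R + 1) - k%:R * (k%:R - 1)) *: ('X * G) - (2 * k%:R * a) *: G.
  by rewrite /klein_op -!mul_polyC !(polyCM, polyCD, polyCB, polyC_natr, polyC1); ring.
rewrite coef0 !(coefD, coefN, coefZ, coefXM, coefXnM, coef_deriv) /= (big d.+1 (ltnSn _)) (big d.+2 (leqW (ltnSn _))).
rewrite !mul0rn !mulr0 addr0 subr0.
have -> : (if (d.+1 < 3)%N then 0 else G`_((d.+1 - 3).+2) *+ (d.+1 - 3).+2 *+ (d.+1 - 3).+1) = d%:R * (d%:R - 1) * G`_d.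
  case: (d) => [|[|i]] /=; rewrite ?mul0r ?subrr ?mulr0 ?mul0r //.
  have -> : (i.+3 - 3 = i)%N by lia.
  by rewrite -mulrnA -[G`_i.+2 *+ _]mulr_natl natrM -[i.+2%:R]natr1 addrK; ring.
have -> : (if (d.+1 < 2)%N then 0 else G`_(d.+1 - 2).+1 *+ (d.+1 - 2).+1) = d%:R * G`_d.
  case: (d) => [|i] /=; first by rewrite mul0r.
  have -> : (i.+2 - 2 = i)%N by lia.
  by rewrite mulr_natl.
move=> e; have : (d%:R - (k + l)%:R) * ((d + l).+1%:R - k%:R) * G`_d = 0.
  have E := congr1 -%R e; rewrite oppr0 in E.
  by rewrite -[RHS]E -[(d + l).+1%:R]natr1 !natrD; ring.
move/eqP; rewrite !mulf_eq0 (negPf lead) orbF !subr_eq0 !eqr_nat => /orP[/eqP <- //|/eqP dk].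
have [c c0 eW] := klein_wronskianE.
have : (size W <= (2 * d).+2)%N.
  have s1 : (size (G^`() * flip G + G * flip G^`())%R <= 2 * d)%N.
    rewrite (leq_trans (size_polyD _ _)) // geq_max;
    have sd' := lt_size_deriv Gn0.
    by apply/andP; split; rewrite (leq_trans (size_polyMleq _ _)) // !size_flip dE; lia.
  rewrite (leq_trans (size_polyD _ _)) // geq_max; apply/andP; split.
    rewrite (leq_trans (size_polyMleq _ _)) //.
    have -> : size (1 - 'X^2 : {poly F}) = 3%N.
      by rewrite addrC size_polyDl size_polyN size_polyXn // size_poly1.
    by lia.
  rewrite (leq_trans (size_scale_leq _ _)) // (leq_trans (size_polyMleq _ _)) // size_flip dE; lia.
rewrite eW size_scale // size_polyXn; lia.
Qed.

Lemma klein_poly_no_common_root s : G.[s] = 0 -> G.[- s] = 0 -> False.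
Proof.
move=> h1 h2; have [c c0 e] := klein_wronskianE.
have := congr1 (fun p => p.[s]) e; rewrite /klein_wronskian.
rewrite !(hornerD, hornerM, hornerZ, hornerXn) flip_horner h1 h2 !(mulr0, mul0r, addr0) => /esym/eqP.
rewrite mulf_eq0 (negPf c0) expf_eq0 => /andP[_ /eqP s0].
by move/negP: klein_poly_0; apply; rewrite -s0; apply/eqP; rewrite h1 s0.
Qed.

End KleinPolynomialTheory.

End KleinPolynomial.

(** * Even and odd parts of the power *)

Section ThetaSplitting.
Variable F : numFieldType.
Variables (k l m n : nat) (a : F) (G : {poly F}).
Hypothesis m_gt0 : (0 < m)%N.
Hypothesis aE : a = n%:R / m%:R.
Hypothesis G_ode : klein_op k l a G = 0.
Hypothesis G_N1 : G.[-1] != 0.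
Hypothesis a_nonnat : forall j : nat, a != j%:R.
Local Notation P := ((1 + 'X) ^+ n * G ^+ m).
Local Notation W := (klein_wronskian a G).

Lemma deriv_exp_pred (p : {poly F}) i : p * (p ^+ i)^`() = i%:R * (p^`() * p ^+ i).
Proof.
rewrite deriv_exp -[_ *+ i]mulr_natl; case: i => [|i] /=; first by rewrite !mul0r mulr0.
by rewrite exprS; ring.
Qed.

(** [P(s) / P(- s)] is the [m]-th power of the quotient of the two solutions,
    so that its logarithmic derivative is [m] times that of the quotient,
    which the Wronskian expresses. *)
Lemma wronskian_power : (1 - 'X^2) * (G * flip G) * (P^`() * flip P - P * (flip P)^`()) =
  m%:R * W * (P * flip P).
Proof.
have mn0 : m%:R != 0 :> F by rewrite pnatr_eq0 -lt0n.
have e1 : (1 + 'X) * G * P^`() = (n%:R * G + m%:R * ((1 + 'X) * G^`())) * P.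
  rewrite derivM.
  have d1 : (1 + 'X : {poly F})^`() = 1 by rewrite derivD derivX -polyC1 derivC add0r.
  have := deriv_exp_pred (1 + 'X) n; rewrite d1 => u1; have u2 := deriv_exp_pred G m.
  transitivity (G * ((1 + 'X) * ((1 + 'X) ^+ n)^`()) * G ^+ m + (1 + 'X) ^+ n * (1 + 'X) * (G * (G ^+ m)^`())); first by ring.
  by rewrite u1 u2; ring.
have e2 : (1 - 'X) * flip G * (flip P)^`() = - (n%:R * flip G + m%:R * ((1 - 'X) * flip G^`())) * flip P.
  have fn i : flip (i%:R : {poly F}) = i%:R by rewrite -polyC_natr flipC.
  have e3 := congr1 (@flip F) e1.
  rewrite [LHS]flipM [RHS]flipM !(flipM, flipD, flip1, flipX, fn) in e3.
  rewrite deriv_flip mulrN e3 [flip P]flipM; ring.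
have -> : (1 - 'X^2 : {poly F}) = (1 + 'X) * (1 - 'X) by ring.
transitivity (((1 + 'X) * G * P^`()) * (1 - 'X) * flip G * flip P - P * (1 + 'X) * G * ((1 - 'X) * flip G * (flip P)^`())).
  by move: (flip P) (flip P)^`() P^`() => p1 p2 p3; ring.
rewrite e1 e2.
have w2 : m%:R * W = m%:R * ((1 + 'X) * (1 - 'X) * (G^`() * flip G + G * flip G^`())) + (2 * n%:R) * (G * flip G).
  have -> : (n%:R : {poly F}) = m%:R * a%:P by rewrite -!polyC_natr -polyCM aE mulrC divfK.
  by rewrite /klein_wronskian -mul_polyC polyCM polyC_natr; ring.
by rewrite w2; move: P (flip P) => p1 p2; ring.
Qed.

(** With [E] and [D] the even and odd parts of [P], the Wronskian of [P(s)]
    and [P(- s)] is [2 (D' E - D E')]. It vanishes to order [2 k] at 0 while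
    [E(0)] is nonzero, so that [D] vanishes to order [2 k + 1]. *)
Lemma odd_part_order i : (i < k)%N -> (odd_poly P)`_i = 0.
Proof.
move=> ik.
have Gn0 : G != 0 by exact: klein_poly_neq0 G_N1.
have G0 := klein_poly_0 G_ode G_N1 a_nonnat.
have [c c0 eW] := klein_wronskianE G_ode G_N1 a_nonnat.
pose D := (odd_poly P \Po 'X^2) * 'X; pose E := even_poly P \Po 'X^2.
have PE : P = E + D by rewrite /E /D poly_even_odd.
have fX2 q : flip (q \Po 'X^2) = q \Po 'X^2 by rewrite /flip -comp_polyA comp_Xn_poly sqrrN.
have fP : flip P = E - D by rewrite PE flipD {2}/D flipM flipX fX2 /E fX2 mulrN.
have X0 : ('X : {poly F}) != 0 by rewrite polyX_eq0.
have [D0|Dn0] := eqVneq D 0.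
  move/eqP: D0; rewrite /D mulf_eq0 (negPf X0) orbF => /eqP D0.
  have := congr1 (fun p : {poly F} => p`_(i * 2)) D0.
  by rewrite coef_comp_poly_Xn // dvdn_mull // mulnK // coef0.
have [j [q q0 Dq]] := multiplicity_XsubC D 0; rewrite Dn0 /= subr0 in q0 Dq.
have XD : 'X * D^`() = 'X^j * (j%:R * q + 'X * q^`()).
  have := deriv_exp_pred ('X : {poly F}) j; rewrite derivX mul1r => u.
  rewrite Dq derivM mulrDr.
  have -> : 'X * (q * 'X^j^`()) = q * ('X * 'X^j^`()) by ring.
  by rewrite u; ring.
have E0 : E.[0] != 0.
  have -> : E.[0] = P.[0] by rewrite PE hornerD /D hornerM hornerX mulr0 addr0.
  by rewrite hornerM !horner_exp hornerD hornerX -polyC1 hornerC addr0 expr1n mul1r expf_neq0.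
have key : (1 - 'X^2) * (G * flip G) * (2 * ('X^j * ((j%:R * q + 'X * q^`()) * E - 'X * (E^`() * q)))) =
    (m%:R * c)%:P * ('X^((2 * k).+1) * (P * flip P)).
  transitivity ('X * ((1 - 'X^2) * (G * flip G) * (P^`() * flip P - P * (flip P)^`()))).
    rewrite fP PE !derivD derivN.
    have -> : 'X^j * ((j%:R * q + 'X * q^`()) * E - 'X * (E^`() * q)) = ('X * D^`()) * E - 'X * E^`() * D.
      by rewrite XD Dq; ring.
    by move: D^`() E^`() => p1 p2; ring.
  rewrite wronskian_power eW -mul_polyC exprS polyCM polyC_natr; ring.
have jk : (2 * k < j)%N.
  rewrite ltnNge; apply/negP => jk.
  have := key.
  have -> : 'X^((2 * k).+1) = 'X^j * 'X^((2 * k - j).+1) :> {poly F}.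
    by rewrite -exprD; congr ('X^ _); lia.
  move=> {}key.
  have : 'X^j * ((1 - 'X^2) * (G * flip G) * (2 * ((j%:R * q + 'X * q^`()) * E - 'X * (E^`() * q)))
      - (m%:R * c)%:P * ('X^((2 * k - j).+1) * (P * flip P))) = 0.
    by move: key; move: (flip P) P => p1 p2 key; rewrite mulrBr; apply/eqP; rewrite subr_eq0; apply/eqP;
       transitivity ((1 - 'X^2) * (G * flip G) * (2 * ('X^j * ((j%:R * q + 'X * q^`()) * E - 'X * (E^`() * q))))); [ring|rewrite key; ring].
  move/eqP; rewrite mulf_eq0 expf_eq0 (negPf X0) andbF /= => /eqP /(congr1 (fun p => p.[0])).
  rewrite -!polyC_natr.
  rewrite !(hornerD, hornerN, hornerM, hornerX, hornerXn, hornerC) flip_horner oppr0 exprS !(mul0r, mulr0, subr0, addr0).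
  have j0 : (0 < j)%N.
    case: j Dq {XD key jk} => // Dq.
    have := congr1 (fun p => p.[0]) Dq; rewrite /D !hornerM hornerX mulr0 expr0 -polyC1 hornerC mulr1 => e.
    by move: q0; rewrite /root -e eqxx.
  move/eqP.
  by rewrite !mulf_eq0 ?oner_eq0 ?pnatr_eq0 (negPf G0) (negPf E0) (negPf (q0 : q.[0] != 0)) -(prednK j0).
have := congr1 (fun p : {poly F} => p`_((i * 2).+1)) Dq.
rewrite /D coefMX /= coef_comp_poly_Xn // dvdn_mull // mulnK // => ->.
by rewrite coefMXn ifT //; lia.
Qed.

Lemma theta_split : exists Theta1 Theta2 : {poly F},
  P = (Theta1 \Po 'X^2) + 'X^(2 * k + 1) * (Theta2 \Po 'X^2).
Proof.
exists (even_poly P), (drop_poly k (odd_poly P)).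
rewrite -[LHS]poly_even_odd; congr (_ + _).
rewrite -[in LHS](poly_take_drop k (odd_poly P)).
have -> : take_poly k (odd_poly P) = 0.
  by apply/polyP => i; rewrite coef_take_poly coef0; case: ifP => // /odd_part_order.
by rewrite add0r comp_polyM comp_Xn_poly -exprM exprD expr1 -!mulrA mulrC -!mulrA.
Qed.

End ThetaSplitting.

(** * Appell's function *)

Section AppellPolynomial.
Variable R : realType.
Local Notation C := R[i].
Local Open Scope classical_set_scope.
Local Open Scope ring_scope.
Local Open Scope complex_scope.

Lemma pochhammerS (b : C) j : pochhammer b j.+1 = pochhammer b j * (b + j%:R).
Proof. by rewrite /pochhammer big_ord_recr. Qed.

Lemma pochhammer0 (b : C) : pochhammer b 0 = 1.
Proof. by rewrite /pochhammer big_ord0. Qed.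

Lemma pochhammer_eq0 (i j : nat) : (i < j)%N -> pochhammer (- i%:R : C) j = 0.
Proof. by move=> ij; rewrite /pochhammer (bigD1 (Ordinal ij)) //= addNr mul0r. Qed.

Definition appell_coef (k l : nat) (b : C) (p q : nat) : C :=
  pochhammer (k%:R + 1) p * pochhammer (l%:R + 1) q * pochhammer (- k%:R) p * pochhammer (- l%:R) q
    / (pochhammer b (p + q) * p`!%:R * q`!%:R).

Lemma limn_series_finite (f : nat -> C^o) N : (forall i, (N <= i)%N -> f i = 0) ->
  limn (series f) = \sum_(i < N) f i.
Proof.
move=> h; apply: cvg_lim; first exact: norm_hausdorff.
apply: (@cvg_near_cst _ C^o); exists N => // i /= Ni.
rewrite /series /= (big_cat_nat (n := N)) //= [X in _ + X]big_nat_cond [X in _ + X]big1 ?addr0 ?big_mkord //.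
by move=> j /andP[/andP[Nj _] _]; exact: h.
Qed.

(** The factors [(- k)_p] and [(- l)_q] vanish for [p > k] and [q > l]. *)
Lemma appellF3_finite (k l : nat) (b x y : C) :
  appellF3 (k%:R + 1) (l%:R + 1) (- k%:R) (- l%:R) b x y =
  \sum_(p < k.+1) \sum_(q < l.+1) appell_coef k l b p q * x ^+ p * y ^+ q.
Proof.
rewrite /appellF3.
have inner p : limn (series (fun q => pochhammer (k%:R + 1) p * pochhammer (l%:R + 1) q * pochhammer (- k%:R) p * pochhammer (- l%:R) q
    / (pochhammer b (p + q) * p`!%:R * q`!%:R) * x ^+ p * y ^+ q : C^o)) =
    \sum_(q < l.+1) appell_coef k l b p q * x ^+ p * y ^+ q.
  by apply: limn_series_finite => q lq; rewrite (@pochhammer_eq0 l q) // mulr0 !mul0r.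
rewrite (_ : (fun p => _) = (fun p => \sum_(q < l.+1) appell_coef k l b p q * x ^+ p * y ^+ q : C^o)); last by apply/funext => p; rewrite inner.
apply: limn_series_finite => p kp; rewrite big1 // => q _.
by rewrite /appell_coef (@pochhammer_eq0 k p) // mulr0 !mul0r.
Qed.

Variables (k l : nat) (a : C).
Hypothesis a_nonneg : forall j : nat, 1 + a + j%:R != 0.

Let c p q := appell_coef k l (1 + a) p q / 2 ^+ (p + q).

(** The scaling by [2^(p + q)] turns the arguments [(s + 1) / (2 s)] and [(1 +
    s) / 2] of Appell's function into the two factors of [monom]. *)
Definition klein_poly : {poly C} := double_sum k l c.

Lemma pochhammer_neq0 j : pochhammer (1 + a) j != 0.
Proof. by apply/prodf_neq0 => i _; exact: a_nonneg. Qed.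

Lemma klein_poly_ode : klein_op k l a klein_poly = 0.
Proof.
have N p q : 1 + a + p%:R + q%:R != 0 by rewrite -addrA -natrD a_nonneg.
have f0 p : p`!%:R != 0 :> C by rewrite pnatr_eq0 -lt0n fact_gt0.
have p10 p : p%:R + 1 != 0 :> C by rewrite natr1 pnatr_eq0.
have two0 j : 2 ^+ j != 0 :> C by rewrite expf_neq0 // pnatr_eq0.
apply: klein_op_double_sum => [p q|p q|q|p].
- rewrite /c /appell_coef addSn !pochhammerS factS natrM exprS -[p.+1%:R]natr1 natrD.
  move: (N p q) (p10 p) (f0 p) (f0 q) (two0 (p + q)%N) (pochhammer_neq0 (p + q)).
  move: (pochhammer (1 + a) (p + q)) (pochhammer _ p) (pochhammer _ q) (pochhammer _ p) (pochhammer _ q).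
  move: p`!%:R q`!%:R (2 ^+ (p + q)) p%:R q%:R k%:R => P1 Q1 T x y K u u1 u2 u3 u4 h1 h2 h3 h4 h5 h6.
  by field; rewrite h2 h3 h4 h5 h6 addrA h1.
- rewrite /c /appell_coef addnS !pochhammerS factS natrM exprS -[q.+1%:R]natr1 natrD.
  move: (N p q) (p10 q) (f0 p) (f0 q) (two0 (p + q)%N) (pochhammer_neq0 (p + q)).
  move: (pochhammer (1 + a) (p + q)) (pochhammer _ p) (pochhammer _ q) (pochhammer _ p) (pochhammer _ q).
  move: p`!%:R q`!%:R (2 ^+ (p + q)) p%:R q%:R l%:R => P1 Q1 T x y K u u1 u2 u3 u4 h1 h2 h3 h4 h5 h6.
  by field; rewrite h2 h3 h4 h5 h6 addrA h1.
- by rewrite /c /appell_coef (@pochhammer_eq0 k k.+1) // mulr0 !mul0r.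
- by rewrite /c /appell_coef (@pochhammer_eq0 l l.+1) // mulr0 !mul0r.
Qed.

Lemma klein_poly_N1 : klein_poly.[-1] != 0.
Proof.
have mE i j : (monom C i j).[-1] = (i == 0)%N%:R * (-1) ^+ j.
  by rewrite /monom hornerM horner_exp hornerD hornerX hornerC addNr hornerXn expr0n.
rewrite /klein_poly /double_sum horner_sum big_ord_recl [X in _ + X]big1 ?addr0; last first.
  by move=> p _; rewrite horner_sum big1 // => q _; rewrite hornerZ mE mul0r mulr0.
rewrite horner_sum big_ord_recl [X in _ + X]big1 ?addr0; last first.
  by move=> q _; rewrite hornerZ mE mul0r mulr0.
rewrite hornerZ mE /c /appell_coef /= !pochhammer0 ?fact0 expr0 !(mul1r, invr1, mulr1).
by rewrite expf_neq0 // oppr_eq0 oner_eq0.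
Qed.

Lemma klein_poly_appell (s : C) : s != 0 ->
  klein_poly.[s] = s ^+ k * appellF3 (k%:R + 1) (l%:R + 1) (- k%:R) (- l%:R)
    (1 + a) ((s + 1) / (2 * s)) ((1 + s) / 2).
Proof.
move=> s0; rewrite appellF3_finite /klein_poly /double_sum horner_sum mulr_sumr.
apply: eq_bigr => p _; rewrite horner_sum mulr_sumr; apply: eq_bigr => q _.
have pk : (p <= k)%N by rewrite -ltnS.
have -> : s ^+ k = s ^+ (k - p) * s ^+ p by rewrite -exprD subnK.
rewrite hornerZ /monom hornerM horner_exp hornerD hornerX hornerC hornerXn /c.
rewrite !exprD !expr_div_n exprMn [1 + s]addrC.
have two0 j : 2 ^+ j != 0 :> C by rewrite expf_neq0 // pnatr_eq0.
move: (two0 p) (two0 q) (expf_neq0 p s0) => h1 h2 h3.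
by field; rewrite h1 h2 h3.
Qed.

End AppellPolynomial.

(** * Reduction of the hypergeometric equation *)

(** The singular point that carries the exponent difference [n / m]. *)
Inductive place := Place0 | Place1 | Placeoo.

Section OdeIdentity.
Variable F : numFieldType.
Implicit Types (s x a : F).

Definition diff0 v (k l a : F) := match v with Place0 => a | _ => k + 1 / 2 end.
Definition diff1 v (k l a : F) := match v with Place0 => k + 1 / 2 | Place1 => a | Placeoo => l + 1 / 2 end.
Definition diffoo v (k l a : F) := match v with Placeoo => a | _ => l + 1 / 2 end.

(** The Moebius involution that sends the place to 1 and the other two singular
    points to 0 and infinity. *)
Definition wmap v x := match v with Place0 => 1 - x | Place1 => x | Placeoo => x / (x - 1) end.
Definition wmap1 v x : F := match v with Place0 => -1 | Place1 => 1 | Placeoo => - 1 / (x - 1) ^+ 2 end.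
Definition wmap2 v x : F := match v with Placeoo => 2 / (x - 1) ^+ 3 | _ => 0 end.

Definition expo0 v (k e0 e1 : F) := match v with Place0 => e0 / 2 | _ => (e0 - (k + 1 / 2)) / 2 end.
Definition expo1 v (k e0 e1 : F) :=
  match v with Place0 => (e1 - (k + 1 / 2)) / 2 | Place1 => e1 / 2 | Placeoo => (e1 + k - 1 / 2) / 2 end.

Lemma wmapK v x : x != 1 -> wmap v (wmap v x) = x.
Proof.
case: v => //= x1; first by ring.
have h : x - 1 != 0 by rewrite subr_eq0.
have -> : x / (x - 1) - 1 = (x - 1)^-1 by field.
by rewrite invrK divfK.
Qed.

Lemma wmap_regular v x : x != 0 -> x != 1 -> wmap v x != 0 /\ wmap v x != 1.
Proof.
case: v => //= x0 x1.
  by rewrite subr_eq0 eq_sym x1; split=> //; rewrite -subr_eq0 addrAC subrr add0r oppr_eq0.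
have h : x - 1 != 0 by rewrite subr_eq0.
split; first by rewrite mulf_neq0 // invr_neq0.
rewrite -subr_eq0; have -> : x / (x - 1) - 1 = (x - 1)^-1 by field.
by rewrite invr_eq0.
Qed.

(** [kappa] is the logarithmic derivative of the prefactor [x^al (1 - x)^be
    ((1 + s) / (1 - s))^(a / 2)] and [kappa1] the derivative of [kappa];
    [sder] and [sder1] are the first two derivatives of [s], where [s ^ 2 =
    wmap v x]. *)
Definition kappa v (al be a x s : F) :=
  al / x - be / (1 - x) + a / 2 * (wmap1 v x / (s * (1 - wmap v x))).
Definition kappa1 v (al be a x s : F) :=
  - al / x ^+ 2 - be / (1 - x) ^+ 2 + a / 2 * (wmap2 v x / (s * (1 - wmap v x))
    - wmap1 v x ^+ 2 / (2 * s ^+ 3 * (1 - wmap v x)) + wmap1 v x ^+ 2 / (s * (1 - wmap v x) ^+ 2)).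
Definition sder v x s : F := wmap1 v x / (2 * s).
Definition sder1 v x s : F := wmap2 v x / (2 * s) - wmap1 v x ^+ 2 / (4 * s ^+ 3).

(** Substituting the prefactor times [G(s)] into the hypergeometric equation
    gives a multiple of the equation for [G] plus a term that measures the
    mismatch of the squared exponent differences. *)
Lemma ode_identity v (k l a e0 e1 eo s x g g1 g2 : F) :
  s != 0 -> s ^+ 2 != 1 -> x != 0 -> x != 1 -> wmap v x = s ^+ 2 ->
  let al := expo0 v k e0 e1 in let be := expo1 v k e0 e1 in
  let kap := kappa v al be a x s in
  x * (1 - x) * ((kap ^+ 2 + kappa1 v al be a x s) * g
      + (2 * kap * sder v x s + sder1 v x s) * g1 + sder v x s ^+ 2 * g2)
  + (1 - e0 - (2 - e0 - e1) * x) * (kap * g + sder v x s * g1)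
  - ((1 - e0 - e1) ^+ 2 - eo ^+ 2) / 4 * g =
  x * (1 - x) * sder v x s ^+ 2 / (s * (1 - s ^+ 2)) *
    (s * (1 - s ^+ 2) * g2 + (2 * a * s - 2 * s ^+ 2 - 2 * k * (1 - s ^+ 2)) * g1
      + ((l * (l + 1) - k * (k - 1)) * s - 2 * k * a) * g)
  + g * (- (e0 ^+ 2 - diff0 v k l a ^+ 2) / (4 * x) - (e1 ^+ 2 - diff1 v k l a ^+ 2) / (4 * (1 - x))
     + (eo ^+ 2 - diffoo v k l a ^+ 2) / 4).
Proof.
move=> s0 s1 x0 x1 wx.
have s1' : 1 - s ^+ 2 != 0 by rewrite subr_eq0 eq_sym.
have s1'' : s ^+ 2 - 1 != 0 by rewrite subr_eq0.
have xE : x = wmap v (s ^+ 2) by rewrite -wx wmapK.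
rewrite /kappa /kappa1 /sder /sder1 xE.
case: v {wx xE} => /=.
- have h : 1 - (1 - s ^+ 2) = s ^+ 2 by ring.
  by field; rewrite ?h ?expf_neq0 ?s0 ?s1' ?s1''.
- by field; rewrite ?expf_neq0 ?s0 ?s1' ?s1''.
- have -> : s ^+ 2 / (s ^+ 2 - 1) - 1 = (s ^+ 2 - 1)^-1 by field.
  have -> : 1 - s ^+ 2 / (s ^+ 2 - 1) = - (s ^+ 2 - 1)^-1 by field.
  by field; rewrite ?expf_neq0 ?s0 ?s1' ?s1''.
Qed.
End OdeIdentity.

(** * Branches of the elementary functions *)

Section HolClosure.
Variable R : realType.
Local Notation C := R[i].
Local Open Scope classical_set_scope.
Local Open Scope ring_scope.
Local Open Scope complex_scope.
Implicit Types f g L : C -> C.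

Lemma hol_cst (c x : C) : hol (fun=> c) x.
Proof. by near=> z; exists 0; exact: cder_cst.
Unshelve. all: by end_near. Qed.
Lemma hol_id (x : C) : hol id x.
Proof. by near=> z; exists 1; exact: cder_id.
Unshelve. all: by end_near. Qed.
Lemma holD f g (x : C) : hol f x -> hol g x -> hol (fun z => f z + g z) x.
Proof. by apply: filterS2 => z [d hd] [e he]; eexists; exact: cderD hd he. Qed.
Lemma holN f (x : C) : hol f x -> hol (fun z => - f z) x.
Proof. by apply: filterS => z [d hd]; eexists; exact: cderN hd. Qed.
Lemma holB f g (x : C) : hol f x -> hol g x -> hol (fun z => f z - g z) x.
Proof. by move=> hf hg; apply: holD => //; exact: holN. Qed.
Lemma holM f g (x : C) : hol f x -> hol g x -> hol (fun z => f z * g z) x.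
Proof. by apply: filterS2 => z [d hd] [e he]; eexists; exact: cderM hd he. Qed.
Lemma holZ f (c x : C) : hol f x -> hol (fun z => c * f z) x.
Proof. by move=> hf; apply: holM => //; exact: hol_cst. Qed.
Lemma holX f n (x : C) : hol f x -> hol (fun z => f z ^+ n) x.
Proof. by apply: filterS => z [d hd]; eexists; exact: cderX hd. Qed.
Lemma hol_cexp f (x : C) : hol f x -> hol (fun z => cexp (f z)) x.
Proof. by apply: filterS => z [d hd]; eexists; exact: cder_cexp_comp hd. Qed.
Lemma hol_poly f (p : {poly C}) (x : C) : hol f x -> hol (fun z => p.[f z]) x.
Proof. by apply: filterS => z [d hd]; eexists; exact: cder_comp hd (cder_poly p _). Qed.
Lemma holV f (x : C) : hol f x -> f x != 0 -> hol (fun z => (f z)^-1) x.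
Proof.
move=> hf fx; have := near_neq0 (hol_continuous hf) fx.
by apply: filterS2 hf => z [d hd] f0; eexists; exact: cderV f0 hd.
Qed.
Lemma hol_div f g (x : C) : hol f x -> hol g x -> g x != 0 -> hol (fun z => f z / g z) x.
Proof. by move=> hf hg gx; apply: holM => //; exact: holV. Qed.

Lemma near_and (x : C) (P Q : C -> Prop) : (\forall z \near (x : C^o), P z) ->
  (\forall z \near (x : C^o), Q z) -> \forall z \near (x : C^o), P z /\ Q z.
Proof. by move=> h k; apply: filterS2 h k. Qed.

(** The quotient [f / g] has a constant nonzero power, and therefore
    derivative zero. *)
Lemma pow_eq_const f g (x : C) N : (0 < N)%N -> hol f x -> hol g x ->
  g x != 0 -> (\forall z \near (x : C^o), f z ^+ N = g z ^+ N) ->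
  exists2 c, c != 0 & \forall z \near (x : C^o), f z = c * g z.
Proof.
move=> N0 hf hg gx e.
have gn := near_neq0 (hol_continuous hg) gx.
have hh : hol (fun z => f z / g z) x by exact: hol_div.
have pw : \forall z \near (x : C^o), (f z / g z) ^+ N = 1.
  by apply: filterS2 gn e => z g0 ez; rewrite expr_div_n ez divff // expf_neq0.
have fx : f x != 0.
  apply/eqP => f0; have := nbhs_singleton e; rewrite f0 expr0n eqn0Ngt N0 => /esym/eqP.
  by rewrite expf_eq0 N0 (negPf gx).
have /near_cder0_const cst : \forall z \near (x : C^o), cder (fun z => f z / g z) z 0.
  move: (germ_near pw); apply: filterS2 hh => z [d hd] pz.
  have pz' : \forall w \near (z : C^o), 1 = (f w / g w) ^+ N by apply: filterS pz.
  have h1 := cderX N hd; have h2 := cder_near pz' (cder_cst 1 z).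
  have /eqP := cder_unique h1 h2.
  have r0 : f z / g z != 0.
    apply/eqP => r0; have := nbhs_singleton pz; rewrite r0 expr0n eqn0Ngt N0 => /eqP.
    by rewrite eq_sym oner_eq0.
  by rewrite !mulf_eq0 pnatr_eq0 eqn0Ngt N0 /= expf_eq0 (negPf r0) andbF orbF => /eqP d0; rewrite -d0.
exists (f x / g x); first by rewrite mulf_neq0 // invr_neq0.
by apply: filterS2 gn cst => z g0 <-; rewrite divfK.
Qed.

End HolClosure.

Section Germs.
Variable R : realType.
Local Notation C := R[i].
Local Open Scope classical_set_scope.
Local Open Scope ring_scope.
Local Open Scope complex_scope.

(** Branches of [log x], [log (1 - x)], of a square root [s] of [wmap v x] and
    of [log ((1 + s) / (1 - s))]: all local solutions are expressed in them. *)
Record germs := Germs { gL0 : C -> C; gL1 : C -> C; gs : C -> C; gU : C -> C }.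

(** The last equation says that [gU d x] is a logarithm of [(1 + s) / (1 - s)]
    for [s = gs d x]. *)
Definition germ_eqs v (d : germs) (x : C) : Prop :=
  [/\ cexp (gL0 d x) = x, cexp (gL1 d x) = 1 - x, gs d x ^+ 2 = wmap v x &
      cexp (gU d x) * (1 - gs d x) = 1 + gs d x].

Definition is_germs v (x : C) (d : germs) : Prop :=
  [/\ hol (gL0 d) x, hol (gL1 d) x, hol (gs d) x & hol (gU d) x] /\
  \forall z \near (x : C^o), germ_eqs v d z.

Definition germs_opp d := Germs (gL0 d) (gL1 d) (fun z => - gs d z) (fun z => - gU d z).

Lemma germ_eqs_regular v d x : germ_eqs v d x ->
  [/\ x != 0, x != 1, gs d x != 0, 1 + gs d x != 0 & 1 - gs d x != 0].
Proof.
move=> [e0 e1 es eU].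
have x0 : x != 0 by rewrite -e0 cexp_neq0.
have x1 : 1 - x != 0 by rewrite -e1 cexp_neq0.
have x1' : x != 1 by rewrite eq_sym -subr_eq0.
have [w0 w1] := wmap_regular v x0 x1'.
have s0 : gs d x != 0 by apply: contraNneq w0 => s0; rewrite -es s0 expr0n.
split=> //; apply: contraNneq w1; rewrite -es.
  by move=> /eqP; rewrite addrC addr_eq0 => /eqP ->; rewrite sqrrN expr1n.
by move=> /eqP; rewrite subr_eq0 => /eqP <-; rewrite expr1n.
Qed.

Lemma is_germs_opp v x d : is_germs v x d -> is_germs v x (germs_opp d).
Proof.
move=> [[h0 h1 hs hU] e]; split; first by split => //; exact: holN.
apply: filterS e => z ez; have [_ _ _ sp sm] := germ_eqs_regular ez.
case: ez => e0 e1 es eU; split => //=; first by rewrite sqrrN.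
rewrite opprK cexpN; apply: (mulfI (cexp_neq0 (gU d z))).
by rewrite eU mulrA divff ?cexp_neq0 // mul1r.
Qed.

Lemma is_germs_near v x d : is_germs v x d -> \forall z \near (x : C^o), is_germs v z d.
Proof.
move=> [[h0 h1 hs hU] e].
have k1 := near_and (hol_near h0) (hol_near h1); have k2 := near_and (hol_near hs) (hol_near hU).
by move: k1 k2 (germ_near e); apply: filterS3 => z [a b] [c f] g.
Qed.

(** The square root is the exponential of half a logarithm of [wmap v]; the
    value [2 * ls] of that logarithm at [x] makes the square root equal to
    [cexp ls] there. *)
Definition germs_at v (x l0 l1 ls u : C) : germs :=
  let s := fun z => cexp (loclog (wmap v) (2 * ls) x z / 2) in
  Germs (loclog id l0 x) (loclog (fun z => 1 - z) l1 x) s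
    (loclog (fun z => (1 + s z) / (1 - s z)) u x).

Lemma hol_wmap v (x : C) : x != 1 -> hol (wmap v : C -> C) x.
Proof.
move=> x1; case: v => /=; [|exact: hol_id|].
  by apply: holB; [exact: hol_cst|exact: hol_id].
by apply: hol_div; [exact: hol_id|apply: holB; [exact: hol_id|exact: hol_cst]|rewrite subr_eq0].
Qed.

Lemma germs_atP v (x l0 l1 ls u : C) : cexp l0 = x -> cexp l1 = 1 - x ->
  cexp ls ^+ 2 = wmap v x -> cexp u * (1 - cexp ls) = 1 + cexp ls ->
  is_germs v x (germs_at v x l0 l1 ls u) /\
  [/\ gL0 (germs_at v x l0 l1 ls u) x = l0, gL1 (germs_at v x l0 l1 ls u) x = l1,
      gs (germs_at v x l0 l1 ls u) x = cexp ls & gU (germs_at v x l0 l1 ls u) x = u].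
Proof.
move=> e0 e1 es eu.
have x0 : x != 0 by rewrite -e0 cexp_neq0.
have x1 : 1 - x != 0 by rewrite -e1 cexp_neq0.
have x1' : x != 1 by rewrite eq_sym -subr_eq0.
have [w0 w1] := wmap_regular v x0 x1'.
have hw := hol_wmap v x1'.
have h1x : hol (fun z => 1 - z) x by apply: holB; [exact: hol_cst|exact: hol_id].
have es2 : cexp (2 * ls) = wmap v x by rewrite -es -cexpMn.
have hLw := hol_loclog (2 * ls) hw w0; have eLw := cexp_loclog hw w0 es2.
pose s := fun z => cexp (loclog (wmap v) (2 * ls) x z / 2).
have hs : hol s x.
  by apply: hol_cexp; apply: holM => //; exact: hol_cst.
have sx : s x = cexp ls.
  by rewrite /s loclog_base //; congr cexp; rewrite mulrAC divff ?mul1r // pnatr_eq0.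
have sE : \forall z \near (x : C^o), s z ^+ 2 = wmap v z.
  apply: filterS eLw => z <-; rewrite /s -cexpMn; congr cexp.
  by rewrite mulrC divfK // pnatr_eq0.
have sm : 1 - s x != 0.
  by rewrite sx subr_eq0; apply: contraNneq w1 => h; rewrite -es -h expr1n.
have sp : 1 + s x != 0.
  by rewrite sx; apply: contraNneq w1 => /eqP; rewrite addrC addr_eq0 => /eqP h; rewrite -es h sqrrN expr1n.
have hq : hol (fun z => (1 + s z) / (1 - s z)) x.
  apply: hol_div => //; first by apply: holD => //; exact: hol_cst.
  by apply: holB => //; exact: hol_cst.
have q0 : (1 + s x) / (1 - s x) != 0 by rewrite mulf_neq0 // invr_neq0.
have qE : cexp u = (1 + s x) / (1 - s x).
  by apply: (mulIf sm); rewrite divfK // sx.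
have h1xn : (fun z : C => 1 - z) x != 0 by [].
have smn : \forall z \near (x : C^o), 1 - s z != 0.
  have hsm : hol (fun z => 1 - s z) x by apply: holB => //; exact: hol_cst.
  exact: (near_neq0 (hol_continuous hsm)).
split; last first.
  split; [exact: (@loclog_base R id l0 x x0)|exact: (@loclog_base R (fun z => 1 - z) l1 x h1xn)|exact: sx|].
  exact: (@loclog_base R (fun z => (1 + s z) / (1 - s z)) u x q0).
split; first by split; [apply: hol_loclog => //; exact: hol_id|exact: hol_loclog|exact: hs|exact: hol_loclog].
have k1 := cexp_loclog (hol_id x) x0 e0.
have k2 := cexp_loclog h1x h1xn e1.
have k3 := cexp_loclog hq q0 qE.
have k12 := near_and k1 k2; have k34 := near_and k3 smn.
move: k12 k34 sE; apply: filterS3 => z [a b] [c f] g; split => //=.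
by rewrite -/s c divfK.
Qed.

Lemma germs_exist v (x : C) : x != 0 -> x != 1 -> exists d, is_germs v x d.
Proof.
move=> x0 x1; have [w0 w1] := wmap_regular v x0 x1.
have [l0 e0] := cexp_onto x0.
have x1' : 1 - x != 0 by rewrite subr_eq0 eq_sym.
have [l1 e1] := cexp_onto x1'.
pose s := sqrtc (wmap v x); have sE : s ^+ 2 = wmap v x by exact: sqr_sqrtc.
have s0 : s != 0 by apply: contraNneq w0 => s0; rewrite -sE s0 expr0n.
have sm : 1 - s != 0.
  by rewrite subr_eq0; apply: contraNneq w1 => h; rewrite -sE -h expr1n.
have sp : 1 + s != 0.
  by apply: contraNneq w1 => /eqP; rewrite addrC addr_eq0 => /eqP h; rewrite -sE h sqrrN expr1n.
have [ls es] := cexp_onto s0.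
have [u eu] : exists u, cexp u = (1 + s) / (1 - s).
  by apply: cexp_onto; rewrite mulf_neq0 // invr_neq0.
have [||h _] := germs_atP (v := v) (ls := ls) (u := u) e0 e1; last by eexists; exact: h.
  by rewrite es.
by rewrite eu es divfK.
Qed.

Lemma cder_gs v x d : is_germs v x d -> cder (gs d) x (sder v x (gs d x)).
Proof.
move=> [[_ _ hs _] e]; have ex := nbhs_singleton e.
have [x0 x1 s0 _ _] := germ_eqs_regular ex.
have [a ha] := hol_cder hs.
have dw : cder (wmap v) x (wmap1 v x).
  case: (v) => /=.
  - by apply: cder_eq (cderB (cder_cst 1 x) (cder_id x)) _; rewrite sub0r.
  - exact: cder_id.
  - have x1' : x - 1 != 0 by rewrite subr_eq0.
    have h : cder (fun z => z - 1) x 1.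
      by apply: cder_eq (cderB (cder_id x) (cder_cst 1 x)) _; rewrite subr0.
    by apply: cder_eq (cderM (cder_id x) (@cderV R (fun z => z - 1) x 1 x1' h)) _; field.
have e2 : \forall z \near (x : C^o), gs d z ^+ 2 = wmap v z by apply: filterS e => z [].
have h := cder_near e2 (cderX 2 ha).
apply: cder_eq ha _; rewrite /sder -(cder_unique h dw) /=.
by field.
Qed.

Lemma cder_gL0 v x d : is_germs v x d -> cder (gL0 d) x (x^-1).
Proof.
move=> [[h _ _ _] e]; rewrite -[x^-1]mul1r.
by apply: (cder_log (f := id)) (cder_id x) => //; apply: filterS e => z [].
Qed.

Lemma cder_gL1 v x d : is_germs v x d -> cder (gL1 d) x (- 1 / (1 - x)).
Proof.
move=> [[_ h _ _] e].
have e1 : \forall z \near (x : C^o), cexp (gL1 d z) = 1 - z by apply: filterS e => z [].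
apply: (cder_log e1 h); apply: cder_eq (cderB (cder_cst 1 x) (cder_id x)) _.
by rewrite sub0r.
Qed.

Lemma cder_gU v x d : is_germs v x d -> cder (gU d) x (wmap1 v x / (gs d x * (1 - wmap v x))).
Proof.
move=> hd; have [[_ _ _ h] e] := hd.
have ex := nbhs_singleton e; have [x0 x1 s0 sp sm] := germ_eqs_regular ex.
have e1 : \forall z \near (x : C^o), cexp (gU d z) = (1 + gs d z) / (1 - gs d z).
  apply: filterS e => z ez; have [_ _ _ _ sz] := germ_eqs_regular ez.
  by case: ez => _ _ _ <-; rewrite mulfK.
have ds := cder_gs hd.
have dq : cder (fun z => (1 + gs d z) / (1 - gs d z)) x (2 * sder v x (gs d x) / (1 - gs d x) ^+ 2).
  have h1 := cderD (cder_cst 1 x) ds; have h2 := cderB (cder_cst 1 x) ds.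
  by apply: cder_eq (cderM h1 (@cderV R (fun z => 1 - gs d z) x _ sm h2)) _; field.
apply: cder_eq (cder_log e1 h dq) _; case: ex => _ _ <- _.
have s2 : 1 - gs d x ^+ 2 != 0.
  have -> : 1 - gs d x ^+ 2 = (1 - gs d x) * (1 + gs d x) by ring.
  by rewrite mulf_neq0.
by rewrite /sder; field; rewrite s2 sp sm s0.
Qed.

End Germs.

(** * The explicit basis of solutions *)

(** [dmat z false] is the diagonal matrix with entries [z, 1] and
    [dmat z true] is its product with the exchange of the two coordinates. *)
Definition dmat (F : fieldType) (z : F) (e : bool) : 'M[F]_2 :=
  \matrix_(i, j) (((j != i) == e)%:R * (if i == 0 then z else 1)).

Section DihedralSolutions.
Variable R : realType.
Local Notation C := R[i].
Local Open Scope classical_set_scope.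
Local Open Scope ring_scope.
Local Open Scope complex_scope.

(** Up to signs, [H] has exponent differences [k + 1/2], [l + 1/2] and [n /
    m], the last one at [v]; [G] gives its explicit solutions. *)
Record dihedral_eq v (k l m n : nat) (G : {poly C}) (H : hypergeometric_eq R) : Prop := DihedralEq {
  de_m_gt0 : (0 < m)%N;
  de_n_gt0 : (0 < n)%N;
  de_nonnat : forall j : nat, (n%:R / m%:R : C) != j%:R;
  de_ode : klein_op k l (n%:R / m%:R) G = 0;
  de_N1 : G.[-1] != 0;
  de_diff0 : (1 - paramC H) ^+ 2 = diff0 v k%:R l%:R (n%:R / m%:R) ^+ 2;
  de_diff1 : (paramC H - paramA H - paramB H) ^+ 2 = diff1 v k%:R l%:R (n%:R / m%:R) ^+ 2;
  de_diffoo : (paramA H - paramB H) ^+ 2 = diffoo v k%:R l%:R (n%:R / m%:R) ^+ 2 }.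

Variables (v : place) (k l m n : nat) (G : {poly C}) (H : hypergeometric_eq R).
Hypothesis HD : dihedral_eq v k l m n G H.
Local Notation a := (n%:R / m%:R : C).
Let e0 : C := 1 - paramC H.
Let e1 : C := paramC H - paramA H - paramB H.
Let al : C := expo0 v k%:R e0 e1.
Let be : C := expo1 v k%:R e0 e1.

Definition prefactor (d : germs R) (x : C) : C :=
  cexp (al * gL0 d x + be * gL1 d x + a / 2 * gU d x).
Definition sol1 (d : germs R) (x : C) : C := prefactor d x * G.[gs d x].
(** The two solutions correspond to the two square roots of [wmap v x]. *)
Definition sol (d : germs R) (i : 'I_2) : C -> C := if i == 0 then sol1 d else sol1 (germs_opp d).

Lemma cder_wmap1 (x : C) : x != 1 -> cder (wmap1 v) x (wmap2 v x : C).
Proof.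
move=> x1; case: (v) => /=; [exact: cder_cst|exact: cder_cst|].
have x1' : (x - 1) ^+ 2 != 0 by rewrite expf_neq0 // subr_eq0.
have h : cder (fun z => (z - 1) ^+ 2) x (2 * (x - 1)).
  have h := cderX 2 (cderB (cder_id x) (cder_cst 1 x)).
  by apply: cder_eq h _; rewrite subr0 mulr1.
apply: cder_eq (cderM (cder_cst (-1) x) (@cderV R (fun z => (z - 1) ^+ 2) x _ x1' h)) _.
by field; move: x1'; rewrite expf_eq0.
Qed.

Lemma cder_wmap (x : C) : x != 1 -> cder (wmap v) x (wmap1 v x : C).
Proof.
move=> x1; case: (v) => /=.
- by apply: cder_eq (cderB (cder_cst 1 x) (cder_id x)) _; rewrite sub0r.
- exact: cder_id.
- have x1' : x - 1 != 0 by rewrite subr_eq0.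
  have h : cder (fun z => z - 1) x 1.
    by apply: cder_eq (cderB (cder_id x) (cder_cst 1 x)) _; rewrite subr0.
  by apply: cder_eq (cderM (cder_id x) (@cderV R (fun z => z - 1) x 1 x1' h)) _; field.
Qed.

Lemma germs_data (x : C) (d : germs R) : is_germs v x d ->
  [/\ x != 0, 1 - x != 0, gs d x != 0, 1 - wmap v x != 0 & gs d x ^+ 2 = wmap v x].
Proof.
move=> [_ e]; have ex := nbhs_singleton e; have [x0 x1 s0 sp sm] := germ_eqs_regular ex.
have [_ _ es _] := ex; split=> //; first by rewrite subr_eq0 eq_sym.
rewrite -es; have -> : 1 - gs d x ^+ 2 = (1 - gs d x) * (1 + gs d x) by ring.
by rewrite mulf_neq0.
Qed.

Lemma cder_sder (x : C) (d : germs R) : is_germs v x d ->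
  cder (fun z => sder v z (gs d z)) x (sder1 v x (gs d x)).
Proof.
move=> hd; have [x0 x1 s0 _ _] := germs_data hd.
have x1' : x != 1 by rewrite eq_sym -subr_eq0.
have s2 : 2 * gs d x != 0 by rewrite mulf_neq0 // pnatr_eq0.
have h := cderM (cder_wmap1 x1') (@cderV R (fun z => 2 * gs d z) x _ s2 (cderZ 2 (cder_gs hd))).
apply: cder_eq h _; rewrite /sder /sder1.
by move: (wmap1 v x) (wmap2 v x) => w1 w2; field.
Qed.

Lemma cder_kappa (x : C) (d : germs R) : is_germs v x d ->
  cder (fun z => kappa v al be a z (gs d z)) x (kappa1 v al be a x (gs d x)).
Proof.
move=> hd; have [x0 x1 s0 w0 _] := germs_data hd.
have x1' : x != 1 by rewrite eq_sym -subr_eq0.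
have d1 := cderM (cder_cst al x) (@cderV R id x 1 x0 (cder_id x)).
have h1 := cderB (cder_cst 1 x) (cder_id x).
have d2 := cderM (cder_cst be x) (@cderV R (fun z => 1 - z) x _ x1 h1).
have h3 := cderM (cder_gs hd) (cderB (cder_cst 1 x) (cder_wmap x1')).
have sw : gs d x * (1 - wmap v x) != 0 by rewrite mulf_neq0.
have d3 := cderZ (a / 2) (cderM (cder_wmap1 x1') (@cderV R (fun z => gs d z * (1 - wmap v z)) x _ sw h3)).
apply: cder_eq (cderD (cderB d1 d2) d3) _; rewrite /sder /kappa1.
move: w0 s0; move: (wmap v x) (wmap1 v x) (wmap2 v x) (gs d x) (a / 2) => w w1 w2 s aa w0 s0.
by field; rewrite w0 s0 x1 x0.
Qed.

Lemma cder_prefactor (x : C) (d : germs R) : is_germs v x d ->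
  cder (prefactor d) x (kappa v al be a x (gs d x) * prefactor d x).
Proof.
move=> hd; apply: cder_cexp_comp.
apply: cder_eq (cderD (cderD (cderZ al (cder_gL0 hd)) (cderZ be (cder_gL1 hd))) (cderZ (a / 2) (cder_gU hd))) _.
by rewrite /kappa mulN1r mulrN.
Qed.

Definition sol1_d1 (d : germs R) (x : C) : C :=
  prefactor d x * (kappa v al be a x (gs d x) * G.[gs d x] + sder v x (gs d x) * G^`().[gs d x]).
Definition sol1_d2 (d : germs R) (x : C) : C :=
  let s := gs d x in let kap := kappa v al be a x s in
  prefactor d x * ((kap ^+ 2 + kappa1 v al be a x s) * G.[s]
      + (2 * kap * sder v x s + sder1 v x s) * G^`().[s] + sder v x s ^+ 2 * G^`()^`().[s]).

Lemma cder_sol1 (x : C) (d : germs R) : is_germs v x d -> cder (sol1 d) x (sol1_d1 d x).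
Proof.
move=> hd; apply: cder_eq (cderM (cder_prefactor hd) (cder_comp (cder_gs hd) (cder_poly G _))) _.
by rewrite /sol1_d1; ring.
Qed.

Lemma cder_sol1_d1 (x : C) (d : germs R) : is_germs v x d -> cder (sol1_d1 d) x (sol1_d2 d x).
Proof.
move=> hd.
have h1 := cderM (cder_kappa hd) (cder_comp (cder_gs hd) (cder_poly G _)).
have h2 := cderM (cder_sder hd) (cder_comp (cder_gs hd) (cder_poly G^`() _)).
apply: cder_eq (cderM (cder_prefactor hd) (cderD h1 h2)) _.
by rewrite /sol1_d2; ring.
Qed.

Lemma sol1_ode (x : C) (d : germs R) : is_germs v x d -> ode H x (sol1 d x) (sol1_d1 d x) (sol1_d2 d x).
Proof.
move=> hd; have [x0 x1 s0 w0 sw] := germs_data hd.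
have x1' : x != 1 by rewrite eq_sym -subr_eq0.
have s1 : gs d x ^+ 2 != 1 by rewrite sw eq_sym -subr_eq0.
have id := ode_identity (k%:R : C) l%:R a e0 e1 (paramA H - paramB H) G.[gs d x] G^`().[gs d x] G^`()^`().[gs d x] s0 s1 x0 x1' (esym sw).
have opE : gs d x * (1 - gs d x ^+ 2) * G^`()^`().[gs d x] +
    (2 * a * gs d x - 2 * gs d x ^+ 2 - 2 * k%:R * (1 - gs d x ^+ 2)) * G^`().[gs d x] +
    ((l%:R * (l%:R + 1) - k%:R * (k%:R - 1)) * gs d x - 2 * k%:R * a) * G.[gs d x] = 0.
  have := congr1 (fun p : {poly C} => p.[gs d x]) (de_ode HD).
  rewrite /klein_op !(hornerD, hornerN, hornerM, hornerZ, hornerX, hornerXn, hornerC) => h.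
  by rewrite -[RHS]h.
have f0 : e0 ^+ 2 = diff0 v k%:R l%:R a ^+ 2 := de_diff0 HD.
have f1 : e1 ^+ 2 = diff1 v k%:R l%:R a ^+ 2 := de_diff1 HD.
cbv zeta in id; rewrite opE f0 f1 -(de_diffoo HD) !subrr oppr0 !mul0r subr0 addr0 !mulr0 addr0 -/al -/be in id.
rewrite /ode /sol1_d1 /sol1_d2 /sol1.
move: id; move: (kappa v _ _ _ _ _) (kappa1 v _ _ _ _ _) (sder v x _) (sder1 v x _) => kp kp1 sd sd1.
move: (G.[gs d x]) (G^`().[gs d x]) (G^`()^`().[gs d x]) (prefactor d x) => g g1 g2 E id.
have idE := congr1 (fun t => E * t) id; rewrite mulr0 in idE.
by rewrite -[RHS]idE /e0 /e1; field.
Qed.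

Lemma sol1_solves (x : C) (d : germs R) : is_germs v x d -> solves_near H x (sol1 d).
Proof.
move=> hd; apply/solves_nearP; exists (sol1_d1 d), (sol1_d2 d).
apply: filterS (is_germs_near hd) => z hz.
by split; [exact: cder_sol1|exact: cder_sol1_d1|exact: sol1_ode].
Qed.

(** Up to nonzero factors the Wronskian of the two solutions is
    [klein_wronskian], a nonzero multiple of [s^(2 k)]. *)
Lemma sol_fundamental (x : C) (d : germs R) : is_germs v x d -> fundamental H x (sol d).
Proof.
move=> hd; have hd' := is_germs_opp hd.
split; first by move=> i; rewrite /sol; case: ifP => _; exact: sol1_solves.
have [x0 x1 s0 w0 sw] := germs_data hd.
have x1' : x != 1 by rewrite eq_sym -subr_eq0.
rewrite /wronskian /sol /= (cder_der (cder_sol1 hd)) (cder_der (cder_sol1 hd')).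
rewrite /sol1_d1 /sol1 /= /sder.
have E1 : prefactor d x != 0 by exact: cexp_neq0.
have E2 : prefactor (germs_opp d) x != 0 by exact: cexp_neq0.
have [c c0 eW] := klein_wronskianE (de_ode HD) (de_N1 HD) (de_nonnat HD).
have := congr1 (fun p : {poly C} => p.[gs d x]) eW; rewrite /klein_wronskian.
rewrite !(hornerD, hornerN, hornerM, hornerZ, hornerX, hornerXn, hornerC) !flip_horner => eW'.
have w1 : wmap1 v x != 0.
  case: (v) => /=; rewrite ?oppr_eq0 ?oner_eq0 //.
  by rewrite mulf_neq0 ?oppr_eq0 ?oner_eq0 // invr_neq0 // expf_neq0 // subr_eq0.
have w0' : 1 - gs d x ^+ 2 != 0 by rewrite sw.
suff -> : prefactor d x * G.[gs d x] * (prefactor (germs_opp d) x * (kappa v al be a x (- gs d x) * G.[- gs d x]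
     + wmap1 v x / (2 * - gs d x) * G^`().[- gs d x])) -
   prefactor d x * (kappa v al be a x (gs d x) * G.[gs d x] + wmap1 v x / (2 * gs d x) * G^`().[gs d x]) *
    (prefactor (germs_opp d) x * G.[- gs d x]) =
   - (prefactor d x * prefactor (germs_opp d) x * (wmap1 v x / (2 * gs d x)) / (1 - gs d x ^+ 2) * (c * gs d x ^+ (2 * k))).
  have t1 : wmap1 v x / (2 * gs d x) != 0.
    by rewrite mulf_neq0 // invr_neq0 // mulf_neq0 // pnatr_eq0.
  by rewrite oppr_eq0 (mulf_neq0 (mulf_neq0 (mulf_neq0 (mulf_neq0 E1 E2) t1) (invr_neq0 w0'))) // mulf_neq0 // expf_neq0.
rewrite -eW' /kappa -sw.
move: w0' s0; move: (wmap1 v x) (gs d x) (prefactor d x) (prefactor _ x) => w s E E' w0' s0.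
move: G.[s] G.[- s] G^`().[s] G^`().[- s] => g g' h h'.
by field; rewrite ?x0 ?x1 ?s0 ?w0' ?pnatr_eq0 -?lt0n ?(de_m_gt0 HD) ?andbT.
Qed.

Lemma sol_opp (d : germs R) i (x : C) : sol (germs_opp d) i x = sol d (if i == 0 then 1 else 0) x.
Proof.
by rewrite /sol; case: ifP => _ //=; rewrite /sol1 /prefactor /= !opprK.
Qed.

Lemma sum2_dmat z e (f : 'I_2 -> C) i :
  \sum_j dmat z e i j * f j = (if i == 0 then z else 1) * f (if (i == 0) == e then 1 else 0).
Proof.
by have [->|->] := ord2 i; rewrite sum2 !mxE /=; case: e => /=;
   rewrite ?eqxx /= ?mul0r ?mul1r ?add0r ?addr0.
Qed.

(** Logarithms of the same function differ by a constant, so that only the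
    constant factors of the two solutions change. *)
Lemma germs_same (x : C) (d d' : germs R) : is_germs v x d -> is_germs v x d' -> gs d' x = gs d x ->
  let c0 := gL0 d' x - gL0 d x in let c1 := gL1 d' x - gL1 d x in
  let cU := gU d' x - gU d x in
  cexp cU = 1 /\ forall i, \forall y \near (x : C^o),
    sol d' i y = cexp (al * c0 + be * c1 - a / 2 * cU) * \sum_j dmat (cexp (a * cU)) false i j * sol d j y.
Proof.
move=> hd hd' sE; have [[h0 h1 hs hU] e] := hd; have [[h0' h1' hs' hU'] e'] := hd'.
have [x0 x1 s0 w0 sw] := germs_data hd.
have sn : \forall y \near (x : C^o), gs d' y = gs d y.
  have ss : (fun y => gs d' y + gs d y) x != 0 by rewrite sE -mulr2n -mulr_natl mulf_neq0 // pnatr_eq0.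
  have := near_neq0 (hol_continuous (holD hs' hs)) ss.
  move: e e'; apply: filterS3 => y [_ _ a1 _] [_ _ a2 _] a3.
  apply/eqP; rewrite -subr_eq0 -(mulIr_eq0 _ (mulIf a3)); apply/eqP.
  by rewrite -subr_sqr a1 a2 subrr.
have L0n := log_unique h0' h0; have L1n := log_unique h1' h1; have Un := log_unique hU' hU.
have {}L0n : \forall y \near (x : C^o), gL0 d' y = gL0 d y + (gL0 d' x - gL0 d x).
  by apply: L0n; apply: filterS2 e e' => y [-> _ _ _] [-> _ _ _].
have {}L1n : \forall y \near (x : C^o), gL1 d' y = gL1 d y + (gL1 d' x - gL1 d x).
  by apply: L1n; apply: filterS2 e e' => y [_ -> _ _] [_ -> _ _].
have {}Un : \forall y \near (x : C^o), gU d' y = gU d y + (gU d' x - gU d x).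
  apply: Un; move: e e' sn; apply: filterS3 => y ey ey' sy.
  have [_ _ _ _ sm] := germ_eqs_regular ey; case: ey ey' => _ _ _ u1 [_ _ _ u2].
  by apply: (mulIf sm); rewrite u1 -sy u2.
move=> c0 c1 cU; rewrite -/cU in Un; rewrite -/c0 in L0n; rewrite -/c1 in L1n; split.
  have ex := nbhs_singleton e; have ex' := nbhs_singleton e'.
  have [_ _ _ _ sm] := germ_eqs_regular ex; case: ex ex' => _ _ _ u1 [_ _ _ u2].
  rewrite /cU cexpB; apply: (mulIf (cexp_neq0 (gU d x))); rewrite divfK ?cexp_neq0 // mul1r.
  by apply: (mulIf sm); rewrite u1 -sE u2.
move=> i; have LL := near_and L0n L1n; move: LL Un sn; apply: filterS3 => y [p1 p2] p3 p4.
rewrite sum2_dmat /sol; case: eqP => i0 /=.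
  rewrite /sol1 /prefactor p1 p2 p3 p4 [RHS]mulrA [RHS]mulrA -!cexpD; congr (cexp _ * _).
  by field; rewrite pnatr_eq0 -lt0n (de_m_gt0 HD).
rewrite mul1r /sol1 /prefactor /= p1 p2 p3 p4 [RHS]mulrA -cexpD; congr (cexp _ * _).
by field; rewrite pnatr_eq0 -lt0n (de_m_gt0 HD).
Qed.

Lemma germs_agree (x : C) (d d' : germs R) : is_germs v x d -> is_germs v x d' ->
  gs d' x = gs d x -> gL0 d' x = gL0 d x -> gL1 d' x = gL1 d x -> gU d' x = gU d x ->
  forall i, \forall y \near (x : C^o), sol d' i y = sol d i y.
Proof.
move=> hd hd' es el0 el1 eU i; have [_ /(_ i)] := germs_same hd hd' es.
apply: filterS => y ->; rewrite el0 el1 eU !subrr !mulr0 addr0 subr0 cexp0 mul1r sum2_dmat.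
by case: eqP => [->|i0] /=; rewrite mul1r // /sol; case: (i =P 0).
Qed.

(** The square roots of two choices of branches are equal or opposite; in the
    second case the two solutions are exchanged. *)
Lemma germs_change (x : C) (d d' : germs R) : is_germs v x d -> is_germs v x d' ->
  exists e z c, [/\ c != 0, z ^+ m = 1 &
    forall i, \forall y \near (x : C^o), sol d' i y = c * \sum_j dmat z e i j * sol d j y].
Proof.
have a_m : m%:R * a = n%:R by rewrite mulrC divfK // pnatr_eq0 -lt0n (de_m_gt0 HD).
have root1 (c : C) : cexp c = 1 -> cexp (a * c) ^+ m = 1.
  by move=> c1; rewrite -cexpMn mulrA a_m cexpMn c1 expr1n.
move=> hd hd'; have [_ _ _ _ sw] := germs_data hd; have [_ _ _ _ sw'] := germs_data hd'.
have /eqP := etrans sw' (esym sw); rewrite eqf_sqr => /orP[/eqP sE|/eqP sE].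
  have [c1 h] := germs_same hd hd' sE.
  exists false; do 2 eexists; split; last exact: h; first exact: cexp_neq0.
  exact: root1.
have [c1 h] := germs_same (is_germs_opp hd) hd' sE.
exists true; do 2 eexists; split; last first.
- move=> i; apply: filterS (h i) => y ->; rewrite sum2_dmat; congr (_ * _).
  by rewrite sum2_dmat sol_opp; case: (i == 0).
- exact: root1.
- exact: cexp_neq0.
Qed.

End DihedralSolutions.

(** * Monodromy is dihedral *)

Section MonodromyBound.
Variable R : realType.
Local Notation C := R[i].
Local Open Scope classical_set_scope.
Local Open Scope ring_scope.
Local Open Scope complex_scope.
Variables (v : place) (k l m n : nat) (G : {poly C}) (H : hypergeometric_eq R).
Hypothesis HD : dihedral_eq v k l m n G H.
Local Notation sol := (sol v k m n G H).

(** Up to scalars, these matrices form the dihedral group. *)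
Definition dihedral_mx (A : 'I_2 -> 'I_2 -> C) : Prop :=
  exists e z c, [/\ c != 0, z ^+ m = 1 & forall i j, A i j = c * dmat z e i j].

(** The property that is propagated along a path of continuation. *)
Definition adapted (x : C) (f : 'I_2 -> C -> C) : Prop :=
  exists d A, [/\ is_germs v x d, dihedral_mx A &
    forall i, \forall y \near (x : C^o), f i y = \sum_j A i j * sol d j y].

Lemma dihedral_mx_mul A B : dihedral_mx A -> dihedral_mx B ->
  dihedral_mx (fun i j => \sum_h A i h * B h j).
Proof.
move=> [e [z [c [c0 zm hA]]]] [f [w [b [b0 wm hB]]]].
have w0 : w != 0 by apply: contra_eq_neq wm => ->; rewrite expr0n eqn0Ngt (de_m_gt0 HD) eq_sym oner_neq0.
exists (e (+) f), (z * (if e then w^-1 else w)), (c * b * (if e then w else 1)); split.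
- by rewrite !mulf_neq0 //; case: (e) => //; exact: oner_neq0.
- by rewrite exprMn zm; case: (e); rewrite ?exprVn wm ?invr1 mulr1.
move=> i j; under eq_bigr => h _ do rewrite hA hB mulrACA.
rewrite -mulr_sumr sum2_dmat !mxE.
by have [->|->] := ord2 i; have [->|->] := ord2 j; case: (e); case: (f); rewrite /= ?(mul0r, mulr0, mul1r, mulr1) //; field.
Qed.

Lemma span_unique (x : C) d (A B : 'I_2 -> 'I_2 -> C) (f : 'I_2 -> C -> C) : is_germs v x d ->
  (forall i, \forall y \near (x : C^o), f i y = \sum_j A i j * sol d j y) ->
  (forall i, \forall y \near (x : C^o), f i y = \sum_j B i j * sol d j y) ->
  forall i j, A i j = B i j.
Proof.
move=> hd hA hB i j; apply/eqP; rewrite -subr_eq0; apply/eqP.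
apply: (fundamental_free (c := fun j => A i j - B i j) (sol_fundamental HD hd)).
apply: filterS2 (hA i) (hB i) => y e1 e2.
under eq_bigr => h _ do rewrite mulrBl.
by rewrite sumrB -e1 -e2 subrr.
Qed.

(** By uniqueness of coordinates and [germs_change], the choice of branches is
    irrelevant. *)
Lemma adapted_any (x : C) f d A : adapted x f -> is_germs v x d ->
  (forall i, \forall y \near (x : C^o), f i y = \sum_j A i j * sol d j y) -> dihedral_mx A.
Proof.
move=> [d' [B [hd' hB fB]]] hd fA.
have [e [z [c [c0 zm h]]]] := germs_change HD hd hd'.
pose D i j := c * dmat z e i j.
have hD : dihedral_mx D by exists e, z, c.
have [e2 [z2 [c2 [c20 zm2 h2]]]] := dihedral_mx_mul hB hD.
exists e2, z2, c2; split => // i j; rewrite -h2.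
apply: (span_unique (B := fun i j => \sum_h B i h * D h j) hd fA) => {}i.
move: (fB i) (h 0) (h 1); apply: filterS3 => y -> h0 h1.
rewrite !sum2 h0 h1 !sum2 /D; move: (sol d 0 y) (sol d 1 y) => u0 u1; ring.
Qed.

Lemma within_pathP (gamma : R -> C^o) (t : R) : {within `[0, 1], continuous gamma} -> t \in `[0, 1] ->
  forall e : R, 0 < e -> exists2 r, 0 < r &
    forall s, s \in `[0, 1] -> `|s - t| < r -> modulus (gamma s - gamma t) < e.
Proof.
move=> /subspace_continuousP cg tin e e0.
have /= := cg t tin _ (near_radius (gamma t) e0).
rewrite /within /= => /nbhs_ballP[r /= r0 hr]; exists r => // s sin st.
by apply: (hr s) => //; rewrite /ball /= distrC.
Qed.

(** Near [gamma t] a single choice of branches and a single coefficient matrix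
    describe the continuation, so that the property passes from one nearby
    parameter to another. *)
Lemma adapted_continuation (gamma : R -> C^o) (F : 'I_2 -> R -> C -> C) :
  {within `[0, 1], continuous gamma} ->
  (forall t, t \in `[0, 1] -> gamma t != 0 /\ gamma t != 1) ->
  (forall i, continuation_along H gamma (F i)) ->
  adapted (gamma 0) (fun i => F i 0) -> forall t, t \in `[0, 1] -> adapted (gamma t) (fun i => F i t).
Proof.
move=> cg gr hF h0; apply: (unit_interval_induction (P := fun t => adapted (gamma t) (fun i => F i t)) h0) => t tin.
have [t0 t1] := gr t tin; have [d hd] := germs_exist v t0 t1.
have hfun := sol_fundamental HD hd.
have sp i := fundamental_span t0 t1 hfun (hF i t tin).1.
have [c0 hc0] := sp 0; have [c1 hc1] := sp 1.
pose A i := if i == 0 :> 'I_2 then c0 else c1.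
have hA : \forall y \near (gamma t : C^o), is_germs v y d /\ forall i,
    \forall z \near (y : C^o), F i t z = \sum_j A i j * sol d j z.
  move: (germ_near hc0) (germ_near hc1) (is_germs_near hd); apply: filterS3 => y k0 k1 k2.
  split; first exact: k2.
  by move=> i; have [->|->] := ord2 i; [exact: k0|exact: k1].
have [q q0 hq] := (near_modulusP _ _).1 hA.
have [r1 r10 hr1] := within_pathP cg tin q0.
have hc i : exists2 r, 0 < r & forall s, s \in `[0, 1] -> `|s - t| < r ->
    \forall z \near (gamma s : C^o), F i s z = F i t z.
  have /nbhs_ballP[r /= r0 hr] := (hF i t tin).2.
  exists r; first exact: r0.
  move=> s sin st; have b : ball t r s by rewrite /ball /= distrC.
  exact: (hr s b sin).
have [r2 r20 hr2] := hc 0; have [r3 r30 hr3] := hc 1.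
have near_t s : s \in `[0, 1] -> `|s - t| < Num.min r1 (Num.min r2 r3) ->
    is_germs v (gamma s) d /\ forall i, \forall z \near (gamma s : C^o), F i s z = \sum_j A i j * sol d j z.
  move=> sin; rewrite !lt_min => /andP[s1 /andP[s2 s3]].
  have [k0 k1] := hq _ (hr1 s sin s1); split; first exact: k0.
  move=> i.
  have k2 : \forall z \near (gamma s : C^o), F i s z = F i t z.
    by have [->|->] := ord2 i; [exact: hr2|exact: hr3].
  by apply: filterS2 k2 (k1 i) => z ->.
exists (Num.min r1 (Num.min r2 r3)); first by rewrite !lt_min r10 r20.
move=> s u sin uin su st ut hs.
have [ds hs1] := near_t s sin st; have [du hu1] := near_t u uin ut.
by exists d, A; split; [exact: du|exact: adapted_any hs ds hs1|exact: hu1].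
Qed.

Lemma monodromy_dihedral (z0 : C) d (M : 'M[C]_2) : is_germs v z0 d ->
  monodromy_matrix H z0 (sol d) M -> dihedral_mx (fun i j => M i j).
Proof.
move=> hd [gamma [F [[cg gr g0 g1] hF]]].
have hF0 i : continuation_along H gamma (F i) by have [] := hF i.
have in0 : (0 : R) \in `[0, 1] by rewrite in_itv /= lexx ler01.
have in1 : (1 : R) \in `[0, 1] by rewrite in_itv /= lexx ler01.
have start : adapted (gamma 0) (fun i => F i 0).
  rewrite g0; exists d, (fun i j => 1 * dmat 1 false i j); split; first exact: hd.
    by exists false, 1, 1; split; [exact: oner_neq0|rewrite expr1n|].
  move=> i; have [_ h _] := hF i; apply: filterS h => y ->.
  under eq_bigr => j _ do rewrite mul1r.
  by rewrite sum2_dmat; have [->|->] := ord2 i; rewrite /= mul1r.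
have := adapted_continuation cg gr hF0 start in1; rewrite g1 => end1.
by apply: adapted_any end1 hd _ => i; have [] := hF i.
Qed.

End MonodromyBound.

(** * Loops with prescribed monodromy *)

Section Loops.
Variable R : realType.
Local Notation C := R[i].
Local Open Scope classical_set_scope.
Local Open Scope ring_scope.
Local Open Scope complex_scope.

Definition period : C := (0 : R) +i* (pi *+ 2).

Lemma cexp_period : cexp period = 1.
Proof. by rewrite cexpE expR0 cos2pi sin2pi mulr1 mulr0. Qed.

Lemma cexp_nat_period j : cexp (j%:R * period) = 1.
Proof. by rewrite cexpMn cexp_period expr1n. Qed.

Lemma Re_neq0_cexp (u : C) : complex.Re u != 0 -> cexp u ^+ 2 != 1.
Proof.
apply: contra_neq => h; have := congr1 (@modulus R) h.
rewrite expr2 modulusM modulus_cexp modulusR normr1 -expr2 => /eqP.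
rewrite pexpr_eq1 ?expR_ge0 // => /eqP; rewrite -expR0; exact: expR_inj.
Qed.

(** Linear interpolation plus a bump that vanishes at both ends. *)
Definition quad (A B D : R) (t : R) : R := A + B * clamp t + D * (clamp t * (1 - clamp t)).

Lemma continuous_quad A B D : continuous (quad A B D : R -> R^o).
Proof.
move=> t; have cc : (@clamp R : R -> R^o) @ t --> (clamp t : R^o) by exact: continuous_clamp.
have c1 : (fun t => 1 - clamp t : R^o) @ t --> (1 - clamp t : R^o).
  exact: (@cvgB R R^o R (nbhs t) _ _ _ _ _ (cvg_cst _) cc).
have c2 : (fun t => clamp t * (1 - clamp t) : R^o) @ t --> (clamp t * (1 - clamp t) : R^o).
  exact: (@cvgM R R (nbhs t) _ _ _ _ _ cc c1).
have c3 : (fun t => D * (clamp t * (1 - clamp t)) : R^o) @ t --> (D * (clamp t * (1 - clamp t)) : R^o).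
  exact: (@cvgM R R (nbhs t) _ _ _ _ _ (cvg_cst D) c2).
have c4 : (fun t => B * clamp t : R^o) @ t --> (B * clamp t : R^o).
  exact: (@cvgM R R (nbhs t) _ _ _ _ _ (cvg_cst B) cc).
have c5 : (fun t => A + B * clamp t : R^o) @ t --> (A + B * clamp t : R^o).
  exact: (@cvgD R R^o R (nbhs t) _ _ _ _ _ (cvg_cst A) c4).
exact: (@cvgD R R^o R (nbhs t) _ _ _ _ _ c5 c3).
Qed.

(** In the coordinate [u = log ((1 + s) / (1 - s))] the singular points are
    the multiples of [pi i]; any two of the points [+- u0 + 2 pi i j] are
    joined by an arc of parabola that avoids them. *)
Lemma period_path (u0 : C) (e : bool) (j : nat) : cexp u0 ^+ 2 != 1 ->
  exists u : R -> C^o, [/\ continuous u, u 0 = u0,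
    u 1 = (if e then - u0 else u0) + j%:R * period & forall t, cexp (u t : C) ^+ 2 != 1].
Proof.
case: u0 => a0 b0 good0.
pose u1 : C := (if e then - (a0 +i* b0) else (a0 +i* b0)) + j%:R * period.
have good1 : cexp u1 ^+ 2 != 1.
  rewrite /u1 cexpD cexp_nat_period mulr1; case: (e); rewrite // cexpN exprVn.
  by rewrite invr_eq1.
pose a1 := complex.Re u1; pose b1 := complex.Im u1.
have natE i : i%:R = (i%:R : R) +i* 0 :> C by rewrite -[RHS]/(i%:R%:C) rmorph_nat.
have a1E : a1 = if e then - a0 else a0.
  by rewrite /a1 /u1 (natE j); case: (e) => /=; rewrite !(mul0r, mulr0, subr0, addr0).
have b1E : b1 = (if e then - b0 else b0) + j%:R * (pi *+ 2).
  by rewrite /b1 /u1 (natE j); case: (e) => /=; rewrite !(mul0r, mulr0, subr0, addr0).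
(* The bump of the real part keeps it away from 0 if it begins and ends on one
   side.  Otherwise the path crosses the imaginary axis halfway, and the bump of
   the imaginary part lets it cross at an odd multiple of [pi / 2]. *)
pose D1 : R := if e then (if a0 == 0 then 1 else 0) else (if 0 <= a0 then 1 else -1).
pose D2 : R := if e && (a0 != 0) then pi *+ 2 else 0.
exists (fun t => quad a0 (a1 - a0) D1 t +i* quad b0 (b1 - b0) D2 t).
have clamp0 : clamp 0 = 0 :> R by rewrite clamp_id // in_itv /= lexx ler01.
have clamp1 : clamp 1 = 1 :> R by rewrite clamp_id // in_itv /= lexx ler01.
split.
- move=> t; exact: (@cvg_complex R R (nbhs t) _ _ _ _ _ (@continuous_quad a0 (a1 - a0) D1 t) (@continuous_quad b0 (b1 - b0) D2 t)).
- by rewrite /quad clamp0 !(mul0r, mulr0, addr0).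
- rewrite /quad clamp1 !mulr1 subrr !mulr0 !addr0 !(addrC _ (_ - _)) !subrK.
  by rewrite -/u1 /a1 /b1; case: (u1).
move=> t; have := clamp_in t; rewrite /quad in_itv /=; move: (clamp t) => c /andP[c0 c1].
have [-> | cn0] := eqVneq c 0; first by rewrite !(mul0r, mulr0, addr0).
have [-> | cn1] := eqVneq c 1.
  rewrite !mulr1 subrr !mulr0 !addr0 !(addrC _ (_ - _)) !subrK /a1 /b1.
  by case: (u1) good1.
have c0' : 0 < c by rewrite lt_def cn0.
have c1' : c < 1 by rewrite lt_def eq_sym cn1.
have cc : 0 < c * (1 - c) by rewrite mulr_gt0 // subr_gt0.
have [hre|hre] := eqVneq (a0 + (a1 - a0) * c + D1 * (c * (1 - c))) 0; last exact: Re_neq0_cexp.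
have eT : e && (a0 != 0).
  move: hre; rewrite a1E /D1; case: (e) => /=.
    case: eqP => [->|//]; rewrite !(oppr0, addr0, mul0r, add0r, mul1r) => h.
    by move: cc; rewrite h ltxx.
  rewrite subrr mul0r addr0; case: leP => h hre.
    by move: cc h hre; rewrite mul1r; lra.
  by move: cc h hre; rewrite mulN1r; lra.
have ch : c = 1 / 2.
  move: hre; rewrite a1E /D1; case/andP: eT => -> a00; rewrite (negPf a00) mul0r addr0 => h.
  apply: (mulfI a00); have h2 : a0 * c + a0 * c = a0 by rewrite -[RHS]subr0 -[X in _ - X]h; ring.
  by rewrite -{2}h2; field.
rewrite -cexpMn hre.
have -> : 2 * (0 +i* (b0 + (b1 - b0) * c + D2 * (c * (1 - c)))) = j%:R * period + ((0 : R) +i* pi).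
  rewrite (natE j) (natE 2) /period; simpc.
  rewrite ch b1E /D2 eT; case/andP: eT => -> _.
  by congr (_ +i* _); move: (@pi R) => p; rewrite ?mulr2n; field.
rewrite cexpD cexp_nat_period mul1r cexpE expR0 cospi sinpi mul1r mulr0.
rewrite eq_complex /= negb_and; apply/orP; left.
by rewrite -subr_eq0 -opprD oppr_eq0 -mulr2n pnatr_eq0.
Qed.

(** The inverse of [u = log ((1 + s) / (1 - s))]. *)
Definition tanh_half (u : C) : C := (cexp u - 1) / (cexp u + 1).

Lemma tanh_halfP (u : C) : cexp u ^+ 2 != 1 ->
  [/\ cexp u + 1 != 0, tanh_half u != 0, tanh_half u ^+ 2 != 1 &
     cexp u * (1 - tanh_half u) = 1 + tanh_half u].
Proof.
move=> g; have E0 := cexp_neq0 u.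
have m1 : cexp u - 1 != 0 by rewrite subr_eq0; apply: contraNneq g => ->; rewrite expr1n.
have p1 : cexp u + 1 != 0.
  by apply: contraNneq g => /eqP; rewrite addr_eq0 => /eqP ->; rewrite sqrrN expr1n.
split=> //; first by rewrite mulf_neq0 // invr_neq0.
- rewrite -subr_eq0.
  have -> : tanh_half u ^+ 2 - 1 = - (4 * cexp u / (cexp u + 1) ^+ 2) by rewrite /tanh_half; field.
  have four : 4 != 0 :> C by rewrite pnatr_eq0.
  by rewrite oppr_eq0 (mulf_neq0 (mulf_neq0 four E0) (invr_neq0 (expf_neq0 2 p1))).
- by rewrite /tanh_half; field.
Qed.

Lemma tanh_half_unique (u s : C) : cexp u * (1 - s) = 1 + s -> s != 0 ->
  cexp u ^+ 2 != 1 /\ s = tanh_half u.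
Proof.
move=> e s0.
have two0 : 2 != 0 :> C by rewrite pnatr_eq0.
have p1 : cexp u + 1 != 0.
  apply/eqP => h; have : cexp u = -1 by apply/eqP; rewrite -addr_eq0 h.
  move=> h2; move: e; rewrite h2 mulN1r opprB => /eqP; rewrite -subr_eq0.
  have -> : s - 1 - (1 + s) = - 2 by ring.
  by rewrite oppr_eq0 (negPf two0).
have sE : s = tanh_half u.
  apply: (mulIf p1); rewrite /tanh_half divfK //.
  have -> : s * (cexp u + 1) = cexp u - 1 - (cexp u * (1 - s) - (1 + s)) by ring.
  by rewrite e subrr subr0.
split=> //; have -> : (cexp u ^+ 2 != 1) = (cexp u ^+ 2 - 1 != 0) by rewrite subr_eq0.
have -> : cexp u ^+ 2 - 1 = s * (cexp u + 1) ^+ 2 by rewrite sE /tanh_half; field.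
by rewrite mulf_neq0 // expf_neq0.
Qed.

Lemma hol_tanh_half (u : C) : cexp u ^+ 2 != 1 -> hol tanh_half u.
Proof.
move=> /tanh_halfP[p1 _ _ _]; have h := hol_cexp (hol_id u).
apply: hol_div => //; first by apply: holB => //; exact: hol_cst.
by apply: holD => //; exact: hol_cst.
Qed.

(** Two branches that are close and have the same exponential coincide by
    [cexp_inj_small]; this provides the closeness. *)
Lemma path_close (f : C -> C) (gamma p : R -> C^o) (t : R) :
  {for (gamma t : C^o), continuous (f : C^o -> C^o)} -> {for t, continuous gamma} ->
  {for t, continuous p} -> f (gamma t) = p t ->
  forall e : R, 0 < e -> \forall s \near t, modulus (f (gamma s) - p s) < e.
Proof.
move=> cf cg cp fp e e0; have e2 : 0 < e / 2 by rewrite divr_gt0.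
have cfg : {for t, continuous (fun s => f (gamma s) : C^o)}.
  exact: (@continuous_comp _ _ _ gamma (f : C^o -> C^o) t cg cf).
have [r r0 hr] := near_pathP cfg e2; have [q q0 hq] := near_pathP cp e2.
apply/nbhs_ballP; exists (Num.min r q) => /=; first by rewrite lt_min r0.
move=> s; rewrite /ball /= lt_min distrC => /andP[h1 h2].
have -> : f (gamma s) - p s = (f (gamma s) - f (gamma t)) - (p s - p t) by rewrite fp; ring.
apply: le_lt_trans (modulusD _ _) _; rewrite modulusN [e]splitr.
by apply: ltrD; [exact: hr|exact: hq].
Qed.

Variables (v : place) (k l m n : nat) (G : {poly C}) (H : hypergeometric_eq R).
Hypothesis HD : dihedral_eq v k l m n G H.
Local Notation sol := (sol v k m n G H).
Local Notation a := (n%:R / m%:R : C).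

(** The image in the [x]-line of the path from [u0] to [+- u0 + 2 pi i j] is a
    loop. Logarithms and square root are continued along it by path lifting,
    and the branches reached at the end differ from the initial ones by the
    prescribed change of [u]. *)
Lemma realize_loop (z0 : C) (d : germs R) (e : bool) (j : nat) : is_germs v z0 d ->
  exists2 c, c != 0 & monodromy_matrix H z0 (sol d) (c *: dmat (cexp (a * (j%:R * period))) e).
Proof.
move=> hd; have ez0 := nbhs_singleton hd.2.
have [z00 z01 s00 _ _] := germ_eqs_regular ez0.
have [el0 el1 es eU] := ez0.
have [good0 s0E] := tanh_half_unique eU s00.
have [u [cu u0 u1 gu]] := period_path e j good0.
pose sg (t : R) : C^o := tanh_half (u t).
pose gamma (t : R) : C^o := wmap v (sg t ^+ 2).
have sgP t := tanh_halfP (gu t).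
have csg : continuous sg.
  by move=> t; exact: (@continuous_comp _ _ _ u (tanh_half : C^o -> C^o) t (cu t) (hol_continuous (hol_tanh_half (gu t)))).
have cgamma : continuous gamma.
  move=> t; have [_ _ s2 _] := sgP t.
  have h : hol (fun z => wmap v (tanh_half z ^+ 2)) (u t).
    apply: (hol_comp (f := fun z => tanh_half z ^+ 2) (g := wmap v)); last exact: hol_wmap.
    exact: (holX 2 (hol_tanh_half (gu t))).
  exact: (@continuous_comp _ _ _ u ((fun z => wmap v (tanh_half z ^+ 2)) : C^o -> C^o) t (cu t) (hol_continuous h)).
have gw t : wmap v (gamma t : C) = sg t ^+ 2 by rewrite /gamma wmapK //; have [] := sgP t.
have greg t : gamma t != 0 /\ gamma t != 1.
  by apply: wmap_regular; [rewrite expf_neq0 //|]; have [] := sgP t.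
have gamma0 : gamma 0 = z0 by rewrite /gamma /sg u0 -s0E es wmapK.
have gamma1 : gamma 1 = z0.
  rewrite /gamma /sg u1; suff -> : tanh_half ((if e then - gU d z0 else gU d z0) + j%:R * period) ^+ 2 = gs d z0 ^+ 2.
    by rewrite es wmapK.
  rewrite s0E /tanh_half cexpD cexp_nat_period mulr1; case: (e) => //.
  have [p1 _ _ _] := tanh_halfP good0; rewrite cexpN; have E0 := cexp_neq0 (gU d z0).
  by field; rewrite p1 E0.
have lift (f : R -> C^o) (l0 : C) : continuous f -> (forall t, f t != 0) -> (forall t, f (clamp t) = f t) ->
    cexp l0 = f 0 -> exists2 p : R -> C^o, continuous p & p 0 = l0 /\ forall t, cexp (p t) = f t.
  move=> cf f0 fc lE; have [p cp [p0 pE]] := path_lift cf f0 lE.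
  exists (fun t => p (clamp t)).
    by move=> t; exact: (@continuous_comp _ _ _ (@clamp R) p t (@continuous_clamp R t) (cp _)).
  split; last by move=> t; rewrite pE ?clamp_in.
  by rewrite clamp_id // in_itv /= lexx ler01.
have clampK t : clamp (clamp t) = clamp t :> R by rewrite clamp_id // clamp_in.
pose u' t := u (clamp t).
have [q0 cq0 [q00 q0E]] : exists2 p : R -> C^o, continuous p & p 0 = gL0 d z0 /\ forall t, cexp (p t) = gamma (clamp t).
  apply: (lift (fun t => gamma (clamp t))).
  - by move=> t; exact: (@continuous_comp _ _ _ (@clamp R) gamma t (@continuous_clamp R t) (cgamma _)).
  - by move=> t; have [] := greg (clamp t).
  - by move=> t; rewrite clampK.
  - by rewrite el0 clamp_id ?gamma0 // in_itv /= lexx ler01.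
have [q1 cq1 [q10 q1E]] : exists2 p : R -> C^o, continuous p & p 0 = gL1 d z0 /\ forall t, cexp (p t) = 1 - gamma (clamp t).
  apply: (lift (fun t => 1 - gamma (clamp t))).
  - move=> t; have h := @continuous_comp _ _ _ (@clamp R) gamma t (@continuous_clamp R t) (cgamma _).
    exact: (@cvgB C C^o R (nbhs t) _ _ _ _ _ (cvg_cst _) h).
  - by move=> t; rewrite subr_eq0 eq_sym; have [] := greg (clamp t).
  - by move=> t; rewrite clampK.
  - by rewrite el1 clamp_id ?gamma0 // in_itv /= lexx ler01.
have [lsg0 lsg0E] : exists z, cexp z = sg 0 by apply: cexp_onto; have [] := sgP 0.
have [qs cqs [qs0 qsE]] : exists2 p : R -> C^o, continuous p & p 0 = lsg0 /\ forall t, cexp (p t) = sg (clamp t).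
  apply: (lift (fun t => sg (clamp t))).
  - by move=> t; exact: (@continuous_comp _ _ _ (@clamp R) sg t (@continuous_clamp R t) (csg _)).
  - by move=> t; have [] := sgP (clamp t).
  - by move=> t; rewrite clampK.
  - by rewrite lsg0E clamp_id // in_itv /= lexx ler01.
pose gm t : C^o := gamma (clamp t).
have cgm : continuous gm.
  by move=> t; exact: (@continuous_comp _ _ _ (@clamp R) gamma t (@continuous_clamp R t) (cgamma _)).
have cu' : continuous (u' : R -> C^o).
  by move=> t; exact: (@continuous_comp _ _ _ (@clamp R) u t (@continuous_clamp R t) (cu _)).
have csg' : continuous (fun t => sg (clamp t)).
  by move=> t; exact: (@continuous_comp _ _ _ (@clamp R) sg t (@continuous_clamp R t) (csg _)).
have [D DP] : exists D : R -> germs R, forall t, is_germs v (gm t) (D t) /\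
    [/\ gL0 (D t) (gm t) = q0 t, gL1 (D t) (gm t) = q1 t,
      gs (D t) (gm t) = sg (clamp t) & gU (D t) (gm t) = u' t].
  exists (fun t => germs_at v (gm t) (q0 t) (q1 t) (qs t) (u' t)) => t.
  rewrite -qsE; apply: germs_atP; rewrite ?q0E ?q1E ?qsE ?gw //.
  by have [] := sgP (clamp t).
have agree t i : \forall s \near t, \forall y \near (gm s : C^o), sol (D s) i y = sol (D t) i y.
  have [hDt [v0 v1 vs vU]] := DP t; have [[h0 h1 hs hU] _] := hDt.
  have n0 := path_close (hol_continuous h0) (cgm t) (cq0 t) v0 ltr01.
  have n1 := path_close (hol_continuous h1) (cgm t) (cq1 t) v1 ltr01.
  have nU := path_close (hol_continuous hU) (cgm t) (cu' t) vU ltr01.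
  have ms : 0 < modulus (sg (clamp t)) by rewrite modulus_gt0; have [] := sgP (clamp t).
  have ns := path_close (hol_continuous hs) (cgm t) (csg' t) vs ms.
  have ms2 : 0 < modulus (sg (clamp t)) / 2 by rewrite divr_gt0.
  have nsg : \forall s \near t, modulus (sg (clamp s) - sg (clamp t)) < modulus (sg (clamp t)) / 2.
    have [r r0 hr] := near_pathP (csg' t) ms2.
    by apply/nbhs_ballP; exists r => // s; rewrite /ball /= distrC => /hr.
  have ng : \forall s \near t, is_germs v (gm s) (D t) by exact: (cgm t _ (is_germs_near hDt)).
  have n01 : \forall s \near t, modulus (gL0 (D t) (gm s) - q0 s) < 1 /\ modulus (gL1 (D t) (gm s) - q1 s) < 1.
    by apply: filterS2 n0 n1.
  have nUs : \forall s \near t, modulus (gU (D t) (gm s) - u' s) < 1 /\ modulus (gs (D t) (gm s) - sg (clamp s)) < modulus (sg (clamp t)).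
    by apply: filterS2 nU ns.
  have ngs : \forall s \near t, is_germs v (gm s) (D t) /\ modulus (sg (clamp s) - sg (clamp t)) < modulus (sg (clamp t)) / 2.
    by apply: filterS2 ng nsg.
  move: n01 nUs ngs; apply: filterS3 => s [d0 d1] [dU ds] [gD dsg].
  have [hDs [w0 w1 ws wU]] := DP s.
  have ex := nbhs_singleton gD.2; have [x0 x1 sn _ sm] := germ_eqs_regular ex; have [f0 f1 fs fU] := ex.
  have sE : gs (D t) (gm s) = sg (clamp s).
    have /eqP := etrans fs (gw (clamp s)); rewrite eqf_sqr => /orP[/eqP //|/eqP sN].
    exfalso; move: ds; rewrite sN -opprD modulusN -mulr2n -mulr_natl modulusM.
    have -> : modulus (2 : C) = 2 by rewrite -[2 : C]/(2%:R) -(rmorph_nat (real_complex R)) modulusR normr_nat.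
    have : modulus (sg (clamp t)) <= modulus (sg (clamp s)) + modulus (sg (clamp s) - sg (clamp t)).
      by rewrite (modulusB (sg (clamp s))); apply: le_trans (modulusD _ _); rewrite addrC subrK.
    by move: dsg; lra.
  apply: (germs_agree HD gD hDs).
  - by rewrite ws sE.
  - by rewrite w0; apply/esym; apply: cexp_inj_small => //; rewrite f0 q0E.
  - by rewrite w1; apply/esym; apply: cexp_inj_small => //; rewrite f1 q1E.
  - rewrite wU; apply/esym; apply: cexp_inj_small => //.
    apply: (mulIf sm); rewrite fU sE /u'; by have [_ _ _ ->] := sgP (clamp s).
have gm0 : gm 0 = z0 by rewrite /gm clamp_id ?gamma0 // in_itv /= lexx ler01.
have gm1 : gm 1 = z0 by rewrite /gm clamp_id ?gamma1 // in_itv /= lexx ler01.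
have u'0 : u' 0 = gU d z0 by rewrite /u' clamp_id // in_itv /= lexx ler01.
have u'1 : u' 1 = (if e then - gU d z0 else gU d z0) + j%:R * period by rewrite /u' clamp_id // in_itv /= lexx ler01.
have hD0 := DP 0; have hD1 := DP 1; rewrite gm0 in hD0; rewrite gm1 in hD1.
have [g0 [a0 a1 as0 aU]] := hD0; have [g1 [b0 b1 bs bU]] := hD1.
have start i : \forall z \near (z0 : C^o), sol (D 0) i z = sol d i z.
  apply: (germs_agree HD hd g0); rewrite ?a0 ?a1 ?as0 ?aU //.
  by rewrite clamp_id ?in_itv /= ?lexx ?ler01 // s0E /sg u0.
have [c c0 finish] : exists2 c, c != 0 & forall i, \forall z \near (z0 : C^o),
    sol (D 1) i z = c * \sum_h dmat (cexp (a * (j%:R * period))) e i h * sol d h z.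
  have s1E : gs (D 1) z0 = if e then - gs d z0 else gs d z0.
    rewrite bs clamp_id ?in_itv /= ?lexx ?ler01 // /sg u1 s0E /tanh_half cexpD cexp_nat_period mulr1.
    case: (e) => //; have [p1 _ _ _] := tanh_halfP good0; rewrite cexpN; have E0 := cexp_neq0 (gU d z0).
    by field; rewrite p1 E0.
  move: s1E bU u'1; case: (e) => /= s1E bU u'1.
    have [_ h] := germs_same HD (is_germs_opp hd) g1 s1E.
    eexists; last first.
      move=> i; apply: filterS (h i) => z ->; rewrite sum2_dmat; congr (_ * _).
      rewrite sum2_dmat sol_opp bU u'1 /= [X in X - _]addrC addrK.
      by case: (i == 0).
    exact: cexp_neq0.
  have [_ h] := germs_same HD hd g1 s1E.
  eexists; last first.
    move=> i; apply: filterS (h i) => z ->; congr (_ * _).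
    by rewrite bU u'1 [X in X - _]addrC addrK.
  exact: cexp_neq0.
exists c => //; exists gm, (fun i t => sol (D t) i); split.
  split; [exact: (continuous_subspaceT cgm)|by move=> t _; exact: (greg (clamp t))|exact: gm0|exact: gm1].
move=> i; split.
- move=> t _; split; first exact: ((sol_fundamental HD (DP t).1).1 i).
  by apply: filterS (agree t i) => s h _.
- exact: start.
- apply: filterS (finish i) => z ->; rewrite mulr_sumr; apply: eq_bigr => h _.
  by rewrite mulrA; congr (_ * _); rewrite [RHS]mxE.
Qed.

End Loops.

(** * The monodromy group *)

Section DihedralGroup.
Local Open Scope group_scope.

(** The elements [x^i y^e] exhaust a group of order [2 m] and are therefore
    distinct. *)
Lemma dihedral_presentation (m : nat) : (1 < m)%N -> exists x y : dihedral_gtype m.*2,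
  [/\ x ^+ m = 1, y ^+ 2 = 1, x ^ y = x^-1,
      forall g, exists (i : 'I_m) (e : bool), g = x ^+ i * y ^+ e &
      forall (i j : 'I_m) (e f : bool), x ^+ i * y ^+ e = x ^+ j * y ^+ f -> i = j /\ e = f].
Proof.
move=> m1; have m0 := ltnW m1.
have [_ /existsP[[x y] /= /eqP[defD xm y2 xy]]] := isoGrpP _ (Grp_dihedral m1) (isog_refl _).
have nyx : <[y]> \subset 'N(<[x]>).
  by rewrite cycle_subG; apply/normP/eqP; rewrite -cycleJ xy cycleV.
exists x, y; split => //.
  move=> g; have : g \in <[x]> * <[y]> by rewrite -norm_joinEr // defD inE.
  case/mulsgP => _ _ /cycleP[i ->] /cycleP[j ->] ->.
  exists (Ordinal (ltn_pmod i m0)), (odd j); rewrite /= expg_mod // -modn2 expg_mod //.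
pose f (p : 'I_m * bool) := x ^+ p.1 * y ^+ p.2.
have finj : {in [set: 'I_m * bool] &, injective f}.
  apply/imset_injP; rewrite cardsT card_prod card_ord card_bool muln2 -[X in _ == X](card_dihedral m1).
  apply/eqP/eq_card => g; rewrite !inE; apply/imsetP.
  have : g \in <[x]> * <[y]> by rewrite -norm_joinEr // defD inE.
  case/mulsgP => _ _ /cycleP[i ->] /cycleP[j ->] ->.
  exists (Ordinal (ltn_pmod i m0), odd j); rewrite ?inE // /f /= expg_mod // -modn2 expg_mod //.
by move=> i j e h /(finj (i, e) (j, h) (finset.in_setT _) (finset.in_setT _)) [-> ->].
Qed.

(** The inverse of [x^j] is written with the natural exponent [j (m - 1)]. *)
Lemma dihedral_mul (gT : finGroupType) (x y : gT) (m i j : nat) (e f : bool) : (0 < m)%N ->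
  x ^+ m = 1 -> y ^+ 2 = 1 -> x ^ y = x^-1 ->
  x ^+ (i + (if e then j * m.-1 else j))%N * y ^+ (e (+) f) = (x ^+ i * y ^+ e) * (x ^+ j * y ^+ f).
Proof.
move=> m0 xm y2 xy; rewrite expgD; case: e => /=; last by rewrite expg0 mulg1 mulgA.
have xj : x ^+ (j * m.-1) = x ^- j.
  apply: (mulIg (x ^+ j)); rewrite -expgD mulVg -{2}[j]muln1 -mulnDr addn1 prednK // mulnC expgM xm expg1n //.
have yV : y^-1 = y by apply: (mulgI y); rewrite mulgV -expg2.
have yxj : y * x ^+ j = x ^- j * y.
  have : (x ^+ j) ^ y = x ^- j by rewrite conjXg xy expgVn.
  by rewrite conjgE yV => <-; rewrite -!mulgA -expg2 y2 mulg1.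
rewrite xj expg1 -!mulgA; congr (_ * _); rewrite [y * _]mulgA yxj -mulgA; congr (_ * _).
by case: f => //=; rewrite ?expg1 ?expg0 ?mulg1 -?expg2.
Qed.
End DihedralGroup.

Section MonodromyGroup.
Variable R : realType.
Local Notation C := R[i].
Local Open Scope classical_set_scope.
Local Open Scope ring_scope.
Local Open Scope complex_scope.

Lemma prim_root_period m : (0 < m)%N -> m.-primitive_root (cexp (period R / m%:R)).
Proof.
move=> m0; have mn0 : m%:R != 0 :> C by rewrite pnatr_eq0 -lt0n.
have mR0 : m%:R != 0 :> R by rewrite pnatr_eq0 -lt0n.
apply/andP; split => //; apply/forallP => i; apply/eqP.
rewrite unity_rootE; apply/eqP/eqP => [|->]; last first.
  by rewrite -cexpMn mulrC divfK // cexp_period.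
rewrite -cexpMn => /cexp_eq1[j /(congr1 (@complex.Im R))].
have -> : i.+1%:R * (period R / m%:R) = (i.+1%:R / m%:R : R)%:C * period R.
  by rewrite rmorphM fmorphV !rmorph_nat; field.
rewrite /period /= !(mul0r, mulr0, addr0, add0r, mulr1) -mulrzr => h.
have p0 : pi *+ 2 != 0 :> R by rewrite mulrn_eq0 /= gt_eqF // pi_gt0.
have {}h : i.+1%:R = m%:R * j%:~R :> R.
  by move: h; rewrite [RHS]mulrC => /(mulIf p0) <-; rewrite mulrC divfK.
have h2 : i.+1%:Z = m%:Z * j.
  by apply/eqP; rewrite -(eqr_int R) rmorphM /= -!pmulrn h.
have := ltn_ord i; move: h2 m0; case: (j) => q; last by lia.
rewrite -PoszM => -[h3] m0 im; move: h3; case: (q) => [|[|q']]; rewrite ?muln0 ?muln1 //.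
by nia.
Qed.

Lemma dmat_mul (z w : C) (e f : bool) : w != 0 ->
  dmat z e *m dmat w f = (if e then w else 1) *: dmat (z * (if e then w^-1 else w)) (e (+) f).
Proof.
move=> w0; apply/matrixP => i j; rewrite mxE sum2_dmat !mxE.
by have [->|->] := ord2 i; have [->|->] := ord2 j; case: (e); case: (f); rewrite /= ?(mul0r, mulr0, mul1r, mulr1) //; field.
Qed.

Lemma dmat_inj (c b z w : C) (e f : bool) : c != 0 -> b != 0 -> z != 0 -> w != 0 ->
  c *: dmat z e = b *: dmat w f -> e = f /\ z = w.
Proof.
move=> c0 b0 z0 w0 /matrixP h.
have h00 := h 0 0; have h01 := h 0 1; have h10 := h 1 0; have h11 := h 1 1.
move: h00 h01 h10 h11; rewrite !mxE; clear -c0 b0.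
case: e; case: f; rewrite /= ?(mul0r, mulr0, mul1r, mulr1) => h00 h01 h10 h11.
- by split; last by move: h01; rewrite h10 => /(mulfI b0).
- by move: c0; rewrite h10 eqxx.
- by move: c0; rewrite h11 eqxx.
- by split; last by move: h00; rewrite h11 => /(mulfI b0).
Qed.

Lemma monodromy_change (H : hypergeometric_eq R) (z0 : C) (y Y : 'I_2 -> C -> C) (A M : 'M[C]_2) :
  A \in unitmx ->
  (forall i, \forall z \near (z0 : C^o), Y i z = \sum_j A i j * y j z) ->
  monodromy_matrix H z0 y M -> monodromy_matrix H z0 Y (A *m M *m invmx A).
Proof.
move=> Au YA [gamma [F [hg hF]]].
exists gamma, (fun i t z => \sum_j A i j * F j t z); split; first exact: hg.
have both (P : 'I_2 -> C -> Prop) : (forall j, \forall z \near (z0 : C^o), P j z) ->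
    \forall z \near (z0 : C^o), forall j, P j z.
  by move=> h; apply: filterS2 (h 0) (h 1) => z h0 h1 j; have [->|->] := ord2 j.
move=> i; split.
- move=> t tin; split.
    by apply: solves_near_sum => j; have [/(_ t tin)[]] := hF j.
  have c0 : \forall s \near t, s \in `[0, 1] -> \forall z \near gamma s, F 0 s z = F 0 t z.
    by have [/(_ t tin)[]] := hF 0.
  have c1 : \forall s \near t, s \in `[0, 1] -> \forall z \near gamma s, F 1 s z = F 1 t z.
    by have [/(_ t tin)[]] := hF 1.
  apply: filterS2 c0 c1 => s h0 h1 sin; have k0 := h0 sin; have k1 := h1 sin.
  by apply: filterS2 k0 k1 => z e0 e1; rewrite !sum2 e0 e1.
- have h : forall j, \forall z \near (z0 : C^o), F j 0 z = y j z by move=> j; have [] := hF j.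
  apply: filterS2 (both _ h) (YA i) => z e ->.
  by rewrite !sum2 !e.
- have h : forall j, \forall z \near (z0 : C^o), F j 1 z = \sum_q M j q * y q z by move=> j; have [] := hF j.
  apply: filterS2 (both _ h) (both _ YA) => z e e'.
  under eq_bigr => j _ do rewrite e mulr_sumr.
  under [RHS]eq_bigr => j _ do rewrite e' mulr_sumr.
  rewrite exchange_big [RHS]exchange_big /=; apply: eq_bigr => q _.
  under eq_bigr => j _ do rewrite mulrA.
  under [RHS]eq_bigr => j _ do rewrite mulrA.
  rewrite -!mulr_suml; congr (_ * _).
  have := congr1 (fun X : 'M[C]_2 => X i q) (mulmxKV Au (A *m M)).
  by rewrite /= => h1; rewrite mxE in h1; rewrite h1 mxE.
Qed.

Variables (v : place) (k l m n : nat) (G : {poly C}) (H : hypergeometric_eq R).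
Hypothesis HD : dihedral_eq v k l m n G H.
Hypothesis m_gt1 : (1 < m)%N.
Hypothesis n_coprime_m : coprime n m.
Local Notation sol := (sol v k m n G H).
Local Notation a := (n%:R / m%:R : C).

(** In the explicit basis a monodromy matrix is a multiple of [dmat (z1 ^ i)
    e] with [z1] a primitive [m]-th root of unity; the isomorphism reads off
    [i] modulo [m] and [e]. All values of [i] occur because [n] is prime to
    [m]. *)
Theorem dihedral_monodromy : monodromy_group_isog H 'D_(m.*2).
Proof.
have m_gt0 := ltnW m_gt1; have mn0 : m%:R != 0 :> C by rewrite pnatr_eq0 -lt0n.
move=> z0 y z00 z01 [hy yfree].
have [d hd] := germs_exist v z00 z01.
have hfun := sol_fundamental HD hd.
have [b0 hb0] := fundamental_span z00 z01 hfun (hy 0).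
have [b1 hb1] := fundamental_span z00 z01 hfun (hy 1).
pose B : 'M[C]_2 := \matrix_(i, j) (if i == 0 then b0 j else b1 j).
have yB i : \forall z \near (z0 : C^o), y i z = \sum_j B i j * sol d j z.
  have [->|->] := ord2 i; [apply: filterS hb0|apply: filterS hb1] => z ->.
    by apply: eq_bigr => j _; rewrite mxE.
  by apply: eq_bigr => j _; rewrite mxE.
have Bu : B \in unitmx.
  rewrite unitmxE unitfE; apply/negP => /det0P[u u0 uB].
  move/negP: u0; apply; apply/eqP/rowP => i; rewrite mxE; apply: (yfree (fun i => u 0 i)).
  apply: filterS2 (yB 0) (yB 1) => z e0 e1.
  rewrite sum2 e0 e1 !mulr_sumr -big_split /=.
  apply: big1 => j _; have := congr1 (fun X : 'rV[C]_2 => X 0 j) uB.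
  rewrite !mxE sum2 !mxE /= => e; rewrite !mulrA -mulrDl e mul0r //.
have Bi : invmx B \in unitmx by rewrite unitmx_inv.
have By i : \forall z \near (z0 : C^o), sol d i z = \sum_j invmx B i j * y j z.
  apply: filterS2 (yB 0) (yB 1) => z e0 e1.
  have hc : \col_j y j z = B *m (\col_j sol d j z) :> 'cV[C]_2.
    apply/matrixP => p q; rewrite mxE [RHS]mxE.
    have [->|->] := ord2 p; [rewrite e0|rewrite e1]; apply: eq_bigr => r _; rewrite !mxE //.
  have := congr1 (fun X : 'cV[C]_2 => X i 0) (mulKmx Bu (\col_j sol d j z)).
  by rewrite -hc [RHS]mxE mxE => <-; apply: eq_bigr => r _; rewrite mxE.
pose z1 := cexp (period R / m%:R).
have prim : m.-primitive_root z1 := prim_root_period m_gt0.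
have z1m : z1 ^+ m = 1 := prim_expr_order prim.
have z1n0 i : z1 ^+ i != 0 by rewrite expf_neq0 // cexp_neq0.
pose Rel (M : 'M[C]_2) (e : bool) (i : nat) := exists2 c, c != 0 & invmx B *m M *m B = c *: dmat (z1 ^+ i) e.
have rel_ex M : monodromy_matrix H z0 y M -> exists e (i : nat), Rel M e i.
  move=> /(monodromy_change Bi By); rewrite invmxK => /(monodromy_dihedral HD hd)[e [z [c [c0 zm hM]]]].
  have [i zi] := prim_rootP prim zm; exists e, i, c => //.
  by apply/matrixP => p q; rewrite hM [RHS]mxE -zi.
have rel_all e (i : nat) : exists2 M, monodromy_matrix H z0 y M & Rel M e i.
  have [j hj] : exists j, (n * j = i %[mod m])%N.
    case: (egcdnP m (de_n_gt0 HD)) => km kn; rewrite (eqP n_coprime_m) => h _.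
    exists (km * i)%N; rewrite mulnA (mulnC n) h mulnDl mul1n.
    by rewrite -modnDml mulnAC modnMl add0n.
  have [c c0 hM] := realize_loop HD e j hd.
  have zE : cexp (a * (j%:R * period R)) = z1 ^+ i.
    have -> : a * (j%:R * period R) = (n * j)%:R * (period R / m%:R) by rewrite natrM; field.
    by rewrite cexpMn -/z1 -(prim_expr_mod prim) hj prim_expr_mod.
  rewrite zE in hM; exists (B *m (c *: dmat (z1 ^+ i) e) *m invmx B).
    exact: (monodromy_change Bu yB hM).
  by exists c => //; rewrite -!mulmxA mulVmx // mulmx1 mulmxA mulVmx // mul1mx.
have rel_uniq M e i f j : Rel M e i -> Rel M f j -> e = f /\ (i = j %[mod m])%N.
  move=> [c c0 h1] [b b0' h2]; rewrite h1 in h2.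
  have [-> /eqP zz] := dmat_inj c0 b0' (z1n0 i) (z1n0 j) h2.
  by split => //; apply/eqP; rewrite -(eq_prim_root_expr prim).
have rel_mul M N e i f j : Rel M e i -> Rel N f j ->
    Rel (M *m N) (e (+) f) (i + (if e then j * m.-1 else j)).
  move=> [c c0 h1] [b b0' h2].
  exists (c * b * (if e then z1 ^+ j else 1)).
    by rewrite !mulf_neq0 //; case: (e); rewrite ?z1n0 ?oner_neq0.
  have -> : invmx B *m (M *m N) *m B = (invmx B *m M *m B) *m (invmx B *m N *m B).
    by rewrite !mulmxA mulmxK.
  rewrite h1 h2 -scalemxAl -scalemxAr dmat_mul // !scalerA exprD; congr (_ *: dmat (_ * _) _).
  case: (e) => //; apply: (mulfI (z1n0 j)); rewrite divff //.
  by rewrite -exprD -{1}[j]muln1 -mulnDr add1n prednK // mulnC exprM z1m expr1n.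
have [x [t [xm t2 xt surj inj]]] := dihedral_presentation m_gt1.
pose val_of (p : bool * nat) := (x ^+ p.2 * t ^+ p.1)%g.
pose rho (M : 'M[C]_2) := match pselect (exists p : bool * nat, Rel M p.1 p.2) with
  | left h => val_of (projT1 (cid h)) | right _ => 1%g end.
have xmod i j : (i = j %[mod m])%N -> (x ^+ i = x ^+ j)%g.
  by move=> h; rewrite -(expg_mod i xm) h expg_mod.
have rhoE M e i : Rel M e i -> rho M = (x ^+ i * t ^+ e)%g.
  move=> hM; rewrite /rho; case: pselect => [h|]; last by case; exists (e, i).
  case: (cid h) => -[f j] /= hM'; rewrite /val_of /=.
  by have [-> /xmod ->] := rel_uniq _ _ _ _ _ hM hM'.
exists rho; split.
- move=> g; have [i [e ->]] := surj g; have [M hM hR] := rel_all e i.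
  by exists M => //; exact: rhoE.
- move=> M N /rel_ex[e [i hM]] /rel_ex[f [j hN]].
  rewrite (rhoE _ _ _ hM) (rhoE _ _ _ hN) (rhoE _ _ _ (rel_mul _ _ _ _ _ _ hM hN)).
  exact: dihedral_mul.
move=> M N /rel_ex[e [i hM]] /rel_ex[f [j hN]].
rewrite (rhoE _ _ _ hM) (rhoE _ _ _ hN); split.
  rewrite -(expg_mod i xm) -(expg_mod j xm).
  move=> /(inj (Ordinal (ltn_pmod i m_gt0)) (Ordinal (ltn_pmod j m_gt0)))[/(congr1 val) /= ij ef].
  move: hM hN => [c c0 h1] [b b0' h2]; exists (b / c); first by rewrite mulf_neq0 // invr_neq0.
  have zz : z1 ^+ j = z1 ^+ i by rewrite -(prim_expr_mod prim) -ij prim_expr_mod.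
  rewrite -ef zz in h2.
  have h3 : invmx B *m N *m B = (b / c) *: (invmx B *m M *m B) by rewrite h1 h2 scalerA divfK.
  have back (X : 'M[C]_2) : X = B *m (invmx B *m X *m B) *m invmx B.
    by rewrite !mulmxA mulmxV // mul1mx mulmxK.
  by rewrite (back N) h3 -scalemxAr -scalemxAl -back.
move=> [c c0 NE]; have hN' : Rel N e i.
  move: hM => [b b0' h1]; exists (c * b); first by rewrite mulf_neq0.
  by rewrite NE -scalemxAr -scalemxAl h1 scalerA.
by rewrite -(rhoE _ _ _ hN) -(rhoE _ _ _ hN').
Qed.

End MonodromyGroup.

(** * Rational functions in lowest terms *)

Section ReducedFractions.
Variable F : fieldType.
Implicit Types (f g : {fraction {poly F}}) (a b p q : {poly F}).

Lemma coprimep_proportional a b p q : b != 0 -> q != 0 -> coprimep a b -> coprimep p q ->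
  p * b = a * q -> exists2 u, u != 0 & p = u *: a /\ q = u *: b.
Proof.
move=> b0 q0 cab cpq e.
have bq : b %| q by rewrite -(Gauss_dvdpr _ (q := a)) 1?coprimep_sym // -e dvdp_mulIr.
have qb : q %| b by rewrite -(Gauss_dvdpr _ (q := p)) 1?coprimep_sym // e dvdp_mulIr.
have /eqpf_eq[u u0 qE] : q %= b by rewrite /eqp qb bq.
exists u => //; split => //; apply: (mulIf b0).
by rewrite e qE -scalerAl -scalerAr.
Qed.

Lemma ratfun_fracE f : [/\ ratfun_den f != 0, coprimep (ratfun_num f) (ratfun_den f) &
  f = tofrac (ratfun_num f) / tofrac (ratfun_den f)].
Proof.
rewrite /ratfun_num /ratfun_den.
set r := generic_quotient.repr f.
have d0 : (frac r).2 != 0 := denom_ratioP r.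
have g0 : gcdp (frac r).1 (frac r).2 != 0 by rewrite gcdp_eq0 negb_and d0 orbT.
have fE : f = tofrac (frac r).1 / tofrac (frac r).2.
  apply: canRL (mulfK _) _; first by rewrite tofrac_eq0.
  rewrite -[f]generic_quotient.reprK -/r /FracField.tofrac; unlock.
  rewrite -[LHS](FracField.pi_mul r (Ratio (frac r).2 1)).
  apply/eqP; rewrite FracField.equivf_def /FracField.mulf.
  by rewrite !numden_Ratio ?oner_neq0 ?mulf_neq0 ?oner_neq0 // !mulr1 mulrC.
have nE := divpK (dvdp_gcdl (frac r).1 (frac r).2).
have dE := divpK (dvdp_gcdr (frac r).1 (frac r).2).
split.
- by apply/eqP => e; move: d0; rewrite -dE e mul0r eqxx.
- by apply: coprimep_div_gcd; rewrite d0 orbT.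
- rewrite fE -[X in tofrac X / _ = _]nE -[X in _ / tofrac X = _]dE !tofracM -mulf_div divff ?mulr1 //.
  by rewrite tofrac_eq0.
Qed.

Lemma ratfun_cross a b : b != 0 ->
  ratfun_num (tofrac a / tofrac b) * b = a * ratfun_den (tofrac a / tofrac b).
Proof.
move=> b0; have [d0 _] := ratfun_fracE (tofrac a / tofrac b).
move: (ratfun_num _) (ratfun_den _) d0 => p q q0 /eqP.
rewrite eqr_div ?tofrac_eq0 // -!tofracM tofrac_eq => /eqP ->.
by rewrite mulrC.
Qed.

Lemma ratfun_evalE a b x : b.[x] != 0 ->
  (ratfun_den (tofrac a / tofrac b)).[x] != 0 /\
  ratfun_eval (tofrac a / tofrac b) x = a.[x] / b.[x].
Proof.
move=> bx; have b0 : b != 0 by apply: contraNneq bx => ->; rewrite horner0.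
have [d0 cnd _] := ratfun_fracE (tofrac a / tofrac b).
have e := ratfun_cross a b0.
have /dvdpP[c bE] : ratfun_den (tofrac a / tofrac b) %| b.
  by rewrite -(Gauss_dvdpr _ (q := ratfun_num (tofrac a / tofrac b))) 1?coprimep_sym // e dvdp_mulIr.
have dx : (ratfun_den (tofrac a / tofrac b)).[x] != 0.
  by apply: contraNneq bx => d; rewrite bE hornerM d mulr0.
split=> //; rewrite /ratfun_eval; apply/eqP; rewrite eqr_div //; apply/eqP.
by rewrite -!hornerM e.
Qed.

Lemma ratfun_eval_tofrac a x : ratfun_eval (tofrac a) x = a.[x].
Proof.
have := @ratfun_evalE a 1 x; rewrite hornerC oner_neq0 tofrac1 !divr1.
by case/(_ isT).
Qed.

Lemma ratfun_degree_gt0 f x y : (ratfun_den f).[x] != 0 -> (ratfun_den f).[y] != 0 ->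
  ratfun_eval f x != ratfun_eval f y -> (0 < ratfun_degree f)%N.
Proof.
move=> dx dy; apply: contraNT; rewrite -leqNgt leqn0 /ratfun_degree.
rewrite -leqn0 geq_max => /andP[]; rewrite !leqn0 /ratfun_eval.
have c p : (size p).-1 == 0%N -> p = (p`_0)%:P.
  by move=> sp; apply: size1_polyC; case: (size p) sp => [|[]].
by move=> /c -> /c ->; rewrite !hornerC.
Qed.

End ReducedFractions.

(** * The covering Phi *)

Section KleinPullback.
Variable R : realType.
Local Notation C := R[i].
Local Open Scope classical_set_scope.
Local Open Scope ring_scope.
Local Open Scope complex_scope.

Variables (k l m n : nat) (G Theta1 Theta2 : {poly C}) (H0 H1 : hypergeometric_eq R).
Hypothesis HD : dihedral_eq Place1 k l m n G H1.
Hypothesis HD0 : dihedral_eq Place1 0 0 m 1 1 H0.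
Hypothesis thetaE : (1 + 'X) ^+ n * G ^+ m = (Theta1 \Po 'X^2) + 'X^(2 * k + 1) * (Theta2 \Po 'X^2).
Local Notation a := (n%:R / m%:R : C).
Local Notation Phi := (tofrac ('X^(2 * k + 1) * Theta2 ^+ 2) / tofrac (Theta1 ^+ 2)).
Local Notation phi := (fun x : C => x ^+ (2 * k + 1) * Theta2.[x] ^+ 2 / Theta1.[x] ^+ 2).
Let al : C := (1 - paramC H1 - (k%:R + 1 / 2)) / 2.
Let be : C := (paramC H1 - paramA H1 - paramB H1) / 2.
Let al0 : C := (1 - paramC H0 - (0%:R + 1 / 2)) / 2.
Let be0 : C := (paramC H0 - paramA H0 - paramB H0) / 2.

Lemma theta_horner s : (1 + s) ^+ n * G.[s] ^+ m = Theta1.[s ^+ 2] + s ^+ (2 * k + 1) * Theta2.[s ^+ 2].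
Proof.
have := congr1 (fun p : {poly C} => p.[s]) thetaE.
by rewrite !(hornerD, hornerM, horner_exp, hornerX, hornerC, horner_comp).
Qed.

(** [Theta1(0)] is the value at 0 of [(1 + s)^n G(s)^m]. *)
Lemma Theta1_0 : Theta1.[0] != 0.
Proof.
have := theta_horner 0; rewrite addr0 expr1n mul1r expr0n /= exprD expr1 mulr0 mul0r addr0 => <-.
by rewrite expf_neq0 // (klein_poly_0 (de_ode HD) (de_N1 HD) (de_nonnat HD)).
Qed.

(** Otherwise [(1 + s)^n G(s)^m] would be even, but it vanishes at [-1] and
    not at [1]. *)
Lemma Theta2_neq0 : Theta2 != 0.
Proof.
have G1 : G.[1] != 0 := klein_poly_1 (de_ode HD) (de_N1 HD) (de_nonnat HD).
have hp := theta_horner 1; have hm := theta_horner (-1).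
apply/eqP => t0; move: hp hm; rewrite t0 !horner0 !mulr0 !addr0 sqrrN subrr expr0n.
rewrite (gtn_eqF (de_n_gt0 HD)) mul0r => <- /eqP; rewrite eq_sym.
by rewrite mulf_eq0 !expf_eq0 -[1 + 1]/(2%:R) pnatr_eq0 (negPf G1) !andbF.
Qed.

Lemma Phi_eval (x : C) : Theta1.[x] != 0 -> (ratfun_den Phi).[x] != 0 /\ ratfun_eval Phi x = phi x.
Proof.
move=> t; have t2 : (Theta1 ^+ 2).[x] != 0 by rewrite horner_exp expf_neq0.
have [h ->] := ratfun_evalE ('X^(2 * k + 1) * Theta2 ^+ 2) t2.
by split => //; rewrite hornerM !horner_exp hornerX.
Qed.

Lemma hol_phi (x : C) : Theta1.[x] != 0 -> hol phi x.
Proof.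
move=> t; apply: hol_div; last exact: expf_neq0.
  by apply: holM; [apply: holX; exact: hol_id|apply: holX; apply: hol_poly; exact: hol_id].
by apply: holX; apply: hol_poly; exact: hol_id.
Qed.

(** With [s0 = s^(2 k + 1) Theta2 / Theta1], a square root of [phi], one has
    [Theta1 (1 + s0) = (1 + s)^n G(s)^m] and [(1 - phi) (1 + s0) / (1 - s0) =
    (1 + s0)^2]. Both sides therefore have the same [2 m]-th power once the
    exponents of [x] and of [phi] are matched. *)
Lemma pullback_germ (x0 : C) (d d0 : germs R) (L0 L1 LT LP LQ : C -> C) :
  is_germs Place1 x0 d -> is_germs Place1 (phi x0) d0 ->
  gs d0 (phi x0) * Theta1.[x0] = gs d x0 ^+ (2 * k + 1) * Theta2.[x0] ->
  [/\ hol L0 x0, hol L1 x0, hol LT x0, hol LP x0 & hol LQ x0] ->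
  (\forall z \near (x0 : C^o), [/\ cexp (L0 z) = z, cexp (L1 z) = 1 - z, cexp (LT z) = Theta1.[z],
     cexp (LP z) = phi z & cexp (LQ z) = 1 - phi z]) ->
  exists c, \forall z \near (x0 : C^o),
    cexp (al * L0 z) * cexp ((be - a / 2) * L1 z) * cexp (1 / m%:R * LT z) *
      cexp (- al0 * LP z) * cexp ((1 / (2 * m%:R) - be0) * LQ z) *
      sol1 Place1 0 m 1 1 H0 d0 (phi z) = c * sol1 Place1 k m n G H1 d z.
Proof.
move=> hd hd0 s0E [h0 h1 hT hP hQ] eL.
have mn0 : m%:R != 0 :> C by rewrite pnatr_eq0 -lt0n (de_m_gt0 HD).
have [[g0 g1 gS gU'] eg] := hd; have [[g00 g10 gS0 gU0] eg0] := hd0.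
have T0 : Theta1.[x0] != 0 by have [_ _ <- _ _] := nbhs_singleton eL; exact: cexp_neq0.
have hp := hol_phi T0.
have ep : \forall z \near (x0 : C^o), germ_eqs Place1 d0 (phi z) by exact: hol_continuous hp _ eg0.
have hs0 : hol (fun z => gs d0 (phi z)) x0 := hol_comp hp gS0.
have hU0 : hol (fun z => gU d0 (phi z)) x0 := hol_comp hp gU0.
have hl0 : hol (fun z => gL0 d0 (phi z)) x0 := hol_comp hp g00.
have hl1 : hol (fun z => gL1 d0 (phi z)) x0 := hol_comp hp g10.
have T1 : \forall z \near (x0 : C^o), Theta1.[z] != 0.
  by apply: filterS eL => z [_ _ <- _ _]; exact: cexp_neq0.
have sE : \forall z \near (x0 : C^o), gs d0 (phi z) * Theta1.[z] = gs d z ^+ (2 * k + 1) * Theta2.[z].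
  have gn : gs d x0 ^+ (2 * k + 1) * Theta2.[x0] != 0.
    rewrite -s0E mulf_neq0 //.
    by have [_ _ h _ _] := germ_eqs_regular (nbhs_singleton ep).
  have ho : hol (fun z => Theta1.[z]) x0 by apply: hol_poly; exact: hol_id.
  have ho2 : hol (fun z => Theta2.[z]) x0 by apply: hol_poly; exact: hol_id.
  have sq : \forall z \near (x0 : C^o), (gs d0 (phi z) * Theta1.[z]) ^+ 2 = (gs d z ^+ (2 * k + 1) * Theta2.[z]) ^+ 2.
    apply: filterS3 T1 ep eg => z t [_ _ e1 _] [_ _ e2 _].
    rewrite !exprMn e1 [in RHS]exprAC e2 /= divfK //; exact: expf_neq0.
  have [c c0 hc] := pow_eq_const (isT : (0 < 2)%N) (holM hs0 ho) (holM (holX (2 * k + 1) gS) ho2) gn sq.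
  have c1 : c = 1 by apply: (mulIf gn); rewrite mul1r -(nbhs_singleton hc).
  by apply: filterS hc => z ->; rewrite c1 mul1r.
have [c1 hc1] : exists c1, \forall z \near (x0 : C^o), L0 z = gL0 d z + c1.
  eexists; apply: (log_unique h0 g0); apply: filterS2 eL eg => z [-> _ _ _ _] [-> _ _ _] //.
have [c2 hc2] : exists c2, \forall z \near (x0 : C^o), L1 z = gL1 d z + c2.
  eexists; apply: (log_unique h1 g1); apply: filterS2 eL eg => z [_ -> _ _ _] [_ -> _ _] //.
have [c3 hc3] : exists c3, \forall z \near (x0 : C^o), LP z = gL0 d0 (phi z) + c3.
  eexists; apply: (log_unique hP hl0); apply: filterS2 eL ep => z [_ _ _ -> _] [-> _ _ _] //.
have [c4 hc4] : exists c4, \forall z \near (x0 : C^o), LQ z = gL1 d0 (phi z) + c4.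
  eexists; apply: (log_unique hQ hl1); apply: filterS2 eL ep => z [_ _ _ _ ->] [_ -> _ _] //.
pose f z := cexp (- (a / 2) * L1 z + 1 / m%:R * LT z + 1 / (2 * m%:R) * LQ z + 1 / (2 * m%:R) * gU d0 (phi z)).
pose g z := cexp (a / 2 * gU d z) * G.[gs d z].
have hf : hol f x0.
  apply: hol_cexp; apply: holD; last exact: holZ.
  by apply: holD; [apply: holD; exact: holZ|exact: holZ].
have hg : hol g x0 by apply: holM; [apply: hol_cexp; exact: holZ|exact: hol_poly].
have key : \forall z \near (x0 : C^o), Theta1.[z] * (1 + gs d0 (phi z)) = (1 + gs d z) ^+ n * G.[gs d z] ^+ m.
  apply: filterS2 sE eg => z e [_ _ /= e2 _].
  by rewrite theta_horner e2 mulrDr mulr1 mulrC -e mulrC.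
have gx : g x0 != 0.
  rewrite mulf_neq0 ?cexp_neq0 //.
  have := nbhs_singleton key; have [_ _ _ h _] := germ_eqs_regular (nbhs_singleton ep).
  move=> e; apply: contra_neq (mulf_neq0 T0 h) => g_0.
  by rewrite e g_0 expr0n (gtn_eqF (de_m_gt0 HD)) mulr0.
have fg : \forall z \near (x0 : C^o), f z ^+ (2 * m) = g z ^+ (2 * m).
  apply: filterS3 (near_and eL ep) eg key => z [[_ e1 eT _ eQ] ez] ey ek.
  have [_ _ _ sp sm] := germ_eqs_regular ey; have [_ _ _ s0p s0m] := germ_eqs_regular ez.
  have [_ _ /= ss0 eU0] := ez; have [_ _ /= ss eU] := ey.
  rewrite /f /g [in RHS]exprMn -!cexpMn.
  have -> : (2 * m)%:R * (a / 2 * gU d z) = n%:R * gU d z by rewrite natrM; field.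
  have -> : (2 * m)%:R * (- (a / 2) * L1 z + 1 / m%:R * LT z + 1 / (2 * m%:R) * LQ z + 1 / (2 * m%:R) * gU d0 (phi z)) =
     2%:R * LT z + (LQ z + gU d0 (phi z)) - n%:R * L1 z by rewrite natrM; field.
  have e1' : cexp (L1 z) = 1 - gs d z ^+ 2 by rewrite ss.
  have eQ' : cexp (LQ z) = 1 - gs d0 (phi z) ^+ 2 by rewrite ss0.
  rewrite cexpB !cexpD !cexpMn e1' eT eQ'.
  have -> : (1 - gs d0 (phi z) ^+ 2) * cexp (gU d0 (phi z)) = (1 + gs d0 (phi z)) ^+ 2.
    by rewrite [RHS]expr2 -{1}eU0; ring.
  rewrite -exprMn ek.
  have -> : cexp (gU d z) = (1 + gs d z) / (1 - gs d z) by rewrite -eU mulfK.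
  have -> : 1 - gs d z ^+ 2 = (1 - gs d z) * (1 + gs d z) by ring.
  move: (gs d z) sp sm => s sp sm.
  rewrite !exprMn exprVn mulnC exprM; field.
  by rewrite !expf_neq0.
have m20 : (0 < 2 * m)%N by rewrite muln_gt0 (de_m_gt0 HD).
have [c5 _ hc5] := pow_eq_const m20 hf hg gx fg.
exists (c5 * cexp (al * c1 + be * c2 - al0 * c3 - be0 * c4)).
have e12 := near_and hc1 hc2; have e34 := near_and hc3 hc4.
move: e12 e34 hc5; apply: filterS3 => z [p1 p2] [p3 p4]; rewrite /f /g => p5.
rewrite /sol1 /prefactor hornerC mulr1 /= -/al -/be -/al0 -/be0.
have -> : c5 * cexp (al * c1 + be * c2 - al0 * c3 - be0 * c4) *
    (cexp (al * gL0 d z + be * gL1 d z + a / 2 * gU d z) * G.[gs d z]) =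
    cexp (al * c1 + be * c2 - al0 * c3 - be0 * c4) * (cexp (al * gL0 d z + be * gL1 d z) *
    (c5 * (cexp (a / 2 * gU d z) * G.[gs d z]))) by rewrite (cexpD (al * gL0 d z + be * gL1 d z)); ring.
rewrite -p5 -!cexpD; congr cexp; rewrite p1 p2 p3 p4.
by field.
Qed.

Lemma prod5 (F : 'I_5 -> C) : \prod_i F i = F (@Ordinal 5 0 isT) * F (@Ordinal 5 1 isT) *
  F (@Ordinal 5 2 isT) * F (@Ordinal 5 3 isT) * F (@Ordinal 5 4 isT).
Proof.
by rewrite !big_ord_recl big_ord0 mulr1 !mulrA; congr (F _ * F _ * F _ * F _ * F _); exact: val_inj.
Qed.

Theorem Phi_pullback : pullback_transformation H0 H1 Phi.
Proof.
have T10 := Theta1_0; have T1n : Theta1 != 0 by apply: contraNneq T10 => ->; rewrite horner0.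
have [y y0] : exists y, ('X * Theta1 * Theta2).[y] != 0.
  by apply: poly_nonroot; rewrite !mulf_neq0 ?polyX_eq0 // Theta2_neq0.
have qE : 1 - Phi = tofrac (Theta1 ^+ 2 - 'X^(2 * k + 1) * Theta2 ^+ 2) / tofrac (Theta1 ^+ 2).
  by rewrite tofracB mulrBl divff // tofrac_eq0 expf_neq0.
split.
  move: y0; rewrite !hornerM hornerX !mulf_eq0 !negb_or => /andP[/andP[y0 y1] y2].
  have [d0 e0] := Phi_eval T10; have [dy ey] := Phi_eval y1.
  apply: (ratfun_degree_gt0 d0 dy); rewrite e0 ey eq_sym addn1 expr0n !mul0r.
  by rewrite !mulf_neq0 ?invr_neq0 ?expf_neq0.
(* The exponents of [Phi] and [1 - Phi] cancel those of the solutions of [H0],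
   up to the [2 m]-th root that [pullback_germ] needs. *)
exists 5, (fun i => nth 0 [:: tofrac 'X; tofrac (1 - 'X); tofrac Theta1; Phi; 1 - Phi] i),
  (fun i => nth 0 [:: al; be - a / 2; 1 / m%:R; - al0; 1 / (2 * m%:R) - be0] i).
split.
  case=> [[|[|[|[|[|//]]]]] i5] /=; rewrite ?qE ?mulf_neq0 ?invr_neq0 ?tofrac_eq0 ?polyX_eq0 ?expf_neq0 //.
  - by rewrite -size_poly_eq0 -[1 - _]opprB size_polyN size_XsubC.
  - by rewrite mulf_neq0 ?expf_neq0 ?polyX_eq0 // Theta2_neq0.
  - have : (Theta1 ^+ 2 - 'X^(2 * k + 1) * Theta2 ^+ 2).[0] != 0.
      by rewrite hornerD hornerN !(horner_exp, hornerM, hornerX) addn1 expr0n mul0r subr0 expf_neq0.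
    by apply: contraNneq => ->; rewrite horner0.
move=> x0 x00 x01 den0 phi0 phi1 f theta hf [L [hL ht]].
have hLi i : hol (L i) x0.
  have := hL i; apply: filterS => z [hz _]; eexists; exact: (derivable_cder _ _).1 hz.
have e0 := hL (@Ordinal 5 0 isT); have e1 := hL (@Ordinal 5 1 isT).
have eT := hL (@Ordinal 5 2 isT); have eP := hL (@Ordinal 5 3 isT); have eQ := hL (@Ordinal 5 4 isT).
have T1 : \forall z \near (x0 : C^o), Theta1.[z] != 0.
  by apply: filterS eT => z [_ /=]; rewrite ratfun_eval_tofrac => <-; exact: cexp_neq0.
have T1x := nbhs_singleton T1.
have phiE : \forall z \near (x0 : C^o), ratfun_eval Phi z = phi z.
  by apply: filterS T1 => z /Phi_eval[].
have phix := nbhs_singleton phiE; rewrite phix in phi0 phi1 hf.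
have eL : \forall z \near (x0 : C^o), [/\ cexp (L (@Ordinal 5 0 isT) z) = z, cexp (L (@Ordinal 5 1 isT) z) = 1 - z,
    cexp (L (@Ordinal 5 2 isT) z) = Theta1.[z], cexp (L (@Ordinal 5 3 isT) z) = phi z &
    cexp (L (@Ordinal 5 4 isT) z) = 1 - phi z].
  move: (near_and e0 e1) (near_and eT eP) (near_and eQ T1).
  apply: filterS3 => z [[_ a0] [_ a1]] [[_ a2] [_ a3]] [[_ a4] t].
  have t2 : (Theta1 ^+ 2).[z] != 0 by rewrite horner_exp expf_neq0.
  rewrite a0 a1 a2 a3 a4 /= qE !ratfun_eval_tofrac (Phi_eval t).2.
  rewrite (ratfun_evalE _ t2).2; split => //; rewrite !(hornerD, hornerN, hornerC, hornerX, horner_exp, hornerM) //.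
  by rewrite mulrBl divff // expf_neq0.
have [d0 hd0] := germs_exist Place1 phi0 phi1.
have [d hd hds] : exists2 d, is_germs Place1 x0 d &
    gs d0 (phi x0) * Theta1.[x0] = gs d x0 ^+ (2 * k + 1) * Theta2.[x0].
  have [d hd] := germs_exist Place1 x00 x01.
  have [_ _ _ _ ss] := germs_data hd; have [_ _ _ _ ss0] := germs_data hd0; rewrite /= in ss ss0.
  have /eqP : (gs d0 (phi x0) * Theta1.[x0]) ^+ 2 = (gs d x0 ^+ (2 * k + 1) * Theta2.[x0]) ^+ 2.
    by rewrite !exprMn ss0 [in RHS]exprAC ss divfK // expf_neq0.
  rewrite eqf_sqr => /orP[/eqP e|/eqP e]; first by exists d.
  exists (germs_opp d); first exact: is_germs_opp.
  by rewrite e /= exprNn -signr_odd oddD oddM /= expr1 mulN1r mulNr.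
have hs : gs (germs_opp d0) (phi x0) * Theta1.[x0] = gs (germs_opp d) x0 ^+ (2 * k + 1) * Theta2.[x0].
  by rewrite /= mulNr hds exprNn -signr_odd oddD oddM /= expr1 mulN1r mulNr.
have hLs := And5 (hLi (@Ordinal 5 0 isT)) (hLi (@Ordinal 5 1 isT)) (hLi (@Ordinal 5 2 isT))
  (hLi (@Ordinal 5 3 isT)) (hLi (@Ordinal 5 4 isT)).
have [b0 hb0] := pullback_germ hd hd0 hds hLs eL.
have [b1 hb1] := pullback_germ (is_germs_opp hd) (is_germs_opp hd0) hs hLs eL.
have [c hc] := fundamental_span phi0 phi1 (sol_fundamental HD0 hd0) hf.
have [F _] := sol_fundamental HD hd.
pose b (i : 'I_2) : C := if i == 0 then c 0 * b0 else c 1 * b1.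
apply: solves_near_congr (solves_near_sum b F).
have hp := hol_phi T1x.
have hcp : \forall z \near (x0 : C^o), f (phi z) = \sum_i c i * sol Place1 0 m 1 1 H0 d0 i (phi z).
  exact: hol_continuous hp _ hc.
move: (near_and hb0 hb1) (near_and ht phiE) hcp; apply: filterS3 => z [p0 p1] [tE ->] ->.
rewrite tE prod5 !sum2 /b /= mulrDr; congr (_ + _).
  by rewrite [RHS]mulrCA -mulrA; congr (_ * _); exact: esym p0.
by rewrite [RHS]mulrCA -mulrA; congr (_ * _); exact: esym p1.
Qed.

End KleinPullback.

(** * Coverings of the projective line *)

Section Coverings.
Variable F : numClosedFieldType.
Implicit Types (p q P Q X Z : {poly F}) (e r : nat) (x z : F).

(** The value at [(x : z)] of the form of degree [e] that dehomogenizes to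
    [p]; the point at infinity is [z = 0]. *)
Definition hval e p x z : F := \sum_(i < e.+1) p`_i * (x ^+ i * z ^+ (e - i)).
Definition hcomp e p X Z : {poly F} := \sum_(i < e.+1) p`_i *: (X ^+ i * Z ^+ (e - i)).

Lemma horner_hcomp e p X Z x : (hcomp e p X Z).[x] = hval e p X.[x] Z.[x].
Proof.
rewrite horner_sum; apply: eq_bigr => i _.
by rewrite hornerZ hornerM !horner_exp.
Qed.

Lemma hvalE e p x z : (size p <= e.+1)%N -> z != 0 -> hval e p x z = z ^+ e * p.[x / z].
Proof.
move=> sp z0; rewrite (horner_coef_wide _ sp) mulr_sumr; apply: eq_bigr => i _.
rewrite expr_div_n [RHS]mulrCA; congr (_ * _); rewrite [RHS]mulrCA; congr (_ * _).
by apply: (mulIf (expf_neq0 i z0)); rewrite divfK ?expf_neq0 // -exprD subnK // -ltnS.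
Qed.

Lemma hval_oo e p x : hval e p x 0 = p`_e * x ^+ e.
Proof.
rewrite /hval big_ord_recr /= subnn expr0 mulr1 big1 ?add0r // => i _.
by rewrite expr0n subn_eq0 leqNgt ltn_ord /= !mulr0.
Qed.

Lemma hvalD e p q x z : hval e (p + q) x z = hval e p x z + hval e q x z.
Proof. by rewrite -big_split; apply: eq_bigr => i _; rewrite coefD mulrDl. Qed.

Lemma hvalZ e c p x z : hval e (c *: p) x z = c * hval e p x z.
Proof. by rewrite mulr_sumr; apply: eq_bigr => i _; rewrite coefZ mulrA. Qed.

Lemma hval_scale e p c x z : hval e p (c * x) (c * z) = c ^+ e * hval e p x z.
Proof.
rewrite mulr_sumr; apply: eq_bigr => i _; rewrite [RHS]mulrCA; congr (_ * _).
by rewrite !exprMn mulrACA -exprD subnKC // -ltnS.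
Qed.

Lemma coef_top_mul P Q a b : (size P <= a.+1)%N -> (size Q <= b.+1)%N ->
  (P * Q)`_(a + b) = P`_a * Q`_b /\ (size (P * Q)%R <= (a + b).+1)%N.
Proof.
move=> sP sQ; split.
  have ab : (a < (a + b).+1)%N by rewrite ltnS leq_addr.
  rewrite coefM (bigD1 (Ordinal ab)) //= addKn big1 ?addr0 // => i /eqP ia.
  have [ai|ia'] := ltnP a i; first by rewrite nth_default ?mul0r // (leq_trans sP).
  rewrite [X in _ * X]nth_default ?mulr0 // (leq_trans sQ) //.
  have ia2 : (i < a)%N by rewrite ltn_neqAle ia' andbT; apply/eqP => h; apply: ia; exact: val_inj.
  by lia.
by apply: leq_trans (size_polyMleq _ _) _; lia.
Qed.

Lemma coef_top_exp P a i : (size P <= a.+1)%N ->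
  (P ^+ i)`_(a * i) = P`_a ^+ i /\ (size (P ^+ i)%R <= (a * i).+1)%N.
Proof.
move=> sP; elim: i => [|i [IH1 IH2]]; first by rewrite muln0 !expr0 coef1 size_poly1.
by have := coef_top_mul sP IH2; rewrite IH1 -!exprS mulnS.
Qed.

Lemma coef_top_hcomp e r p X Z : (size X <= r.+1)%N -> (size Z <= r.+1)%N ->
  (hcomp e p X Z)`_(r * e) = hval e p X`_r Z`_r /\ (size (hcomp e p X Z) <= (r * e).+1)%N.
Proof.
move=> sX sZ.
have h (i : 'I_e.+1) : (X ^+ i * Z ^+ (e - i))`_(r * e) = X`_r ^+ i * Z`_r ^+ (e - i) /\
    (size (X ^+ i * Z ^+ (e - i))%R <= (r * e).+1)%N.
  have [a1 a2] := coef_top_exp i sX; have [b1 b2] := coef_top_exp (e - i) sZ.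
  have := coef_top_mul a2 b2; rewrite a1 b1 -mulnDr subnKC // -ltnS //.
split.
  by rewrite coef_sum; apply: eq_bigr => i _; rewrite coefZ (h i).1.
apply: leq_trans (size_sum _ _ _) _; apply/bigmax_leqP => i _.
by apply: leq_trans (size_scale_leq _ _) (h i).2.
Qed.

(** The map [(p : q)] from the projective line to itself is everywhere defined
    and of degree [e]: no common zero, neither finite nor at infinity. *)
Definition cover e p q : Prop :=
  [/\ (size p <= e.+1)%N, (size q <= e.+1)%N, p`_e = 0 -> q`_e = 0 -> False &
      forall x, p.[x] = 0 -> q.[x] = 0 -> False].

Lemma cover_hval e p q x z : cover e p q -> hval e p x z = 0 -> hval e q x z = 0 -> x = 0 /\ z = 0.
Proof.
move=> [sp sq top nr]; have [->|z0] := eqVneq z 0.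
  rewrite !hval_oo; have [-> //|x0] := eqVneq x 0.
  move=> /eqP; rewrite mulf_eq0 expf_eq0 (negPf x0) andbF orbF => /eqP h1.
  by move=> /eqP; rewrite mulf_eq0 expf_eq0 (negPf x0) andbF orbF => /eqP /(top h1).
rewrite !hvalE // => /eqP; rewrite mulf_eq0 expf_eq0 (negPf z0) andbF /= => /eqP h1.
by move=> /eqP; rewrite mulf_eq0 expf_eq0 (negPf z0) andbF /= => /eqP /(nr _ h1).
Qed.

Lemma cover_comp e r p q X Z : cover e p q -> cover r X Z ->
  cover (r * e) (hcomp e p X Z) (hcomp e q X Z).
Proof.
move=> cpq [sX sZ top nr].
have [tp szp] := coef_top_hcomp e p sX sZ; have [tq szq] := coef_top_hcomp e q sX sZ.
split => //.
  by rewrite tp tq => h1 h2; have [/top h3 /h3] := cover_hval cpq h1 h2.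
move=> x; rewrite !horner_hcomp => h1 h2.
by have [/nr h3 /h3] := cover_hval cpq h1 h2.
Qed.

Lemma det2_free (a b c d x y : F) : a * d - b * c != 0 ->
  a * x + b * y = 0 -> c * x + d * y = 0 -> x = 0 /\ y = 0.
Proof.
move=> D h1 h2; split; apply: (mulfI D); rewrite mulr0.
  have -> : (a * d - b * c) * x = d * (a * x + b * y) - b * (c * x + d * y) by ring.
  by rewrite h1 h2 !mulr0 subrr.
have -> : (a * d - b * c) * y = a * (c * x + d * y) - c * (a * x + b * y) by ring.
by rewrite h1 h2 !mulr0 subrr.
Qed.

Lemma cover_lin e p q (a b c d : F) : a * d - b * c != 0 -> cover e p q ->
  cover e (a *: p + b *: q) (c *: p + d *: q).
Proof.
move=> D [sp sq top nr].
have sz u w : (size (u *: p + w *: q)%R <= e.+1)%N.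
  apply: leq_trans (size_polyD _ _) _; rewrite geq_max.
  by rewrite (leq_trans (size_scale_leq _ _) sp) (leq_trans (size_scale_leq _ _) sq).
split => //.
  by rewrite !coefD !coefZ => h1 h2; have [/top h3 /h3] := det2_free D h1 h2.
by move=> x; rewrite !hornerD !hornerZ => h1 h2; have [/nr h3 /h3] := det2_free D h1 h2.
Qed.

Lemma cover_coprime e p q : cover e p q -> coprimep p q.
Proof.
move=> [_ _ _ nr]; apply: Pdiv.ClosedField.root_coprimep => x /rootP h; apply/eqP => h2; exact: nr h h2.
Qed.

Lemma coprime_cover p q : coprimep p q -> q != 0 -> cover (maxn (size p).-1 (size q).-1) p q.
Proof.
move=> cpq q0; have sq : (0 < size q)%N by rewrite size_poly_gt0.
set e := maxn _ _; have [e1 e2 e3] : [/\ (size p <= e.+1)%N, (size q <= e.+1)%N & e = (size p).-1 \/ e = (size q).-1].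
  by split; lia.
split => //.
  move=> pe qe; case: e3 => e3.
    have /eqP : lead_coef p = 0 by rewrite /lead_coef -e3.
    rewrite lead_coef_eq0 => /eqP p0; move: e2 e3; rewrite p0 size_poly0 /= => e2 e3.
    move: qe; rewrite (_ : e = (size q).-1); last by lia.
    by move/eqP; rewrite -/(lead_coef q) lead_coef_eq0 (negPf q0).
  by move: qe; rewrite e3 => /eqP; rewrite -/(lead_coef q) lead_coef_eq0 (negPf q0).
by move=> x px qx; have := coprimep_root cpq (introT rootP px); rewrite qx eqxx.
Qed.

(** Coprimality makes the two pairs proportional, and the degree is the larger
    of the two degrees of a pair. *)
Lemma cover_unique e e' p q P Q : cover e p q -> cover e' P Q -> q != 0 -> Q != 0 ->
  p * Q = P * q -> e = e' /\ exists2 u, u != 0 & p = u *: P /\ q = u *: Q.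
Proof.
move=> c C q0 Q0 h.
have [u u0 [pE qE]] := coprimep_proportional Q0 q0 (cover_coprime C) (cover_coprime c) h.
split; last by exists u.
case: c C => [sp sq top _] [sP sQ Top _].
have [lt|gt|//] := ltngtP e e'; exfalso.
  apply: Top; apply/eqP; [rewrite -(mulrI_eq0 _ (mulfI u0)) -coefZ -pE|rewrite -(mulrI_eq0 _ (mulfI u0)) -coefZ -qE];
    by rewrite nth_default // (leq_trans _ lt).
by apply: top; rewrite ?pE ?qE coefZ nth_default ?mulr0 // (leq_trans _ gt).
Qed.

(** A nonconstant covering attains all values, so that a form vanishing on its
    image vanishes. *)
Lemma hval_inj e r p X Z : (size p <= e.+1)%N -> cover r X Z -> (0 < r)%N ->
  (forall t, t != 0 -> hval e p X.[t] Z.[t] = 0) -> p = 0.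
Proof.
move=> sp [sX sZ top nr] r0 h; apply/eqP/negPn/negP => p0.
(* The value [t] of the covering is chosen so that it is attained at a finite
   nonzero point. *)
pose w (a b : F) : {poly F} := a%:P - b *: 'X.
have w0 (a b : F) : (a = 0 -> b = 0 -> False) -> w a b != 0.
  move=> ab; apply/eqP => wab; apply: ab.
    by have := congr1 (fun u : {poly F} => u`_0) wab; rewrite coefB coefC coefZ coefX coef0 mulr0 subr0.
  have := congr1 (fun u : {poly F} => u`_1) wab; rewrite coefB coefC coefZ coefX coef0 mulr1 sub0r /=.
  by move/eqP; rewrite oppr_eq0 => /eqP.
have wE (a b t : F) : (w a b).[t] = a - t * b.
  by rewrite hornerD hornerN hornerZ hornerC hornerX mulrC.
have [t] := poly_nonroot (mulf_neq0 p0 (mulf_neq0 (w0 _ _ top) (w0 _ _ (nr 0)))).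
rewrite !hornerM !mulf_eq0 !negb_or !wE => /andP[pt /andP[wt w1]].
have top' : (X - t *: Z)`_r != 0 by rewrite coefB coefZ.
have [x /rootP] : exists x, root (X - t *: Z) x.
  apply/closed_rootP; apply: contraNneq top' => s1.
  by rewrite nth_default // s1.
rewrite hornerD hornerN hornerZ => /eqP; rewrite subr_eq0 => /eqP xE.
have x0 : x != 0 by apply: contraNneq w1 => x0; move: xE; rewrite x0 => ->; rewrite subrr.
have [zx|zx] := eqVneq Z.[x] 0; first by apply: (nr x) => //; rewrite xE zx mulr0.
have := h x x0; rewrite hvalE // xE mulfK // => /eqP.
by rewrite mulf_eq0 expf_eq0 (negPf zx) andbF (negPf pt).
Qed.

Lemma cover_free e p q a b : cover e p q -> (0 < e)%N -> a *: p + b *: q = 0 -> a = 0 /\ b = 0.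
Proof.
move=> [sp sq top nr] e0 h.
have const u : (forall x, u.[x] = 0 -> False) -> u`_e = 0.
  move=> ux; have [s1|s1] := eqVneq (size u) 1; first by rewrite nth_default // s1.
  by have [x /rootP /ux] := closed_rootP u s1.
have ev x : a * p.[x] + b * q.[x] = 0 by rewrite -!hornerZ -hornerD h horner0.
have cf : a * p`_e + b * q`_e = 0 by rewrite -!coefZ -coefD h coef0.
have [a0|a0] := eqVneq a 0.
  split => //; apply/eqP/negPn/negP => b0; rewrite a0 in ev cf.
  have q0 x : q.[x] = 0 by apply: (mulfI b0); rewrite mulr0 -(ev x) mul0r add0r.
  have qe : q`_e = 0 by move: cf; rewrite mul0r add0r => cf; apply: (mulfI b0); rewrite mulr0.
  by apply: top => //; apply: const => x px; exact: nr px (q0 x).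
exfalso.
have pq x : q.[x] = 0 -> p.[x] = 0 by move=> qx; apply: (mulfI a0); rewrite mulr0 -(ev x) qx mulr0 addr0.
have qe : q`_e = 0 by apply: const => x qx; exact: nr (pq x qx) qx.
by apply: top => //; move: cf; rewrite qe mulr0 addr0 => cf; apply: (mulfI a0); rewrite mulr0.
Qed.

Lemma hvalM e f p q x z : (size p <= e.+1)%N -> (size q <= f.+1)%N ->
  hval (e + f) (p * q) x z = hval e p x z * hval f q x z.
Proof.
move=> sp sq; have [t s] := coef_top_mul sp sq.
have [->|z0] := eqVneq z 0; first by rewrite !hval_oo t exprD mulrACA.
by rewrite !hvalE // hornerM exprD mulrACA.
Qed.

Lemma hval_exp e p x z i : (size p <= e.+1)%N -> hval (e * i) (p ^+ i) x z = hval e p x z ^+ i.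
Proof.
move=> sp; elim: i => [|i IH].
  by rewrite muln0 !expr0 /hval big_ord_recl big_ord0 coef1 /= !expr0 !mulr1 addr0.
by rewrite mulnS exprS hvalM ?IH ?exprS //; have [] := coef_top_exp i sp.
Qed.

Lemma hvalXn e j x z : (j <= e)%N -> hval e 'X^j x z = x ^+ j * z ^+ (e - j).
Proof.
move=> je; have je' : (j < e.+1)%N by [].
rewrite /hval (bigD1 (Ordinal je')) //= coefXn eqxx mul1r big1 ?addr0 // => i ij.
rewrite coefXn; case: eqP => [ji|_]; last by rewrite mul0r.
by case/negP: ij; apply/eqP; exact: val_inj.
Qed.

Lemma hval_linear a b x z : hval 1 (a *: 'X + b%:P) x z = a * x + b * z.
Proof.
rewrite /hval big_ord_recl big_ord1 !coefD !coefZ !coefX !coefC /= subnn !expr0 !expr1.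
by rewrite mulr0 add0r mulr1 addr0 mul1r mulr1 addrC.
Qed.

Lemma cover_sym_pair r m A B : cover r A B ->
  cover (r * (2 * m)) (A ^+ (2 * m) + B ^+ (2 * m)) (A ^+ m * B ^+ m).
Proof.
move=> [sA sB top nr].
have [tA zA] := coef_top_exp (2 * m) sA; have [tB zB] := coef_top_exp (2 * m) sB.
have [tA1 zA1] := coef_top_exp m sA; have [tB1 zB1] := coef_top_exp m sB.
have [tAB zAB] := coef_top_mul zA1 zB1.
have key (x y : F) : x ^+ (2 * m) + y ^+ (2 * m) = 0 -> x ^+ m * y ^+ m = 0 -> x = 0 /\ y = 0.
  have [m0|m0] := posnP m.
    by rewrite m0 muln0 !expr0 => /eqP; rewrite (_ : 1 + 1 = 2%:R) // pnatr_eq0.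
  have m2 : (2 * m == 0)%N = false by apply/negbTE; lia.
  have z (u : F) : u ^+ (2 * m) = 0 -> u = 0 by move=> /eqP; rewrite expf_eq0 => /andP[_ /eqP].
  move=> h /eqP; rewrite mulf_eq0 !expf_eq0 m0 /= => /orP[/eqP e|/eqP e]; move: h; rewrite e expr0n m2.
    by rewrite add0r => /z.
  by rewrite addr0 => /z.
split.
- by apply: leq_trans (size_polyD _ _) _; rewrite geq_max zA zB.
- by apply: leq_trans zAB _; lia.
- rewrite coefD tA tB => h1; have -> : (r * (2 * m) = r * m + r * m)%N by lia.
  by rewrite tAB tA1 tB1 => /(key _ _ h1)[].
- move=> x; rewrite hornerD hornerM !horner_exp => h1 h2.
  by have [/nr h3 /h3] := key _ _ h1 h2.
Qed.

End Coverings.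

(** * Forms invariant under the dihedral group *)

Section KleinForms.
Variable F : numClosedFieldType.
Implicit Types (p q P Q X Z : {poly F}) (U V : F).

(** In terms of [T + 1 / T = U / V] and [s = (T - 1) / (T + 1)], the point [x]
    with [wmap v x = s ^ 2] is a Moebius function of [U / V], with these
    coefficients. *)
Definition place_mx v : (F * F) * (F * F) := match v with
  | Place0 => ((0, 4), (1, 2)) | Place1 => ((1, -2), (1, 2)) | Placeoo => ((1, -2), (0, -4)) end.
Definition xnum v U V := (place_mx v).1.1 * U + (place_mx v).1.2 * V.
Definition xden v U V := (place_mx v).2.1 * U + (place_mx v).2.2 * V.

Lemma place_mx_det v :
  (place_mx v).1.1 * (place_mx v).2.2 - (place_mx v).1.2 * (place_mx v).2.1 != 0.
Proof.
have h2 : 2 != 0 :> F by rewrite pnatr_eq0.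
have h4 : 4 != 0 :> F by rewrite pnatr_eq0.
case: v => /=.
- by rewrite mul0r sub0r mulr1 oppr_eq0.
- by rewrite (_ : 1 * 2 - -2 * 1 = 4) //; ring.
- by rewrite mulr0 subr0 mul1r oppr_eq0.
Qed.

Lemma place_value v (t r : F) : t != 0 -> t + 1 != 0 -> r != 0 ->
  let U := r * (t ^+ 2 + 1) in let V := r * t in
  xden v U V != 0 /\ xnum v U V / xden v U V = wmap v (((t - 1) / (t + 1)) ^+ 2).
Proof.
move=> t0 t1 r0 U V.
have h4 : 4 != 0 :> F by rewrite pnatr_eq0.
have dE : xden v U V = match v with Placeoo => - 4 * (r * t) | _ => r * (t + 1) ^+ 2 end.
  by rewrite /xden /U /V; case: v => /=; ring.
have d0 : xden v U V != 0.
  by rewrite dE; case: v {dE} => /=; rewrite !mulf_neq0 ?oppr_eq0 ?expf_neq0.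
split=> //; rewrite dE /xnum /U /V; case: v {dE d0} => /=.
- by field; rewrite t1 r0.
- by field; rewrite t1 r0.
- have -> : ((t - 1) / (t + 1)) ^+ 2 - 1 = - 4 * t / (t + 1) ^+ 2 by field.
  by field; rewrite t0 t1 r0 ?h4 ?oppr_eq0.
Qed.

Variables (v : place) (n m d : nat) (G : {poly F}).
Hypothesis m_gt0 : (0 < m)%N.
Hypothesis n_gt0 : (0 < n)%N.
Hypothesis G_size : size G = d.+1.
Hypothesis G_1 : G.[1] != 0.
Hypothesis G_common : forall s, G.[s] = 0 -> G.[- s] = 0 -> False.

(** With [s = (t^m - 1) / (t^m + 1)], the quotient [knum / kden] is [t^n G(s)
    / G(- s)], the quotient of the two explicit solutions in the coordinate [t
    = ((1 + s) / (1 - s))^(1 / m)]. *)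
Definition knum : {poly F} := 'X^n * hcomp d G ('X^m - 1) ('X^m + 1).
Definition kden : {poly F} := hcomp d G (1 - 'X^m) ('X^m + 1).
Local Notation D := (n + m * d)%N.

Lemma knumE t : knum.[t] = t ^+ n * hval d G (t ^+ m - 1) (t ^+ m + 1).
Proof. by rewrite hornerM horner_hcomp !(hornerD, hornerN, hornerXn, hornerC). Qed.

Lemma kdenE t : kden.[t] = hval d G (1 - t ^+ m) (t ^+ m + 1).
Proof. by rewrite horner_hcomp !(hornerD, hornerN, hornerXn, hornerC). Qed.

Lemma cover_klein : cover D knum kden.
Proof.
have sG : (size G <= d.+1)%N by rewrite G_size.
have h11 : hval d G 1 1 != 0 by rewrite hvalE ?oner_neq0 // expr1n mul1r divr1.
have s1 : (size ('X^m - 1 : {poly F})%R <= m.+1)%N.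
  by apply: leq_trans (size_polyD _ _) _; rewrite size_polyXn size_polyN size_poly1 geq_max leqnn.
have s2 : (size ('X^m + 1 : {poly F})%R <= m.+1)%N.
  by apply: leq_trans (size_polyD _ _) _; rewrite size_polyXn size_poly1 geq_max leqnn.
have s3 : (size (1 - 'X^m : {poly F})%R <= m.+1)%N by rewrite -opprB size_polyN.
have [t1 z1] := coef_top_hcomp d G s1 s2; have [t2 z2] := coef_top_hcomp d G s3 s2.
have xn : (size ('X^n : {poly F})%R <= n.+1)%N by rewrite size_polyXn.
have [t z] := coef_top_mul xn z1.
have c1 : ('X^m - 1 : {poly F})`_m = 1 by rewrite coefB coefXn coef1 eqxx gtn_eqF // subr0.
have c2 : ('X^m + 1 : {poly F})`_m = 1 by rewrite coefD coefXn coef1 eqxx gtn_eqF // addr0.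
split => //.
- by apply: leq_trans z2 _; rewrite ltnS leq_addl.
- move=> h _; move: h; rewrite t t1 c1 c2 coefXn eqxx mul1r => h.
  by rewrite h eqxx in h11.
- move=> x; rewrite knumE kdenE; have [->|x0] := eqVneq x 0.
    by move=> _; rewrite expr0n gtn_eqF //= subr0 add0r => h; rewrite h eqxx in h11.
  move=> /eqP; rewrite mulf_eq0 expf_eq0 (negPf x0) andbF /=.
  have [S1|S1] := eqVneq (x ^+ m + 1) 0.
    rewrite S1 hval_oo mulf_eq0 -/(lead_coef G) => /orP[|].
      rewrite (_ : G`_d = lead_coef G) ?lead_coef_eq0 -?size_poly_eq0 ?G_size //.
      by rewrite /lead_coef G_size.
    rewrite expf_eq0 => /andP[_]; rewrite (_ : x ^+ m - 1 = - 2).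
      by rewrite oppr_eq0 pnatr_eq0.
    by rewrite -[RHS](add0r) -S1; ring.
  rewrite !hvalE // mulf_eq0 expf_eq0 (negPf S1) andbF /= => /eqP h1 /eqP.
  rewrite mulf_eq0 expf_eq0 (negPf S1) andbF /= => /eqP h2.
  by apply: (G_common h1); rewrite -mulNr opprB.
Qed.

Lemma knum_zeta z t : z ^+ m = 1 -> knum.[z * t] = z ^+ n * knum.[t] /\ kden.[z * t] = kden.[t].
Proof. by move=> zm; rewrite !knumE !kdenE !exprMn zm mul1r mulrA. Qed.

Lemma knum_inv t : t != 0 ->
  kden.[t] = t ^+ D * knum.[t^-1] /\ knum.[t] = t ^+ D * kden.[t^-1].
Proof.
move=> t0; rewrite !knumE !kdenE exprD exprM !exprVn.
have tm : t ^+ m != 0 by rewrite expf_neq0.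
have -> : t ^+ n * (t ^+ m) ^+ d * ((t ^+ n)^-1 * hval d G ((t ^+ m)^-1 - 1) ((t ^+ m)^-1 + 1)) =
    (t ^+ m) ^+ d * hval d G ((t ^+ m)^-1 - 1) ((t ^+ m)^-1 + 1).
  have tn : t ^+ n != 0 by rewrite expf_neq0.
  by field.
rewrite -[_ * _ * hval _ _ _ _]mulrA -!hval_scale.
by split; [|congr (_ * _)]; congr hval; field.
Qed.

(** The point [x] as a function of degree [2 m] of the coordinate [t]. *)
Definition xpoly : {poly F} := (place_mx v).1.1 *: ('X^(2 * m) + 1) + (place_mx v).1.2 *: 'X^m.
Definition zpoly : {poly F} := (place_mx v).2.1 *: ('X^(2 * m) + 1) + (place_mx v).2.2 *: 'X^m.

Lemma xpolyE t : xpoly.[t] = xnum v (t ^+ (2 * m) + 1) (t ^+ m).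
Proof. by rewrite hornerD !hornerZ hornerD !hornerXn hornerC. Qed.

Lemma zpolyE t : zpoly.[t] = xden v (t ^+ (2 * m) + 1) (t ^+ m).
Proof. by rewrite hornerD !hornerZ hornerD !hornerXn hornerC. Qed.

Lemma cover_place : cover (2 * m) xpoly zpoly.
Proof.
apply: cover_lin; first exact: place_mx_det.
have cX : cover 1 ('X : {poly F}) 1.
  split; rewrite ?size_polyX ?size_poly1 ?coefX ?coef1 //=; first by move/eqP; rewrite oner_eq0.
  by move=> x _; rewrite hornerC => /eqP; rewrite oner_eq0.
by have := cover_sym_pair m cX; rewrite !expr1n mulr1 mul1n.
Qed.

Lemma place_zeta z t : z ^+ m = 1 -> xpoly.[z * t] = xpoly.[t] /\ zpoly.[z * t] = zpoly.[t].
Proof. by move=> zm; rewrite !xpolyE !zpolyE !exprMn mulnC !exprM zm expr1n !mul1r. Qed.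

Lemma place_inv t : t != 0 ->
  xpoly.[t] = t ^+ (2 * m) * xpoly.[t^-1] /\ zpoly.[t] = t ^+ (2 * m) * zpoly.[t^-1].
Proof.
move=> t0; have tm : t ^+ m != 0 by rewrite expf_neq0.
rewrite !xpolyE !zpolyE /xnum /xden mulnC !exprVn exprM.
by split; field.
Qed.

Variable zeta : F.
Hypothesis zeta_prim : m.-primitive_root zeta.
Hypothesis n_coprime_m : coprime n m.

(** The substitution [t |-> zeta t] multiplies [knum] by [zeta^n] and fixes
    [kden] and [x], so that only exponents divisible by [m] occur in [f]; [t
    |-> 1 / t] exchanges [knum] and [kden], which equates the two outer
    coefficients. *)
Lemma klein_form (f p : {poly F}) : (size f <= (2 * m).+1)%N ->
  (forall t, t != 0 -> hval (2 * m) f knum.[t] kden.[t] = hval D p xpoly.[t] zpoly.[t]) ->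
  forall a b, hval (2 * m) f a b = f`_0 * (a ^+ (2 * m) + b ^+ (2 * m)) + f`_m * (a ^+ m * b ^+ m).
Proof.
move=> sf h; have zm := prim_expr_order zeta_prim.
have z0 : zeta != 0 by apply/eqP => z0; move/eqP: zm; rewrite z0 expr0n gtn_eqF // eq_sym oner_eq0.
have D0 : (0 < D)%N by rewrite addn_gt0 n_gt0.
(* The form of [f] at [zeta^n] times its first argument, minus the form of [f]. *)
pose g := \poly_(i < (2 * m).+1) (f`_i * (zeta ^+ (n * i) - 1)).
have gE a b : hval (2 * m) g a b = hval (2 * m) f (zeta ^+ n * a) b - hval (2 * m) f a b.
  rewrite -sumrB; apply: eq_bigr => i _; rewrite coef_poly ltn_ord exprMn -exprM; ring.
have g0 : g = 0.
  apply: (hval_inj (size_poly _ _) cover_klein D0) => t t0; rewrite gE.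
  have [k1 k2] := knum_zeta t zm; have [x1 x2] := place_zeta t zm.
  have e1 := h (zeta * t) (mulf_neq0 z0 t0); rewrite k1 k2 x1 x2 in e1.
  by rewrite e1 (h t t0) subrr.
have f0 i : (i <= 2 * m)%N -> ~~ (m %| i)%N -> f`_i = 0.
  move=> im mi; have := congr1 (fun u : {poly F} => u`_i) g0.
  rewrite coef_poly ltnS im coef0 => /eqP; rewrite mulf_eq0 subr_eq0 => /orP[/eqP //|].
  by rewrite -(prim_order_dvd zeta_prim) Gauss_dvdr ?(negPf mi) // coprime_sym.
have m2 : (2 * m == 0)%N = false by apply/negbTE; lia.
have fE : f = f`_0 *: 1 + f`_m *: 'X^m + f`_(2 * m) *: 'X^(2 * m).
  apply/polyP => i; rewrite !coefD !coefZ coef1 !coefXn.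
  have [im|im] := leqP i (2 * m); last first.
    rewrite nth_default ?(leq_trans sf) //.
    by rewrite !gtn_eqF ?mulr0 ?addr0 //; lia.
  have [/dvdnP[j ij]|mi] := boolP (m %| i)%N; last first.
    rewrite f0 //; have -> : (i == 0)%N = false by apply/negbTE; apply: contra mi => /eqP ->.
    have -> : (i == m)%N = false by apply/negbTE; apply: contra mi => /eqP ->.
    have -> : (i == 2 * m)%N = false by apply/negbTE; apply: contra mi => /eqP ->; rewrite dvdn_mull.
    by rewrite !mulr0 !addr0.
  have : (j <= 2)%N by nia.
  case: j ij => [|[|[|//]]] -> _; rewrite ?mul0n ?mul1n ?eqxx.
  - by rewrite mulr1 eq_sym gtn_eqF // eq_sym m2 !mulr0 !addr0.
  - by rewrite gtn_eqF // mulr0 add0r mulr1 (_ : (m == 2 * m)%N = false) ?mulr0 ?addr0 //; apply/negbTE; lia.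
  - by rewrite m2 mulr0 add0r mulr1 (_ : (2 * m == m)%N = false) ?mulr0 ?add0r //; apply/negbTE; lia.
have hf a b : hval (2 * m) f a b = f`_0 * b ^+ (2 * m) + f`_m * (a ^+ m * b ^+ m) + f`_(2 * m) * a ^+ (2 * m).
  have m1 : (m <= 2 * m)%N by lia.
  have mm : (2 * m - m = m)%N by lia.
  have h1 : hval (2 * m) 1 a b = b ^+ (2 * m) by rewrite -(expr0 'X) hvalXn // expr0 subn0 mul1r.
  rewrite {1}fE !hvalD !hvalZ h1 (hvalXn _ _ m1) (hvalXn _ _ (leqnn _)) subnn mm expr0 mulr1.
  by [].
(* The difference of [f] and the form with its arguments exchanged. *)
pose q : {poly F} := (f`_0 - f`_(2 * m)) *: ('X^(2 * m) + (-1) *: 'X^0).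
have q0 : q = 0.
  have sq : (size q <= (2 * m).+1)%N.
    apply: leq_trans (size_scale_leq _ _) _; apply: leq_trans (size_polyD _ _) _.
    rewrite geq_max size_polyXn leqnn (leq_trans (size_scale_leq _ _)) // size_polyXn //.
  apply: (hval_inj sq cover_klein D0) => t t0.
  rewrite hvalZ hvalD hvalZ !hvalXn // subnn subn0 !expr0 mulr1 mul1r.
  have tD : t^-1 != 0 by rewrite invr_eq0.
  have e1 := h t t0; have e2 := h _ tD.
  have [k1 k2] := knum_inv t0; have [x1 x2] := place_inv t0.
  have e3 : hval (2 * m) f kden.[t] knum.[t] = hval (2 * m) f knum.[t] kden.[t].
    rewrite e1 [in LHS]k1 [in LHS]k2 x1 x2 !hval_scale e2; congr (_ * _).
    by rewrite -!exprM mulnC.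
  move: e3; rewrite !hf => e3.
  transitivity ((f`_0 * knum.[t] ^+ (2 * m) + f`_m * (kden.[t] ^+ m * knum.[t] ^+ m) + f`_(2 * m) * kden.[t] ^+ (2 * m))
    - (f`_0 * kden.[t] ^+ (2 * m) + f`_m * (knum.[t] ^+ m * kden.[t] ^+ m) + f`_(2 * m) * knum.[t] ^+ (2 * m))).
    by ring.
  by rewrite e3 subrr.
move=> a b; rewrite hf; have := congr1 (fun u : {poly F} => u`_(2 * m)) q0.
rewrite coefZ coefD coefZ !coefXn eqxx m2 mulr0 addr0 mulr1 coef0 => /eqP; rewrite subr_eq0 => /eqP <-.
by ring.
Qed.

(** For [f = knum / kden], the quotient of the two is [f^m + f^(- m)], which
    is invariant under the dihedral group acting on [f]. *)
Definition klein_invariants (t : F) : F * F :=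
  (knum.[t] ^+ (2 * m) + kden.[t] ^+ (2 * m), knum.[t] ^+ m * kden.[t] ^+ m).

Definition moebius_of_invariants e (p q : {poly F}) (a b g h : F) : Prop :=
  a * h - b * g != 0 /\ forall t,
    hval e p xpoly.[t] zpoly.[t] = a * (klein_invariants t).1 + b * (klein_invariants t).2 /\
    hval e q xpoly.[t] zpoly.[t] = g * (klein_invariants t).1 + h * (klein_invariants t).2.

Lemma hval_free e (p q : {poly F}) x y : cover e p q -> (0 < e)%N ->
  (forall t, x * hval e p xpoly.[t] zpoly.[t] + y * hval e q xpoly.[t] zpoly.[t] = 0) ->
  x = 0 /\ y = 0.
Proof.
move=> c e0 h; apply: (cover_free c e0); have [sp sq _ _] := c.
have s : (size (x *: p + y *: q)%R <= e.+1)%N.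
  apply: leq_trans (size_polyD _ _) _; rewrite geq_max.
  by rewrite (leq_trans (size_scale_leq _ _) sp) (leq_trans (size_scale_leq _ _) sq).
have m2 : (0 < 2 * m)%N by lia.
by apply: (hval_inj s cover_place m2) => t _; rewrite hvalD !hvalZ.
Qed.

(** Both sides of the relation are the same function of [t] in lowest terms,
    of degree [2 m e] on the left and [2 m D] on the right. The forms on the
    right are then invariant under the symmetries of [x], so that they are
    combinations of the two invariants. *)
Lemma klein_degree v0 e (p q : {poly F}) (a b g h : F) :
  a * h - b * g != 0 -> cover e p q -> q != 0 -> (0 < e)%N ->
  (forall t, let A := a * knum.[t] + b * kden.[t] in let B := g * knum.[t] + h * kden.[t] in
     let U := A ^+ (2 * m) + B ^+ (2 * m) in let V := A ^+ m * B ^+ m in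
     hval e p xpoly.[t] zpoly.[t] * xden v0 U V = hval e q xpoly.[t] zpoly.[t] * xnum v0 U V) ->
  e = D /\ exists a' b' g' h', moebius_of_invariants e p q a' b' g' h'.
Proof.
move=> det cpq q0 e0 rel; have [sp sq _ _] := cpq.
have m2 : (0 < 2 * m)%N by lia.
pose A := a *: knum + b *: kden; pose B := g *: knum + h *: kden.
pose U := A ^+ (2 * m) + B ^+ (2 * m); pose V := A ^+ m * B ^+ m.
have cUV := cover_sym_pair m (cover_lin det cover_klein); rewrite -/A -/B -/U -/V in cUV.
have cz := cover_lin (place_mx_det v0) cUV.
set Pz := _ *: U + _ *: V in cz; set Qz := _ *: U + _ *: V in cz.
have cP := cover_comp cpq cover_place.
set P := hcomp e p _ _ in cP; set Q := hcomp e q _ _ in cP.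
have PzE t : Pz.[t] = xnum v0 U.[t] V.[t] by rewrite hornerD !hornerZ.
have QzE t : Qz.[t] = xden v0 U.[t] V.[t] by rewrite hornerD !hornerZ.
have UE t : U.[t] = (a * knum.[t] + b * kden.[t]) ^+ (2 * m) + (g * knum.[t] + h * kden.[t]) ^+ (2 * m).
  by rewrite hornerD !horner_exp !hornerD !hornerZ.
have VE t : V.[t] = (a * knum.[t] + b * kden.[t]) ^+ m * (g * knum.[t] + h * kden.[t]) ^+ m.
  by rewrite hornerM !horner_exp !hornerD !hornerZ.
have PQ : P * Qz = Pz * Q.
  apply/eqP; rewrite -subr_eq0; apply/eqP/horner_eq0 => t.
  rewrite hornerD hornerN !hornerM !horner_hcomp PzE QzE UE VE.
  by have /= -> := rel t; rewrite [in X in _ - X]mulrC subrr.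
have Q0 : Q != 0.
  apply: contra_neq q0 => Q0; apply: (hval_inj sq cover_place m2) => t _.
  by rewrite -horner_hcomp -/Q Q0 horner0.
have Qz0 : Qz != 0.
  apply/eqP => z0; move/eqP: PQ; rewrite z0 mulr0 eq_sym mulf_eq0 (negPf Q0) orbF => /eqP p0.
  by have [_ _ _ nr] := cz; apply: (nr 0); rewrite ?p0 ?z0 horner0.
have [eE [u u0 [Pu Qu]]] := cover_unique cP cz Q0 Qz0 PQ.
have eD : e = D by apply/eqP; rewrite -(eqn_pmul2l m2) eE mulnC.
split => //.
have sX (x y : F) : (size (x *: 'X + y%:P)%R <= 2)%N.
  apply: leq_trans (size_polyD _ _) _; rewrite geq_max.
  by rewrite (leq_trans (size_scale_leq _ _)) ?size_polyX // (leq_trans (size_polyC_leq1 _)).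
pose fA := a *: 'X + b%:P; pose fB := g *: 'X + h%:P.
pose Fu : {poly F} := fA ^+ (2 * m) + fB ^+ (2 * m); pose Fv : {poly F} := fA ^+ m * fB ^+ m.
have [_ zA] := coef_top_exp (2 * m) (sX a b); have [_ zB] := coef_top_exp (2 * m) (sX g h).
have [_ zA1] := coef_top_exp m (sX a b); have [_ zB1] := coef_top_exp m (sX g h).
have [_ zAB] := coef_top_mul zA1 zB1.
rewrite !mul1n in zA zB zA1 zB1 zAB.
have mm : (2 * m = m + m)%N by lia.
have hlin (a1 b1 x y : F) i : hval i ((a1 *: 'X + b1%:P) ^+ i) x y = (a1 * x + b1 * y) ^+ i.
  by have := hval_exp x y i (sX a1 b1); rewrite mul1n hval_linear.
have FuE x y : hval (2 * m) Fu x y = (a * x + b * y) ^+ (2 * m) + (g * x + h * y) ^+ (2 * m).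
  by rewrite hvalD !hlin.
have FvE x y : hval (2 * m) Fv x y = (a * x + b * y) ^+ m * (g * x + h * y) ^+ m.
  by rewrite [X in hval X]mm hvalM // !hlin.
pose form x y := u *: (x *: Fu + y *: Fv).
have sform x y : (size (form x y) <= (2 * m).+1)%N.
  apply: leq_trans (size_scale_leq _ _) _; apply: leq_trans (size_polyD _ _) _.
  rewrite geq_max !(leq_trans (size_scale_leq _ _)) //; first by rewrite mm.
  by apply: leq_trans (size_polyD _ _) _; rewrite geq_max zA.
have formE x y t : hval (2 * m) (form x y) knum.[t] kden.[t] = u * (x * U.[t] + y * V.[t]).
  by rewrite hvalZ hvalD !hvalZ FuE FvE UE VE.
pose fP := form (place_mx v0).1.1 (place_mx v0).1.2.
pose fQ := form (place_mx v0).2.1 (place_mx v0).2.2.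
have hP t : hval (2 * m) fP knum.[t] kden.[t] = hval D p xpoly.[t] zpoly.[t].
  by rewrite formE -eD -horner_hcomp -/P Pu hornerZ PzE.
have hQ t : hval (2 * m) fQ knum.[t] kden.[t] = hval D q xpoly.[t] zpoly.[t].
  by rewrite formE -eD -horner_hcomp -/Q Qu hornerZ QzE.
have kP := klein_form (sform _ _) (fun t _ => hP t).
have kQ := klein_form (sform _ _) (fun t _ => hQ t).
exists fP`_0, fP`_m, fQ`_0, fQ`_m.
have hPI t : hval e p xpoly.[t] zpoly.[t] = fP`_0 * (klein_invariants t).1 + fP`_m * (klein_invariants t).2.
  by rewrite eD -hP kP.
have hQI t : hval e q xpoly.[t] zpoly.[t] = fQ`_0 * (klein_invariants t).1 + fQ`_m * (klein_invariants t).2.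
  by rewrite eD -hQ kQ.
split=> //; move: hPI hQI; move: fP`_0 fP`_m fQ`_0 fQ`_m => a1 b1 g1 h1 hPI hQI.
apply/eqP => det0; have free x y := @hval_free e p q x y cpq e0.
have [g10 a10] : g1 = 0 /\ - a1 = 0.
  apply: free => t; rewrite hPI hQI; transitivity (- (a1 * h1 - b1 * g1) * (klein_invariants t).2); first by ring.
  by rewrite det0 oppr0 mul0r.
have [h10 b10] : h1 = 0 /\ - b1 = 0.
  apply: free => t; rewrite hPI hQI; transitivity ((a1 * h1 - b1 * g1) * (klein_invariants t).1); first by ring.
  by rewrite det0 mul0r.
have [] : (1 : F) = 0 /\ (0 : F) = 0; last by move/eqP; rewrite oner_eq0.
apply: free => t; rewrite hPI; move/eqP: a10; move/eqP: b10; rewrite !oppr_eq0 => /eqP -> /eqP ->.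
by rewrite !mul0r !addr0 mul1r.
Qed.

(** Two Moebius functions of the same invariants are Moebius functions of each
    other. *)
Lemma klein_unique e (p q p' q' : {poly F}) (a b g h a' b' g' h' : F) :
  (size p <= e.+1)%N -> (size q <= e.+1)%N -> (size p' <= e.+1)%N -> (size q' <= e.+1)%N ->
  moebius_of_invariants e p q a b g h -> moebius_of_invariants e p' q' a' b' g' h' ->
  exists x y z w, [/\ x * w - y * z != 0, p' = x *: p + y *: q & q' = z *: p + w *: q].
Proof.
move=> sp sq sp' sq' [det rel] [det' rel'].
have m2 : (0 < 2 * m)%N by lia.
have sD x y : (size (x *: p + y *: q)%R <= e.+1)%N.
  apply: leq_trans (size_polyD _ _) _; rewrite geq_max.
  by rewrite (leq_trans (size_scale_leq _ _) sp) (leq_trans (size_scale_leq _ _) sq).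
have inj (u w : {poly F}) : (size u <= e.+1)%N -> (size w <= e.+1)%N ->
    (forall t, hval e u xpoly.[t] zpoly.[t] = hval e w xpoly.[t] zpoly.[t]) -> u = w.
  move=> su sw uw; apply/eqP; rewrite -subr_eq0 -scaleN1r; apply/eqP.
  have s : (size (u + -1 *: w)%R <= e.+1)%N.
    by apply: leq_trans (size_polyD _ _) _; rewrite geq_max su (leq_trans (size_scale_leq _ _) sw).
  by apply: (hval_inj s cover_place m2) => t _; rewrite hvalD hvalZ uw mulN1r subrr.
pose dt := a * h - b * g.
exists ((a' * h - b' * g) / dt), ((b' * a - a' * b) / dt), ((g' * h - h' * g) / dt), ((h' * a - g' * b) / dt).
split.
- rewrite (_ : _ - _ = (a' * h' - b' * g') / dt) ?mulf_neq0 ?invr_eq0 //; rewrite /dt; field => //.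
- apply: (inj _ _ sp' (sD _ _)) => t; rewrite hvalD !hvalZ.
  by have [-> ->] := rel t; have [-> _] := rel' t; rewrite /dt; field.
- apply: (inj _ _ sq' (sD _ _)) => t; rewrite hvalD !hvalZ.
  by have [-> ->] := rel t; have [_ ->] := rel' t; rewrite /dt; field.
Qed.

End KleinForms.

(** * The relation imposed by a pull-back transformation *)

Section PullbackRelation.
Variable R : realType.
Local Notation C := R[i].
Local Open Scope classical_set_scope.
Local Open Scope ring_scope.
Local Open Scope complex_scope.

(** An arc gives infinitely many roots, distinct because [g] inverts [t]. *)
Lemma poly_near0 (W : {poly C}) (t g : C -> C) (x0 : C) :
  (\forall x \near (x0 : C^o), W.[t x] = 0 /\ g (t x) = x) -> W = 0.
Proof.
move=> /near_modulusP[r r0 hr]; apply/eqP/negPn/negP => W0.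
pose u (j : nat) : C := x0 + (r / (j.+2)%:R)%:C.
have hu j : W.[t (u j)] = 0 /\ g (t (u j)) = u j.
  apply: hr; rewrite /u addrAC subrr add0r modulusR.
  have j0 : 0 < (j.+2)%:R :> R by rewrite ltr0n.
  rewrite gtr0_norm ?divr_gt0 // ltr_pdivrMr // -[X in X < _]mulr1 ltr_pM2l //.
  by rewrite ltr1n.
have uinj : injective u.
  move=> i j /addrI /(congr1 (@complex.Re R)) /= /(mulfI (lt0r_neq0 r0)) /invr_inj /eqP.
  by rewrite eqr_nat => /eqP[].
have := @max_poly_roots _ W [seq t (u j) | j <- iota 0 (size W)] W0.
rewrite size_map size_iota ltnn => H; apply: notF; apply: H.
  by apply/allP => _ /mapP[j _ ->]; apply/rootP; exact: (hu j).1.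
rewrite map_inj_uniq ?iota_uniq // => i j /(congr1 g).
by rewrite (hu i).2 (hu j).2 => /uinj.
Qed.

(** The common factor drops out of the quotient of the two solutions, which
    becomes a rational function of [t]. *)
Lemma sol_klein v k l m n G (H : hypergeometric_eq R) (d : germs R) (x : C) :
  dihedral_eq v k l m n G H -> germ_eqs v d x ->
  let t := cexp (gU d x / m%:R) in
  [/\ t ^+ m != 0, t ^+ m + 1 != 0, wmap v x = ((t ^+ m - 1) / (t ^+ m + 1)) ^+ 2 &
    exists2 c, c != 0 & sol v k m n G H d 0 x = c * (knum n m (k + l) G).[t] /\
                        sol v k m n G H d 1 x = c * (kden m (k + l) G).[t]].
Proof.
move=> HD ex t; have [x0 x1 s0 sp sm] := germ_eqs_regular ex; have [_ _ es eU] := ex.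
have mn0 : m%:R != 0 :> C by rewrite pnatr_eq0 -lt0n (de_m_gt0 HD).
have tm : t ^+ m = (1 + gs d x) / (1 - gs d x).
  by rewrite -cexpMn mulrC divfK // -eU mulfK.
have h2 : 2 != 0 :> C by rewrite pnatr_eq0.
have tp : t ^+ m + 1 = 2 / (1 - gs d x) by rewrite tm; field.
have tp0 : t ^+ m + 1 != 0 by rewrite tp mulf_neq0 // invr_neq0.
have sE : (t ^+ m - 1) / (t ^+ m + 1) = gs d x by rewrite tp tm; field; rewrite ?h2 sm.
split => //; [by rewrite tm mulf_neq0 // invr_neq0|by rewrite sE es|].
have sG : (size G <= (k + l).+1)%N by rewrite (klein_poly_size (de_ode HD) (de_N1 HD) (de_nonnat HD)).
rewrite knumE kdenE !hvalE // sE -(opprB (t ^+ m)) mulNr sE.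
set T := (t ^+ m + 1) ^+ (k + l).
have T0 : T != 0 by rewrite expf_neq0.
set al := expo0 v k%:R (1 - paramC H) (paramC H - paramA H - paramB H).
set be := expo1 v k%:R (1 - paramC H) (paramC H - paramA H - paramB H).
exists (cexp (al * gL0 d x + be * gL1 d x - n%:R / m%:R / 2 * gU d x) / T).
  by rewrite mulf_neq0 ?cexp_neq0 // invr_neq0.
have tn : t ^+ n = cexp (n%:R / m%:R * gU d x) by rewrite -cexpMn; congr cexp; field.
split; rewrite /sol /= /sol1 /prefactor -/al -/be.
  rewrite tn; have -> : al * gL0 d x + be * gL1 d x + n%:R / m%:R / 2 * gU d x =
    (al * gL0 d x + be * gL1 d x - n%:R / m%:R / 2 * gU d x) + n%:R / m%:R * gU d x by field.
  by rewrite (cexpD (_ - _)); field.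
by rewrite /= mulrN; field.
Qed.

Lemma ratfun_degree_cover (phi : {fraction {poly C}}) :
  cover (ratfun_degree phi) (ratfun_num phi) (ratfun_den phi).
Proof. by have [d0 c _] := ratfun_fracE phi; exact: coprime_cover. Qed.

Lemma hol_ratfun (phi : {fraction {poly C}}) (x : C) : (ratfun_den phi).[x] != 0 ->
  hol (ratfun_eval phi) x.
Proof. by move=> dx; apply: hol_div => //; apply: hol_poly; exact: hol_id. Qed.

Variables (H0 H1 : hypergeometric_eq R) (phi : {fraction {poly C}}).
Hypothesis phi_pullback : pullback_transformation H0 H1 phi.
Local Notation p := (ratfun_num phi).
Local Notation q := (ratfun_den phi).

(** Outside the roots of a nonzero polynomial every function involved is
    regular and nonzero, and branches of the powers exist. *)
Lemma generic_pullback : exists (x0 : C) (theta : C -> C),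
  [/\ x0 != 0, x0 != 1, q.[x0] != 0, ratfun_eval phi x0 != 0 & ratfun_eval phi x0 != 1] /\
  ((\forall x \near (x0 : C^o), theta x != 0) /\
   forall y : C -> C, solves_near H0 (ratfun_eval phi x0) y ->
     solves_near H1 x0 (fun x => theta x * y (ratfun_eval phi x))).
Proof.
have [deg [N [r [a [r0 pb]]]]] := phi_pullback.
have [q0 cpq _] := ratfun_fracE phi; have cov := ratfun_degree_cover phi.
have p0 : p != 0.
  apply/eqP => p0; have [] := @cover_free _ _ p q 1 0 cov deg; last by move/eqP; rewrite oner_eq0.
  by rewrite p0 scaler0 scale0r addr0.
have pq : p - q != 0.
  apply/eqP => pq; have [] := @cover_free _ _ p q 1 (-1) cov deg; last by move/eqP; rewrite oner_eq0.
  by rewrite scale1r scaleN1r.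
pose bad : {poly C} := 'X * (1 - 'X) * q * p * (p - q) * \prod_i (ratfun_num (r i) * ratfun_den (r i)).
have [x0] : exists x, bad.[x] != 0.
  apply: poly_nonroot; apply: mulf_neq0.
    rewrite !mulf_neq0 ?polyX_eq0 // -size_poly_eq0 -opprB size_polyN size_XsubC //.
  apply/prodf_neq0 => i _; have [d0 _ rE] := ratfun_fracE (r i).
  by rewrite mulf_neq0 //; apply: contra_neq (r0 i) => n0; rewrite rE n0 tofrac0 mul0r.
rewrite !hornerM !mulf_eq0 !negb_or => /andP[/andP[/andP[/andP[/andP[x00 x01] qx] px] pqx] rx].
rewrite hornerX in x00; rewrite hornerD hornerN hornerX hornerC subr_eq0 eq_sym in x01.
rewrite hornerD hornerN subr_eq0 in pqx.
have rx' i : (ratfun_num (r i)).[x0] != 0 /\ (ratfun_den (r i)).[x0] != 0.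
  rewrite horner_prod in rx; move/prodf_neq0: rx => /(_ i isT).
  by rewrite hornerM mulf_eq0 negb_or => /andP[].
have z0 : ratfun_eval phi x0 != 0 by rewrite mulf_neq0 // invr_neq0.
have z1 : ratfun_eval phi x0 != 1.
  by apply: contra_neq pqx => h; rewrite -[LHS](divfK qx) -/(ratfun_eval phi x0) h mul1r.
have ri i : ratfun_eval (r i) x0 != 0 by have [h1 h2] := rx' i; rewrite mulf_neq0 // invr_neq0.
pose L i := loclog (ratfun_eval (r i)) (sval (cid (cexp_onto (ri i)))) x0.
have hL i : hol (L i) x0 by apply: hol_loclog (ri i); apply: hol_ratfun; exact: (rx' i).2.
have eL i : \forall x \near (x0 : C^o), cexp (L i x) = ratfun_eval (r i) x.
  apply: cexp_loclog => //; first by apply: hol_ratfun; exact: (rx' i).2.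
  exact: (svalP (cid (cexp_onto (ri i)))).
exists x0, (fun x => \prod_i cexp (a i * L i x)); split=> //; split.
  by apply: filterE => x; apply/prodf_neq0 => i _; exact: cexp_neq0.
move=> y hy; apply: (pb x0 x00 x01 qx z0 z1 y) => //.
exists L; split; last exact: filterE.
move=> i; apply: filterS2 (hL i) (eL i) => x [dd hd] hx; split => //.
by case: hd.
Qed.

Variables (v v0 : place) (k l m n : nat) (G : {poly C}).
Hypothesis HD : dihedral_eq v k l m n G H1.
Hypothesis HD0 : dihedral_eq v0 0 0 m 1 1 H0.
Local Notation knum := (knum n m (k + l) G).
Local Notation kden := (kden m (k + l) G).
Local Notation xpoly := (xpoly C v m).
Local Notation zpoly := (zpoly C v m).
Local Notation e := (ratfun_degree phi).

(** The pulled back solutions of [H0] are combinations of those of [H1], so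
    that the quotient of the former is a Moebius function [A / B] of [knum /
    kden]. Its [m]-th power [T] determines [phi] through [T + 1 / T]. *)
Theorem pullback_relation : exists a b g h : C, a * h - b * g != 0 /\
  forall t, let A := a * knum.[t] + b * kden.[t] in let B := g * knum.[t] + h * kden.[t] in
     let U := A ^+ (2 * m) + B ^+ (2 * m) in let V := A ^+ m * B ^+ m in
     hval e p xpoly.[t] zpoly.[t] * xden v0 U V = hval e q xpoly.[t] zpoly.[t] * xnum v0 U V.
Proof.
have m0 := de_m_gt0 HD.
have cov := ratfun_degree_cover phi; have [sp sq _ _] := cov.
have [x0 [theta [[x00 x01 qx z0 z1] [th pb]]]] := generic_pullback.
have [d hd] := germs_exist v x00 x01; have [d0 hd0] := germs_exist v0 z0 z1.
have hfun := sol_fundamental HD hd; have [hsol0 _] := sol_fundamental HD0 hd0.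
have [c0 hc0] := fundamental_span x00 x01 hfun (pb _ (hsol0 0)).
have [c1 hc1] := fundamental_span x00 x01 hfun (pb _ (hsol0 1)).
have hphi := hol_ratfun qx.
have ed : \forall x \near (x0 : C^o), germ_eqs v d x by case: hd.
have ed0 : \forall x \near (x0 : C^o), germ_eqs v0 d0 (ratfun_eval phi x).
  by case: hd0 => _ h; exact: hol_continuous hphi _ h.
have qn : \forall x \near (x0 : C^o), q.[x] != 0.
  have hq : hol (fun x => q.[x]) x0 by apply: hol_poly; exact: hol_id.
  exact: near_neq0 (hol_continuous hq) qx.
pose t x := cexp (gU d x / m%:R); pose t0 x := cexp (gU d0 (ratfun_eval phi x) / m%:R).
pose A x := c0 0 * knum.[t x] + c0 1 * kden.[t x].
pose B x := c1 0 * knum.[t x] + c1 1 * kden.[t x].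
have key : \forall x \near (x0 : C^o), exists2 c, c != 0 & A x = c * t0 x /\ B x = c.
  move: (near_and ed ed0) (near_and hc0 hc1) th; apply: filterS3 => x [ex ex0] [h0 h1] thx.
  have [_ _ _ [b b0 [y0 y1]]] := sol_klein HD ex.
  have [_ _ _ [b' b0' [w0 w1]]] := sol_klein HD0 ex0.
  rewrite !sum2 y0 y1 w0 in h0; rewrite !sum2 y0 y1 w1 in h1.
  rewrite knumE expr1 /hval !big_ord1 coef1 !expr0 !mulr1 in h0.
  rewrite kdenE /hval big_ord1 coef1 !expr0 !mulr1 in h1.
  exists (theta x * b' / b); first by rewrite !mulf_neq0 // invr_neq0.
  split; apply: (mulfI b0); rewrite /A /B mulrDr.
    by transitivity (theta x * (b' * t0 x)); [rewrite [RHS]h0; ring|field].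
  by transitivity (theta x * b'); [rewrite [RHS]h1; ring|field].
have zE : \forall x \near (x0 : C^o), t0 x ^+ m != 0 /\ t0 x ^+ m + 1 != 0 /\
    ratfun_eval phi x = wmap v0 (((t0 x ^+ m - 1) / (t0 x ^+ m + 1)) ^+ 2).
  apply: filterS ed0 => x ex0; have [h1 h2 h3 _] := sol_klein HD0 ex0.
  by split => //; split => //; rewrite -h3 wmapK //; have [] := germ_eqs_regular ex0.
have xE : \forall x \near (x0 : C^o), zpoly.[t x] != 0 /\ xpoly.[t x] / zpoly.[t x] = x.
  apply: filterS ed => x ex; have [h1 h2 h3 _] := sol_klein HD ex.
  have [] := place_value v h1 h2 (oner_neq0 _); rewrite !mul1r -h3 wmapK; last by have [] := germ_eqs_regular ex.
  by rewrite xpolyE zpolyE mulnC exprM.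
exists (c0 0), (c0 1), (c1 0), (c1 1); split.
  apply/eqP => det.
  (* Otherwise the quotient [A / B] and with it [phi] would be constant. *)
  have tc : exists c, \forall x \near (x0 : C^o), t0 x = c.
    have [g0|g0] := eqVneq (c1 0) 0.
      have h0 : c1 1 != 0.
        have [c cn [_ hB]] := nbhs_singleton key; apply: contra_neq cn => h0.
        by rewrite -hB /B g0 h0 !mul0r addr0.
      exists (c0 1 / c1 1); apply: filterS key => x [c cn [hA hB]].
      apply: (mulfI (mulf_neq0 cn h0)); transitivity (c1 1 * A x); first by rewrite hA; ring.
      transitivity (c0 1 * B x); last by rewrite hB; field.
      apply/eqP; rewrite -subr_eq0 /A /B; apply/eqP.
      by transitivity ((c0 0 * c1 1 - c0 1 * c1 0) * knum.[t x]); [ring|rewrite det mul0r].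
    exists (c0 0 / c1 0); apply: filterS key => x [c cn [hA hB]].
    apply: (mulfI (mulf_neq0 cn g0)); transitivity (c1 0 * A x); first by rewrite hA; ring.
    transitivity (c0 0 * B x); last by rewrite hB; field.
    apply/eqP; rewrite -subr_eq0 /A /B; apply/eqP.
    by transitivity (- (c0 0 * c1 1 - c0 1 * c1 0) * kden.[t x]); [ring|rewrite det oppr0 mul0r].
  have [c hc] := tc; pose z := wmap v0 (((c ^+ m - 1) / (c ^+ m + 1)) ^+ 2).
  have pz : p + (- z) *: q = 0.
    apply: (@poly_near0 _ id id x0); move: qn hc zE; apply: filterS3 => x qx' tx [_ [_ ex]]; split => //.
    rewrite tx -/z in ex; rewrite hornerD hornerZ mulNr; apply/eqP; rewrite subr_eq0; apply/eqP.
    by rewrite -ex divfK.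
  have deg : (0 < e)%N by case: phi_pullback.
  have [] := @cover_free _ _ p q 1 (- z) cov deg; last by move/eqP; rewrite oner_eq0.
  by rewrite scale1r.
pose PA : {poly C} := c0 0 *: knum + c0 1 *: kden; pose PB : {poly C} := c1 0 *: knum + c1 1 *: kden.
pose PU := PA ^+ (2 * m) + PB ^+ (2 * m); pose PV := PA ^+ m * PB ^+ m.
pose W := hcomp e p xpoly zpoly * ((place_mx C v0).2.1 *: PU + (place_mx C v0).2.2 *: PV) -
          hcomp e q xpoly zpoly * ((place_mx C v0).1.1 *: PU + (place_mx C v0).1.2 *: PV).
have WE u : W.[u] = let A := c0 0 * knum.[u] + c0 1 * kden.[u] in let B := c1 0 * knum.[u] + c1 1 * kden.[u] in
     let U := A ^+ (2 * m) + B ^+ (2 * m) in let V := A ^+ m * B ^+ m in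
     hval e p xpoly.[u] zpoly.[u] * xden v0 U V - hval e q xpoly.[u] zpoly.[u] * xnum v0 U V.
  have UE : PU.[u] = (c0 0 * knum.[u] + c0 1 * kden.[u]) ^+ (2 * m) + (c1 0 * knum.[u] + c1 1 * kden.[u]) ^+ (2 * m).
    by rewrite hornerD !horner_exp !hornerD !hornerZ.
  have VE : PV.[u] = (c0 0 * knum.[u] + c0 1 * kden.[u]) ^+ m * (c1 0 * knum.[u] + c1 1 * kden.[u]) ^+ m.
    by rewrite hornerM !horner_exp !hornerD !hornerZ.
  have lin (a b : C) : (a *: PU + b *: PV).[u] = a * PU.[u] + b * PV.[u] by rewrite hornerD !hornerZ.
  have split (P Q P' Q' : {poly C}) : (P * P' - Q * Q').[u] = P.[u] * P'.[u] - Q.[u] * Q'.[u].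
    by rewrite hornerD hornerN !hornerM.
  by rewrite split !lin (horner_hcomp e p) (horner_hcomp e q) UE VE.
suff W0 : W = 0.
  move=> u; have := WE u; rewrite W0 horner0 => /esym h.
  by apply/eqP; rewrite -subr_eq0; apply/eqP; exact: h.
apply: (@poly_near0 _ t (fun u => xpoly.[u] / zpoly.[u]) x0).
move: (near_and xE qn) zE key; apply: filterS3 => x [[zx xx] qx'] [T0 [T1 zz]] [c cn [hA hB]].
split => //; rewrite WE -/(A x) -/(B x) hA hB.
have r0 : c ^+ (2 * m) != 0 by rewrite expf_neq0.
have := place_value v0 T0 T1 r0; cbv zeta; rewrite -zz.
have -> : c ^+ (2 * m) * ((t0 x ^+ m) ^+ 2 + 1) = (c * t0 x) ^+ (2 * m) + c ^+ (2 * m).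
  by rewrite [in RHS]exprMn (mulnC 2 m) (exprM (t0 x)); ring.
have -> : c ^+ (2 * m) * t0 x ^+ m = (c * t0 x) ^+ m * c ^+ m.
  by rewrite [in RHS]exprMn mul2n -addnn exprD; ring.
set U := (c * t0 x) ^+ (2 * m) + c ^+ (2 * m); set V := (c * t0 x) ^+ m * c ^+ m => -[dn0 zq].
have dq : xnum v0 U V = ratfun_eval phi x * xden v0 U V by rewrite -zq divfK.
rewrite !hvalE // xx dq /ratfun_eval; apply/eqP; rewrite subr_eq0; apply/eqP.
by move: qx'; move: q.[x] p.[x] (xden _ _ _) (_ ^+ e) => u1 u2 u3 u4 u1n; field.
Qed.

End PullbackRelation.

(** * Klein coverings *)

Section Assembly.
Variable R : realType.
Local Notation C := R[i].

Lemma perm_eq3 (T : eqType) (x y z a b c : T) : perm_eq [:: x; y; z] [:: a; b; c] ->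
  [\/ [:: x; y; z] = [:: a; b; c] \/ [:: x; y; z] = [:: a; c; b],
      [:: x; y; z] = [:: b; a; c] \/ [:: x; y; z] = [:: b; c; a] |
      [:: x; y; z] = [:: c; a; b] \/ [:: x; y; z] = [:: c; b; a]].
Proof.
have perm2 (u v w t : T) : perm_eq [:: u; v] [:: w; t] -> [:: u; v] = [:: w; t] \/ [:: u; v] = [:: t; w].
  move=> h; have : u \in [:: w; t] by rewrite -(perm_mem h) mem_head.
  rewrite !inE => /orP[]/eqP ue; move: h; rewrite ue.
    by rewrite perm_cons => h1; left; congr (_ :: _); apply: perm_small_eq h1.
  move=> h; right; have : perm_eq [:: t; v] [:: t; w].
    by apply: perm_trans h _; exact: permEl (perm_catC [:: w] [:: t]).
  by rewrite perm_cons => h1; congr (_ :: _); apply: perm_small_eq h1.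
move=> h; have : x \in [:: a; b; c] by rewrite -(perm_mem h) mem_head.
rewrite !inE => /or3P[]/eqP xe; move: h; rewrite xe.
- by rewrite perm_cons => /perm2[] ->; constructor 1; [left|right].
- move=> h; have : perm_eq [:: b; y; z] [:: b; a; c].
    by apply: perm_trans h _; exact: permEl (perm_catCA [:: a] [:: b] [:: c]).
  by rewrite perm_cons => /perm2[] ->; constructor 2; [left|right].
- move=> h; have : perm_eq [:: c; y; z] [:: c; a; b].
    by apply: perm_trans h _; exact: permEl (perm_catC [:: a; b] [:: c]).
  by rewrite perm_cons => /perm2[] ->; constructor 3; [left|right].
Qed.

Lemma eq_up_to_sign_sqr (x y : C) : eq_up_to_sign x y -> x ^+ 2 = y ^+ 2.
Proof. by case/orP => /eqP ->; rewrite ?sqrrN. Qed.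

(** The signs of the exponent differences disappear in the squares, in which
    alone [ode_identity] compares them with [k], [l] and [a]. *)
Lemma is_E_place (k l a : C) (H : hypergeometric_eq R) : is_E (k + 1 / 2) (l + 1 / 2) a H ->
  exists v (k' l' : C), ((k', l') = (k, l) \/ (k', l') = (l, k)) /\
    [/\ (1 - paramC H) ^+ 2 = diff0 v k' l' a ^+ 2,
        (paramC H - paramA H - paramB H) ^+ 2 = diff1 v k' l' a ^+ 2 &
        (paramA H - paramB H) ^+ 2 = diffoo v k' l' a ^+ 2].
Proof.
case=> [[|x [|y [|z [|]]]]] //= h; rewrite ?andbF //.
move=> /and4P[/eq_up_to_sign_sqr -> /eq_up_to_sign_sqr -> /eq_up_to_sign_sqr -> _].
case: (perm_eq3 h) => -[] [-> -> ->].
- by exists Placeoo, k, l; split; [left|].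
- by exists Place1, k, l; split; [left|].
- by exists Placeoo, l, k; split; [right|].
- by exists Place1, l, k; split; [right|].
- by exists Place0, k, l; split; [left|].
- by exists Place0, l, k; split; [right|].
Qed.

Lemma coprime_ratio_nonnat (n m : nat) : (1 < m)%N -> coprime n m ->
  forall j : nat, (n%:R / m%:R : C) != j%:R.
Proof.
move=> m1 cop j; have m0 : m%:R != 0 :> C by rewrite pnatr_eq0; lia.
apply/eqP => /(canRL (divfK m0)) /eqP; rewrite -natrM eqr_nat => /eqP nE.
by move: cop; rewrite nE coprimeMl /coprime gcdnn => /andP[_ /eqP m1']; rewrite m1' in m1.
Qed.

Lemma ratio_nonneg (n m : nat) : (0 < m)%N -> forall j : nat, 1 + n%:R / m%:R + j%:R != 0 :> C.
Proof.
move=> m0 j; have mn0 : m%:R != 0 :> C by rewrite pnatr_eq0 -lt0n.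
have -> : 1 + n%:R / m%:R + j%:R = (m + n + j * m)%:R / m%:R :> C.
  by rewrite !natrD natrM; field.
by rewrite mulf_neq0 ?invr_eq0 // pnatr_eq0 -lt0n; lia.
Qed.

Section Params.
Variables (k l m n : nat).
Hypothesis m_gt1 : (1 < m)%N.
Hypothesis n_gt0 : (0 < n)%N.
Hypothesis n_coprime_m : coprime n m.
Local Notation a := (n%:R / m%:R : C).

Lemma dihedral_eq_klein v (H : hypergeometric_eq R) :
  (1 - paramC H) ^+ 2 = diff0 v k%:R l%:R a ^+ 2 ->
  (paramC H - paramA H - paramB H) ^+ 2 = diff1 v k%:R l%:R a ^+ 2 ->
  (paramA H - paramB H) ^+ 2 = diffoo v k%:R l%:R a ^+ 2 ->
  dihedral_eq v k l m n (klein_poly k l a) H.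
Proof.
move=> h0 h1 hoo; have m0 := ltnW m_gt1; split => //.
- exact: coprime_ratio_nonnat.
- exact: (klein_poly_ode k l (ratio_nonneg n m0)).
- exact: klein_poly_N1.
Qed.
End Params.

Lemma is_E_dihedral (k l m n : nat) (H : hypergeometric_eq R) :
  (1 < m)%N -> (0 < n)%N -> coprime n m -> is_E (k%:R + 1 / 2) (l%:R + 1 / 2) (n%:R / m%:R) H ->
  exists v (k' l' : nat) G, (k' + l' = k + l)%N /\ dihedral_eq v k' l' m n G H.
Proof.
move=> m1 n0 cop /is_E_place[v [k' [l' [[[-> ->]|[-> ->]] [h0 h1 hoo]]]]].
  by exists v, k, l, (klein_poly k l (n%:R / m%:R)); split => //; exact: dihedral_eq_klein.
by exists v, l, k, (klein_poly l k (n%:R / m%:R)); split; [rewrite addnC|exact: dihedral_eq_klein].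
Qed.

Lemma dihedral_eq_standard v (m : nat) (H : hypergeometric_eq R) : (1 < m)%N ->
  (1 - paramC H) ^+ 2 = diff0 v 0%:R 0%:R (1%:R / m%:R) ^+ 2 ->
  (paramC H - paramA H - paramB H) ^+ 2 = diff1 v 0%:R 0%:R (1%:R / m%:R) ^+ 2 ->
  (paramA H - paramB H) ^+ 2 = diffoo v 0%:R 0%:R (1%:R / m%:R) ^+ 2 ->
  dihedral_eq v 0 0 m 1 1 H.
Proof.
move=> m1 h0 h1 hoo; split => //; first exact: ltnW.
- exact: (coprime_ratio_nonnat m1 (coprime1n m)).
- by rewrite /klein_op derivC deriv0 !(mulr0, mul0r, add0r, addr0, subr0, subrr, oppr0, scale0r, polyC0, mulr0n).
- by rewrite hornerC oner_neq0.
Qed.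

Lemma is_E_standard (m : nat) (H : hypergeometric_eq R) : (1 < m)%N ->
  is_E (1 / 2) (1 / 2) (1 / m%:R) H -> exists v, dihedral_eq v 0 0 m 1 1 H.
Proof.
move=> m1 h; have {}h : is_E (0%:R + 1 / 2) (0%:R + 1 / 2) (1%:R / m%:R) H by rewrite add0r.
have [v [k' [l' [e hd]]]] := is_E_place h; exists v.
move: hd; have [-> ->] : k' = 0%:R /\ l' = 0%:R by case: e => -[-> ->].
by case; exact: dihedral_eq_standard.
Qed.

(** Both uniqueness and the degree are read off from the expression of a Klein
    covering by the invariants. *)
Lemma klein_covering_invariants v (k l m n : nat) (G : {poly C}) (H1 : hypergeometric_eq R) phi :
  (1 < m)%N -> coprime n m -> dihedral_eq v k l m n G H1 -> klein_covering m H1 phi ->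
  ratfun_degree phi = (n + m * (k + l))%N /\
  exists a b g h, moebius_of_invariants v n m (k + l) G (ratfun_degree phi)
    (ratfun_num phi) (ratfun_den phi) a b g h.
Proof.
move=> m1 cop HD [H0 [/(is_E_standard m1)[v0 HD0] _ _ pb]].
have G0 := de_ode HD; have G1 := de_N1 HD; have an := de_nonnat HD.
have [a [b [g [h [det rel]]]]] := pullback_relation pb HD HD0.
have [q0 _ _] := ratfun_fracE phi; have [deg _] := pb.
exact: (klein_degree (de_m_gt0 HD) (de_n_gt0 HD) (klein_poly_size G0 G1 an)
  (klein_poly_1 G0 G1 an) (klein_poly_no_common_root G0 G1 an)
  (prim_root_period R (de_m_gt0 HD)) cop det (ratfun_degree_cover phi) q0 deg rel).
Qed.

Lemma klein_covering_unique v (k l m n : nat) (G : {poly C}) (H1 : hypergeometric_eq R) phi psi :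
  (1 < m)%N -> coprime n m -> dihedral_eq v k l m n G H1 ->
  klein_covering m H1 phi -> klein_covering m H1 psi -> moebius_equivalent phi psi.
Proof.
move=> m1 cop HD hphi hpsi.
have [e1 [a [b [g [h r1]]]]] := klein_covering_invariants m1 cop HD hphi.
have [e2 [a' [b' [g' [h' r2]]]]] := klein_covering_invariants m1 cop HD hpsi.
have G0 := de_ode HD; have G1 := de_N1 HD; have an := de_nonnat HD.
have [sp sq _ _] := ratfun_degree_cover phi; have [sp' sq' _ _] := ratfun_degree_cover psi.
rewrite e2 -e1 in sp' sq' r2.
have [x [y [z [w [det pE qE]]]]] := klein_unique (de_m_gt0 HD) (de_n_gt0 HD) (klein_poly_size G0 G1 an)
  (klein_poly_1 G0 G1 an) (prim_root_period R (de_m_gt0 HD)) cop sp sq sp' sq' r1 r2.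
exists x, y, z, w; split => //.
have [q0 _ phiE] := ratfun_fracE phi; have [q0' _ psiE] := ratfun_fracE psi.
have Q0 : tofrac (ratfun_den phi) != 0 by rewrite tofrac_eq0.
rewrite [in LHS]psiE [in RHS]phiE /ratfun_const pE qE.
have lin u t : tofrac (u *: ratfun_num phi + t *: ratfun_den phi) =
    (tofrac u%:P * (tofrac (ratfun_num phi) / tofrac (ratfun_den phi)) + tofrac t%:P) * tofrac (ratfun_den phi).
  by rewrite -!mul_polyC tofracD !tofracM mulrDl -mulrA divfK.
by rewrite !lin -mulf_div divff // mulr1.
Qed.

End Assembly.

Theorem theorem5p1 (R : realType) (k l m n : nat) (H1 : hypergeometric_eq R)
    (k_gt0 : (0 < k)%N) (l_gt0 : (0 < l)%N) (n_gt0 : (0 < n)%N)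
    (m_gt1 : (1 < m)%N) (n_coprime_m : coprime n m)
    (H1_E : is_E (k%:R + 1 / 2) (l%:R + 1 / 2) (n%:R / m%:R) H1) :
  [/\ monodromy_group_isog H1 'D_(m.*2),
      exists G Theta1 Theta2 : {poly R[i]},
        [/\ forall s : R[i], s != 0 ->
              G.[s] = s ^+ k *
                appellF3 (k%:R + 1) (l%:R + 1) (- k%:R) (- l%:R)
                  (1 + n%:R / m%:R) ((s + 1) / (2 * s)) ((1 + s) / 2),
            (1 + 'X) ^+ n * G ^+ m =
              (Theta1 \Po 'X^2) + 'X^(2 * k + 1) * (Theta2 \Po 'X^2) &
            has_exponent_differences H1
              (k%:R + 1 / 2) (n%:R / m%:R) (l%:R + 1 / 2) ->
            let Phi : {fraction {poly R[i]}} :=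
              tofrac ('X^(2 * k + 1) * Theta2 ^+ 2) / tofrac (Theta1 ^+ 2) in
            [/\ (ratfun_den Phi).[0] != 0, ratfun_eval Phi 0 = 0 &
                forall H0 : hypergeometric_eq R,
                  has_exponent_differences H0 (1 / 2) (1 / m%:R) (1 / 2) ->
                  klein_pullback m H0 H1 Phi]],
      forall phi psi : {fraction {poly R[i]}},
        klein_covering m H1 phi -> klein_covering m H1 psi ->
        moebius_equivalent phi psi &
      forall phi : {fraction {poly R[i]}},
        klein_covering m H1 phi ->
        ratfun_degree phi = ((k + l) * m + n)%N].
Proof.
have m_gt0 := ltnW m_gt1.
have [v [k' [l' [G' [kl HD]]]]] := is_E_dihedral m_gt1 n_gt0 n_coprime_m H1_E.
have an := ratio_nonneg R n m_gt0.
have ode := klein_poly_ode k l an; have N1 := klein_poly_N1 k l (n%:R / m%:R : R[i]).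
have nonnat := coprime_ratio_nonnat R m_gt1 n_coprime_m.
have monodromy := dihedral_monodromy HD m_gt1 n_coprime_m.
split => //.
- have [T1 [T2 thetaE]] := theta_split m_gt0 erefl ode N1 nonnat.
  exists (klein_poly k l (n%:R / m%:R)), T1, T2; split => //.
    by move=> s s0; exact: klein_poly_appell.
  move=> H1_diff Phi.
  have HD1 : dihedral_eq Place1 k l m n (klein_poly k l (n%:R / m%:R)) H1.
    move: H1_diff => /and4P[/eq_up_to_sign_sqr h0 /eq_up_to_sign_sqr h1 /eq_up_to_sign_sqr hoo _].
    exact: dihedral_eq_klein.
  have [den0 eval0] := Phi_eval k T2 (Theta1_0 HD1 thetaE).
  split => //; first by rewrite eval0 addn1 expr0n !mul0r.
  move=> H0 H0_diff.
  have HD0 : dihedral_eq Place1 0 0 m 1 1 H0.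
    move: H0_diff => /and4P[/eq_up_to_sign_sqr h0 /eq_up_to_sign_sqr h1 /eq_up_to_sign_sqr hoo _].
    by apply: dihedral_eq_standard; rewrite //= add0r.
  split => //.
  + exists [:: 1 / 2; 1 / m%:R; 1 / 2] => //.
    by rewrite perm_cons (permEl (perm_catC [:: _] [:: _])).
  + exact: (dihedral_monodromy HD0 m_gt1 (coprime1n m)).
  + exact: (Phi_pullback HD1 HD0 thetaE).
- by move=> phi psi; exact: klein_covering_unique HD.
- move=> phi /(klein_covering_invariants m_gt1 n_coprime_m HD)[-> _].
  by rewrite kl addnC mulnC.
Qed.
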